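(* Let $d\ge1$ and $L\ge0$ be integers and let $x=(x_1,\dots,x_n)\in(\mathbb{S}^d)^n$, where $n=\pi_L$, be $n$ points drawn from the harmonic ensemble. Then \[ \mathbb{E}_{x\in(\mathbb{S}^d)^n}(E_0(x))=n^2V_{\log}(\mathbb{S}^d)-\frac n2\left(\sum_{k=1}^L\frac1{\frac d2+k}+H_{L+d-1}+\psi_0(1/2)-\psi_0(d/2)\right). \]
   Context: $\mathbb{S}^d$ is the unit sphere in $\mathbb{R}^{d+1}$ and $\mu$ its normalized (probability) surface measure. $E_0(x)=\sum_{i\ne j}\log\frac1{\|x_i-x_j\|}$ (sum over ordered pairs) is the discrete logarithmic energy. $H_k=\sum_{j=1}^k\frac1j$ is the $k$th harmonic number and $\psi_0=(\log\Gamma)'$ is the digamma function. The continuous logarithmic energy is \[ V_{\log}(\mathbb{S}^d)=\int_{\mathbb{S}^d}\int_{\mathbb{S}^d}\log\frac1{\|x-y\|}\,d\mu(x)\,d\mu(y)=\tfrac12\left(\psi_0(d)-\psi_0(d/2)\right)-\log2. \] $\Pi_L$ is the space of restrictions to $\mathbb{S}^d$ of polynomials of degree at most $L$ in $d+1$ variables, $\pi_L=\dim\Pi_L=\frac{2L+d}{d}\binom{d+L-1}{L}$, and $K_L(x,y)$ is the reproducing kernel of $\Pi_L$ in $L^2(\mu)$. The harmonic ensemble is the determinantal point process on $\mathbb{S}^d$ with kernel $K_L$ with respect to $\mu$; it has $n=\pi_L$ points a.s., and $x=(x_1,\dots,x_n)$ drawn from it is the random vector in $(\mathbb{S}^d)^n$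 with density $\frac1{n!}\det(K_L(x_i,x_j))_{1\le i,j\le n}$ with respect to $\mu^{\otimes n}$. *)

(* Defs.v *)
From HB Require Import structures.
From mathcomp Require Import all_boot all_order all_algebra.
From mathcomp Require Import all_classical all_reals all_analysis.
From mathcomp Require Import measurable_realfun.
From mathcomp Require mpoly.

Set Implicit Arguments.
Unset Strict Implicit.
Unset Printing Implicit Defensive.

Import Order.TTheory GRing.Theory Num.Theory.
Import numFieldNormedType.Exports.

Local Open Scope classical_set_scope.
Local Open Scope ring_scope.

Lemma sigma_finite_product d1 d2 (T1 : measurableType d1)
    (T2 : measurableType d2) (R : realType)
    (m1 : {sigma_finite_measure set T1 -> \bar R})
    (m2 : {sigma_finite_measure set T2 -> \bar R}) :
  sigma_finite setT (m1 \x m2)%E.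
Proof.
have /sigma_finiteP[F [TF ndF Foo]] := sigma_finiteT m1.
have /sigma_finiteP[G [TG ndG Goo]] := sigma_finiteT m2.
exists (fun n => F n `*` G n).
  rewrite -setXTT TF TG predeqE => -[x y]; split.
    move=> [/= [n _ Fnx] [k _ Gky]]; exists (maxn n k) => //; split.
    - by move: x Fnx; exact/subsetPset/ndF/leq_maxl.
    - by move: y Gky; exact/subsetPset/ndG/leq_maxr.
  by move=> [n _ []/= ? ?]; split; exists n.
move=> k; have [? ?] := Foo k; have [? ?] := Goo k.
split; first exact: measurableX.
by rewrite product_measure1E// lte_mul_pinfty// ge0_fin_numE.
Qed.

Section cons_measure.
Context d (T : measurableType d) (R : realType) (n : nat).
Variable m : {sigma_finite_measure set T -> \bar R}.
Variable m' : {sigma_finite_measure set (n.-tuple T) -> \bar R}.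

Definition tcons (p : T * n.-tuple T) : n.+1.-tuple T := [tuple of p.1 :: p.2].

Lemma measurable_tcons : measurable_fun setT tcons.
Proof. by apply: measurable_cons => //; exact: measurable_snd. Qed.

Definition cons_measure : set (n.+1.-tuple T) -> \bar R :=
  pushforward (m \x m')%E tcons.

Let cons_measure0 : cons_measure set0 = 0%E.
Proof. by rewrite /cons_measure /pushforward preimage_set0 measure0. Qed.

Let cons_measure_ge0 A : (0 <= cons_measure A)%E.
Proof. by rewrite /cons_measure /pushforward; apply: measure_ge0. Qed.

Let cons_measure_sigma_additive : semi_sigma_additive cons_measure.
Proof.
move=> F mF tF mUF; rewrite /cons_measure /pushforward preimage_bigcup.
have mpre A : measurable A -> measurable (tcons @^-1` A).
  by move=> mA; rewrite -[X in measurable X]setTI; exact: measurable_tcons.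
apply: measure_semi_sigma_additive.
- by move=> k; exact: mpre.
- apply/trivIsetP => /= i j _ _ ij; rewrite -preimage_setI.
  by move/trivIsetP : tF => /(_ _ _ _ _ ij) ->//; rewrite preimage_set0.
- by rewrite -preimage_bigcup; exact: mpre.
Qed.

HB.instance Definition _ := isMeasure.Build _ _ _ cons_measure
  cons_measure0 cons_measure_ge0 cons_measure_sigma_additive.

Let cons_measure_sigma_finite : sigma_finite setT cons_measure.
Proof.
have [F TF Foo] := sigma_finite_product m m'.
pose uncons (t : n.+1.-tuple T) : T * n.-tuple T := (thead t, [tuple of behead t]).
have munc : measurable_fun setT uncons.
  apply: measurable_fun_pair; first exact: measurable_tnth.
  exact: measurable_behead.
exists (fun k => uncons @^-1` F k).
  by rewrite -preimage_bigcup -TF.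
move=> k; have [mF Fk] := Foo k; split.
  by rewrite -[X in measurable X]setTI; exact: munc.
rewrite /cons_measure /pushforward (_ : _ @^-1` _ = F k)//.
apply/seteqP; split=> -[x t] /=; rewrite /uncons/= theadE;
  by rewrite (_ : [tuple of _] = t)//; apply: val_inj.
Qed.

HB.instance Definition _ := @Measure_isSigmaFinite.Build _ _ _ cons_measure
  cons_measure_sigma_finite.

End cons_measure.

(* n-fold product of the measure [m] *)
Fixpoint tuple_measure d (T : measurableType d) (R : realType)
    (m : {sigma_finite_measure set T -> \bar R}) (n : nat) :
    {sigma_finite_measure set (n.-tuple T) -> \bar R} :=
  if n is n'.+1 then [the {sigma_finite_measure set _ -> \bar R} of
    cons_measure m (tuple_measure m n')]
  else [the {sigma_finite_measure set _ -> \bar R} of dirac [tuple]].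

Notation Rvec R m := (m.-tuple (measurableTypeR R)).

Lemma tuple_measureS d (T : measurableType d) (R : realType)
    (m : {sigma_finite_measure set T -> \bar R}) n (A : set (n.+1.-tuple T)) :
  tuple_measure m n.+1 A =
  (m \x tuple_measure m n)%E (@tcons _ T n @^-1` A).
Proof. by []. Qed.

Lemma measurable_tuple_box d (T : measurableType d) n (A : set T) :
  measurable A -> measurable [set t : n.-tuple T | forall i, A (tnth t i)].
Proof.
move=> mA.
rewrite (_ : [set t | _] =
    \bigcap_(i in [set: 'I_n]) ((@tnth n T ^~ i) @^-1` A)); last first.
  by apply/seteqP; split=> [t At i _|t At i]; exact: At.
apply: fin_bigcap_measurable => // i _.
by rewrite -[X in measurable X]setTI; exact: measurable_tnth.
Qed.

Lemma tuple_measure_box d (T : measurableType d) (R : realType)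
    (m : {sigma_finite_measure set T -> \bar R}) n (A : set T) :
  measurable A ->
  tuple_measure m n [set t | forall i, A (tnth t i)] = (m A ^+ n)%E.
Proof.
move=> mA; elim: n => [|n IH].
  rewrite expe0 /= diracE mem_set//=; by case.
rewrite tuple_measureS expeS -IH -product_measure1E//; last first.
  exact: measurable_tuple_box.
congr (product_measure1 _ _ _); apply/seteqP; split=> -[x t] /=.
  move=> H; split; first exact: (H ord0).
  by move=> i; have := H (lift ord0 i); rewrite tnthS.
move=> [Ax At] i; case: (unliftP ord0 i) => [j|] ->; last exact: Ax.
by rewrite tnthS.
Qed.

Section sphere.
Context (R : realType).

Definition enorm m (x : Rvec R m) : R :=
  Num.sqrt (\sum_(i < m) (tnth x i : R) ^+ 2).

Definition edist m (x y : Rvec R m) : R :=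
  Num.sqrt (\sum_(i < m) ((tnth x i : R) - (tnth y i : R)) ^+ 2).

Definition unit_ball m : set (Rvec R m) := [set x | enorm x <= 1].

Definition unit_sphere d : set (Rvec R d.+1) := [set x | enorm x = 1].

Arguments unit_ball m : clear implicits.
Arguments unit_sphere d : clear implicits.

Definition radial_proj m (x : Rvec R m) : Rvec R m :=
  [tuple (tnth x i : R) / enorm x | i < m].

Definition lebesgue_Rvec m : {sigma_finite_measure set (Rvec R m) -> \bar R} :=
  tuple_measure (@lebesgue_measure R) m.

(* Normalized surface measure of the sphere, as a measure on the ambient space:
   the surface measure of a subset [A] of the sphere is [d + 1] times the
   volume of the cone [{r x | 0 <= r <= 1, x in A}], and normalizing amounts to
   dividing the volume of the cone by that of the unit ball. It gives mass [1]
   to the sphere, see [sphere_measure_sphere]. *)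
Definition sphere_measure d (A : set (Rvec R d.+1)) : \bar R :=
  (((fine (lebesgue_Rvec d.+1 (unit_ball d.+1)))^-1)%:E *
   lebesgue_Rvec d.+1 (unit_ball d.+1 `&` @radial_proj d.+1 @^-1` A))%E.

Arguments sphere_measure d A : clear implicits.

Lemma enorm_ge0 m (x : Rvec R m) : 0 <= enorm x.
Proof. exact: sqrtr_ge0. Qed.

Lemma sqr_enorm m (x : Rvec R m) :
  enorm x ^+ 2 = \sum_(i < m) (tnth x i : R) ^+ 2.
Proof. by rewrite sqr_sqrtr// sumr_ge0// => i _; exact: sqr_ge0. Qed.

Lemma measurable_enorm m : measurable_fun setT (@enorm m).
Proof.
apply: (@measurableT_comp _ _ _ _ _ _ (@Num.sqrt R)).
  by apply: continuous_measurable_fun; exact: sqrt_continuous.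
apply: (@measurable_sum _ _ _ _ _ _ (fun i (x : Rvec R m) => (tnth x i : R) ^+ 2)) => i.
apply: measurable_funX; exact: measurable_tnth.
Qed.

Lemma measurable_radial_proj m : measurable_fun setT (@radial_proj m).
Proof.
apply/measurable_fun_tnthP => i.
rewrite (_ : _ \o _ = fun x : Rvec R m => (tnth x i : R) * enorm x `^ (-1)).
  apply: measurable_funM; first exact: measurable_tnth.
  apply: (@measurableT_comp _ _ _ _ _ _ (@powR R ^~ (-1))) => //.
  exact: measurable_enorm.
by apply/funext => x /=; rewrite tnth_mktuple powR_inv1// enorm_ge0.
Qed.

Lemma measurable_unit_ball m : measurable (unit_ball m).
Proof.
rewrite (_ : unit_ball m = setT `&` @enorm m @^-1` `]-oo, 1]%classic).
  exact: measurable_enorm.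
by apply/seteqP; split=> x /=; rewrite /unit_ball /= in_itv/= => // -[].
Qed.

Lemma measurable_box m (a b : R) :
  measurable [set x : Rvec R m | forall i, a <= (tnth x i : R) <= b].
Proof.
rewrite (_ : [set x | _] =
    [set x : Rvec R m | forall i, `[a, b]%classic (tnth x i : R)]).
  exact: measurable_tuple_box.
by apply/seteqP; split=> x xab i; have := xab i; rewrite /= in_itv.
Qed.

Lemma lebesgue_Rvec_box m (a b : R) : a <= b ->
  lebesgue_Rvec m [set x | forall i, a <= (tnth x i : R) <= b] =
  ((b - a) ^+ m)%:E.
Proof.
move=> ab; rewrite (_ : [set x | _] =
    [set x : Rvec R m | forall i, `[a, b]%classic (tnth x i : R)]).
  have E := @tuple_measure_box _ _ R (@lebesgue_measure R) m `[a, b]%classic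
    (measurable_itv _).
  have I : @lebesgue_measure R `[a, b]%classic = (b - a)%:E.
    rewrite lebesgue_measure_itv/= lte_fin; case: ltP => // ba.
    by rewrite (le_anti (introT andP (conj ab ba))) subrr.
  rewrite EFin_expe -I; exact: E.
by apply/seteqP; split=> x xab i; have := xab i; rewrite /= in_itv.
Qed.

Lemma lebesgue_unit_ball_lty m : (lebesgue_Rvec m (unit_ball m) < +oo)%E.
Proof.
apply: (@le_lt_trans _ _
  (lebesgue_Rvec m [set x | forall i, -1 <= (tnth x i : R) <= 1])); last first.
  by rewrite lebesgue_Rvec_box ?ltry// (le_trans _ ler01)// lerN10.
apply: le_measure; rewrite ?inE//.
- exact: measurable_unit_ball.
- exact: measurable_box.
move=> x x1 i /=; rewrite -ler_norml.
rewrite -(@ler_pXn2r _ 2) ?nnegrE// expr1n real_normK ?num_real//.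
apply: (@le_trans _ _ (enorm x ^+ 2)); last by rewrite expr_le1 ?enorm_ge0.
by rewrite sqr_enorm (bigD1 i)//= lerDl sumr_ge0// => j _; exact: sqr_ge0.
Qed.

Lemma lebesgue_unit_ball_gt0 m : (0 < lebesgue_Rvec m.+1 (unit_ball m.+1))%E.
Proof.
pose e : R := m.+1%:R^-1.
have e0 : 0 < e by rewrite invr_gt0.
apply: (@lt_le_trans _ _
    (lebesgue_Rvec m.+1 [set x | forall i, 0 <= (tnth x i : R) <= e])).
  by rewrite lebesgue_Rvec_box ?ltW// lte_fin exprn_gt0// subr0.
apply: le_measure; rewrite ?inE//.
- exact: measurable_box.
- exact: measurable_unit_ball.
move=> x xB; rewrite /unit_ball/= -(@ler_pXn2r _ 2) ?nnegrE ?enorm_ge0//.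
rewrite expr1n sqr_enorm (@le_trans _ _ (\sum_(i < m.+1) e))//.
  apply: ler_sum => i _; have /andP[x0 xe] := xB i.
  apply: (@le_trans _ _ (e ^+ 2)); first by rewrite ler_pXn2r ?nnegrE// ltW.
  rewrite expr2 -[leRHS]mulr1 ler_pM2l// invf_le1//.
  by rewrite ler1n.
by rewrite sumr_const card_ord -mulr_natr mulVf.
Qed.

Section sphere_measure_instance.
Variable d : nat.

Let mrad A : measurable A ->
  measurable (unit_ball d.+1 `&` @radial_proj d.+1 @^-1` A).
Proof.
move=> mA; apply: measurableI; first exact: measurable_unit_ball.
by rewrite -[X in measurable X]setTI; exact: measurable_radial_proj.
Qed.

Let sphere_measure0 : sphere_measure d set0 = 0%E.
Proof. by rewrite /sphere_measure preimage_set0 setI0 measure0 mule0. Qed.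

Let sphere_measure_ge0 A : (0 <= sphere_measure d A)%E.
Proof.
by rewrite /sphere_measure mule_ge0// lee_fin invr_ge0 fine_ge0.
Qed.

Let sphere_measure_sigma_additive : semi_sigma_additive (sphere_measure d).
Proof.
move=> F mF tF mUF; rewrite /sphere_measure.
rewrite preimage_bigcup setI_bigcupr.
rewrite [X in X @ _ --> _](_ : _ = (fun n =>
    (fine (lebesgue_Rvec d.+1 (unit_ball d.+1)))^-1%:E *
    \sum_(0 <= i < n) lebesgue_Rvec d.+1
      (unit_ball d.+1 `&` @radial_proj d.+1 @^-1` F i))%E); last first.
  by apply/funext => n; rewrite ge0_sume_distrr.
apply: cvgeZl => //; apply: measure_semi_sigma_additive.
- by move=> i; exact: mrad.
- apply/trivIsetP => /= i j _ _ ij.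
  move/trivIsetP : tF => /(_ _ _ I I ij) Fij.
  by rewrite setIACA setIid -preimage_setI Fij preimage_set0 setI0.

- by rewrite -setI_bigcupr -preimage_bigcup; exact: mrad.
Qed.

HB.instance Definition _ := isMeasure.Build _ _ _ (sphere_measure d)
  sphere_measure0 sphere_measure_ge0 sphere_measure_sigma_additive.

Let sphere_measureT : sphere_measure d setT = 1%E.
Proof.
rewrite /sphere_measure preimage_setT setIT.
have l0 := lebesgue_unit_ball_gt0 d; have loo := lebesgue_unit_ball_lty d.+1.
rewrite -[X in (_ * X)%E]fineK ?ge0_fin_numE// -EFinM mulVf//.
by rewrite gt_eqF// fine_gt0// l0.
Qed.

HB.instance Definition _ := Measure_isProbability.Build _ _ _ (sphere_measure d)
  sphere_measureT.

Lemma measurable_unit_sphere : measurable (unit_sphere d).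
Proof.
rewrite (_ : unit_sphere d = setT `&` @enorm d.+1 @^-1` [set 1]).
  exact: measurable_enorm.
by rewrite setTI.
Qed.

Lemma sphere_measure_sphere : sphere_measure d (unit_sphere d) = 1%E.
Proof.
rewrite -sphere_measureT -[in RHS](setvU (unit_sphere d)) measureU; last 3 first.
- by apply: measurableC; exact: measurable_unit_sphere.
- exact: measurable_unit_sphere.
- exact: setICl.
rewrite [X in (X + _)%E](_ : _ = 0%E) ?add0e//.
rewrite -[LHS]/(sphere_measure d (~` unit_sphere d)) /sphere_measure.
rewrite [X in (_ * X)%E](_ : _ = 0%E) ?mule0//.
apply/eqP; rewrite -measure_le0.
apply: (@le_trans _ _
    (lebesgue_Rvec d.+1 [set x | forall i, 0 <= (tnth x i : R) <= 0])); last first.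
  by rewrite lebesgue_Rvec_box// subrr expr0n.
apply: le_measure; rewrite ?inE//.
- by apply: mrad; apply: measurableC; exact: measurable_unit_sphere.
- exact: measurable_box.
move=> x [_ /= nx]; apply: contrapT => xB; apply: nx.
have x0 : enorm x != 0.
  apply/negP => /eqP x0; apply: xB => i; rewrite -eq_le eq_sym; apply/eqP.
  have /eqP : \sum_(i < d.+1) (tnth x i : R) ^+ 2 = 0.
    by rewrite -sqr_enorm x0 expr0n.
  rewrite psumr_eq0; last by move=> j _; exact: sqr_ge0.
  by move=> /allP/(_ i (mem_index_enum _)); rewrite sqrf_eq0 => /eqP.
rewrite /unit_sphere/= /enorm.
under eq_bigr do rewrite tnth_mktuple exprMn.
rewrite -mulr_suml -sqr_enorm exprVn mulfV ?sqrtr1//.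
by rewrite expf_neq0.
Qed.

End sphere_measure_instance.

End sphere.

Arguments unit_ball R m : clear implicits.
Arguments unit_sphere R d : clear implicits.
Arguments sphere_measure R d A : clear implicits.

Section special_functions.
Context (R : realType).

Definition gamma_fun (x : R) : R :=
  \int[@lebesgue_measure R]_(t in `]0, +oo[) (t `^ (x - 1) * expR (- t)).

Definition digamma : R -> R := derive1 (fun x => ln (gamma_fun x)).

Definition harmonic_number (k : nat) : R := \sum_(1 <= j < k.+1) j%:R^-1.

End special_functions.

Section log_energy.
Context (R : realType) (d : nat).

(* For coinciding points the summand is [ln 0^-1 = ln 0 = 0], not [+oo]. *)
Definition log_energy n (x : n.-tuple (Rvec R d.+1)) : R :=
  \sum_(i < n) \sum_(j < n | j != i) ln (edist (tnth x i) (tnth x j))^-1.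

Definition V_log : \bar R :=
  (\int[sphere_measure R d]_(x in unit_sphere R d)
    \int[sphere_measure R d]_(y in unit_sphere R d) (ln (edist x y)^-1)%:E)%E.

End log_energy.
Arguments V_log : clear implicits.

Section harmonic_ensemble.
Context (R : realType) (d : nat).
Implicit Types (V : set (Rvec R d.+1 -> R)) (f : Rvec R d.+1 -> R)
  (K : Rvec R d.+1 -> Rvec R d.+1 -> R).

(* Functions on the sphere are represented by functions on the ambient space
   of which only the values on the sphere are ever looked at. *)
Definition sphere_polynomials (L : nat) : set (Rvec R d.+1 -> R) :=
  [set f | exists p : mpoly.mpoly d.+1 R,
    all (fun m => mpoly.mdeg m <= L)%N (mpoly.msupp p) /\
    forall x, unit_sphere R d x ->
      f x = mpoly.meval (fun i => (tnth x i : R)) p].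

Definition has_dim_on_sphere V (n : nat) : Prop :=
  exists b : 'I_n -> Rvec R d.+1 -> R,
    [/\ forall i, V (b i),
        forall c : 'I_n -> R,
          (forall x, unit_sphere R d x -> \sum_(i < n) c i * b i x = 0) ->
          forall i, c i = 0
      & forall f, V f -> exists c : 'I_n -> R,
          forall x, unit_sphere R d x -> f x = \sum_(i < n) c i * b i x].

(* [V] is meant to be finite-dimensional, with the inner product of
   L^2(sphere_measure). *)
Definition is_reproducing_kernel V K : Prop :=
  forall x, unit_sphere R d x ->
    V (fun y => K y x) /\
    forall f, V f ->
      (\int[sphere_measure R d]_(y in unit_sphere R d) (f y * K y x)%:E
       = (f x)%:E)%E.

Definition determinantal_density n K (x : n.-tuple (Rvec R d.+1)) : R :=
  n`!%:R^-1 * \det (\matrix_(i < n, j < n) K (tnth x i) (tnth x j)).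

Definition determinantal_law n K (A : set (n.-tuple (Rvec R d.+1))) : \bar R :=
  (\int[tuple_measure (sphere_measure R d) n]_(x in
      A `&` [set x | forall i, unit_sphere R d (tnth x i)])
    (determinantal_density K x)%:E)%E.

End harmonic_ensemble.
Arguments sphere_polynomials : clear implicits.

(* Main.v *)
(* The kernel factors as K(x, y) = sum_l b_l(x) c_l(y) with biorthogonal families
   (b_l) and (c_l), so det (K(x_i, x_j)) is a product of two determinants; expanding
   both by Leibniz and integrating out all but two points leaves
     E = \int\int log (1 / |x - y|) (K(x, x) K(y, y) - K(x, y)^2).
   By rotation invariance K(x, x) = n, and with y at the pole K(x, y) = k(v) for a
   polynomial k in v = |x - y|^2 / 4, so that log |x - y| = log 2 + (log v) / 2 and
   only the moment \int k^2 log v remains. The polynomial k is an eigenfunction of a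
   Jacobi operator, which is symmetric for the form \int v p q and, up to an explicit
   error, for \int v p q log v; this gives rational recurrences for the coefficients
   c_j of k and for the moments \int k v^j log v, whence c_j \int k v^j log v for
   j > 0. The moment j = 0 comes from the derivative at 0 of a polynomial whose roots
   1, ..., L express that \int k v^s = 0 for 0 < s <= L. Finally \int log v is a
   series that Gauss' formula sums to values of the digamma function. *)
Require Import Defs.
From HB Require Import structures.
From mathcomp Require Import all_boot all_order all_algebra.
From mathcomp Require Import fingroup perm.
From mathcomp Require Import all_classical all_reals all_analysis.
From mathcomp Require Import measurable_realfun.
From mathcomp Require mpoly.
From mathcomp Require Import ring lra.

Import Order.TTheory GRing.Theory Num.Theory.
Import numFieldNormedType.Exports.

Local Open Scope classical_set_scope.
Local Open Scope ring_scope.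
Set Implicit Arguments.
Unset Strict Implicit.
Unset Printing Implicit Defensive.

(** * Rotations of the Euclidean space *)

(** The law of [v] is never computed. With a = d/2 it is the Beta(a, a) law, but the only fact
    extracted from the surface measure is its invariance under plane rotations, which comes down to
    translation invariance of the Lebesgue measure because a rotation is a product of three shears.
    Letting the angle tend to 0 yields one integration by parts for polynomials in [v], and this
    identity determines all moments. The logarithm is singular at the pole, so it is reached through
    its Taylor polynomials at 1, whose error is controlled by the same identity. The Jacobi operator
    enters because reproduction at v = 0 says that [k] is orthogonal to v q for deg q < L: it is an
    orthogonal polynomial for the weight v^a (1 - v)^(a-1), one power of v above Beta(a, a). The
    harmonic number H_L coming from the moment j = 0 cancels against the 1/j in the moments j > 0,
    so that only the sums of 1/(d + i) and of 1/(j + a) survive. *)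

Section shear.
Context (R : realType).

Lemma lebesgue_measure_shift (c : R) (A : set R) : measurable A ->
  pushforward (@lebesgue_measure R) (fun x : measurableTypeR R => x + c : measurableTypeR R) A =
  lebesgue_measure A.
Proof.
have mc : measurable_fun setT (fun x : measurableTypeR R => x + c : measurableTypeR R).
  by apply: measurable_funD.
pose mixin := isMeasurableFun.Build _ _ _ _ _ mc.
pose phi : {mfun _ >-> _} := HB.pack (fun x : measurableTypeR R => x + c : measurableTypeR R) mixin.
move=> mA; apply/esym.
apply: (@lebesgue_measure_unique R (pushforward (@lebesgue_measure R) phi)) => //= _ [[a b]] _ <-.
rewrite /pushforward (_ : _ @^-1` _ = `](a - c), (b - c)]%classic).
  rewrite [in LHS]lebesgue_measure_itv [in RHS]lebesgue_measure_itv /= !lte_fin ltrD2r -!EFinB.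
  by rewrite (_ : b - c - (a - c) = b - a)//; ring.
by apply/seteqP; split=> x /=; rewrite !in_itv/= ltrBlDr lerBrDr.
Qed.

Lemma ge0_integral_shift (c : R) (f : measurableTypeR R -> \bar R) :
  measurable_fun setT f -> (forall x, 0 <= f x)%E ->
  (\int[@lebesgue_measure R]_x f (x + c)%R = \int[@lebesgue_measure R]_x f x)%E.
Proof.
move=> mf f0.
have mc : measurable_fun setT (fun x : measurableTypeR R => x + c : measurableTypeR R).
  by apply: measurable_funD.
have := @ge0_integral_pushforward _ _ _ _ R _ mc (@lebesgue_measure R) setT f measurableT mf (fun _ _ => f0 _).
rewrite preimage_setT => <-.
pose mixin := isMeasurableFun.Build _ _ _ _ _ mc.
pose phi : {mfun _ >-> _} := HB.pack (fun x : measurableTypeR R => x + c : measurableTypeR R) mixin.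
apply: (@eq_measure_integral _ _ _ setT lebesgue_measure (pushforward (@lebesgue_measure R) phi)) => A mA _; exact: lebesgue_measure_shift.
Qed.

End shear.

Section tuple_integral.
Context d (T : measurableType d) (R : realType).
Variable m : {sigma_finite_measure set T -> \bar R}.

Lemma ge0_integral_tupleS n (f : n.+1.-tuple T -> \bar R) :
  measurable_fun setT f -> (forall t, 0 <= f t)%E ->
  (\int[tuple_measure m n.+1]_t f t =
   \int[m]_x \int[tuple_measure m n]_t f (tcons (x, t)))%E.
Proof.
move=> mf f0.
transitivity (\int[m \x tuple_measure m n]_z (f \o @tcons _ T n) z)%E.
  rewrite -[LHS]/(integral (pushforward (m \x tuple_measure m n)%E (@tcons _ T n)) setT f).
  rewrite ge0_integral_pushforward ?preimage_setT//.
  exact: measurable_tcons.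
rewrite fubini_tonelli1//; last by move=> z; exact: f0.
by apply: measurableT_comp => //; exact: measurable_tcons.
Qed.

Lemma ge0_integral_tupleS_swap n (f : n.+1.-tuple T -> \bar R) :
  measurable_fun setT f -> (forall t, 0 <= f t)%E ->
  (\int[tuple_measure m n.+1]_t f t =
   \int[tuple_measure m n]_t \int[m]_x f (tcons (x, t)))%E.
Proof.
move=> mf f0; rewrite ge0_integral_tupleS//.
apply: (@fubini_tonelli _ _ _ _ _ m (tuple_measure m n) (f \o @tcons _ T n)).
  by apply: measurableT_comp => //; exact: measurable_tcons.
by move=> z; exact: f0.
Qed.

Lemma measurable_tcons2 n x : measurable_fun setT (fun t => @tcons _ T n (x, t)).
Proof.
apply: (measurableT_comp (f := @tcons _ T n) (g := pair x)) => //.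
exact: measurable_tcons.
Qed.

Lemma measurable_tcons1 n t : measurable_fun setT (fun x => @tcons _ T n (x, t)).
Proof.
apply: (measurableT_comp (f := @tcons _ T n) (g := pair^~ t)) => //.
exact: measurable_tcons.
Qed.

End tuple_integral.

Section coordinate_shear.
Context (R : realType).

Definition shear n (i : 'I_n) (phi : Rvec R n -> R) (t : Rvec R n) : Rvec R n :=
  [tuple if k == i then (tnth t k : R) + phi t else tnth t k | k < n].

Lemma measurable_shear n (i : 'I_n) phi : measurable_fun setT phi ->
  measurable_fun setT (shear i phi).
Proof.
move=> mphi; apply/measurable_fun_tnthP => k.
rewrite (_ : _ \o _ = fun t : Rvec R n =>
  if k == i then (tnth t k : R) + phi t else tnth t k); last first.
  by apply/funext => t /=; rewrite tnth_mktuple.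
case: (k == i); last exact: measurable_tnth.
by apply: measurable_funD => //; exact: measurable_tnth.
Qed.

Lemma tcons_lift n (x : measurableTypeR R) (t : Rvec R n) i : tnth (tcons (x, t)) (lift ord0 i) = tnth t i.
Proof. by rewrite tnthS. Qed.

Lemma tcons_ord0 n (x : measurableTypeR R) (t : Rvec R n) : tnth (tcons (x, t)) ord0 = x.
Proof. by []. Qed.

(** Induction on the dimension. If [i] is not the head, the head is frozen and absorbed into [phi];
    if it is, the head is integrated innermost, where [phi] is constant because it ignores that
    coordinate, and translation invariance applies. *)
Lemma ge0_integral_shear n (i : 'I_n) (phi : Rvec R n -> R) (f : Rvec R n -> \bar R) :
  measurable_fun setT phi ->
  (forall t u : Rvec R n, (forall k, k != i -> tnth t k = tnth u k) -> phi t = phi u) ->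
  measurable_fun setT f -> (forall t, 0 <= f t)%E ->
  (\int[lebesgue_Rvec R n]_t f (shear i phi t) = \int[lebesgue_Rvec R n]_t f t)%E.
Proof.
rewrite /lebesgue_Rvec; elim: n i phi f => [[]//|n IH] i phi f mphi phii mf f0.
have mfs : measurable_fun setT (fun t => f (shear i phi t)).
  by apply: measurableT_comp => //; exact: measurable_shear.
case: (unliftP ord0 i) => [j|] ij.
  rewrite [LHS]ge0_integral_tupleS// [RHS]ge0_integral_tupleS//.
  apply: eq_integral => x _.
  pose psi (t : Rvec R n) := phi (tcons (x, t)).
  rewrite -[RHS](IH j psi)//.
  - apply: eq_integral => t _; congr f.
    apply: eq_from_tnth => k.
    rewrite tnth_mktuple.
    case: (unliftP ord0 k) => [l|] ->.
      by rewrite !tcons_lift tnth_mktuple ij (inj_eq lift_inj).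
    by rewrite !tcons_ord0 ij.
  - by apply: measurableT_comp => //; exact: measurable_tcons2.
  - move=> t u tu; apply: phii => k.
    case: (unliftP ord0 k) => [l|] -> //.
    by rewrite !tcons_lift ij (inj_eq lift_inj); exact: tu.
  - by apply: measurableT_comp => //; exact: measurable_tcons2.
rewrite [LHS]ge0_integral_tupleS_swap// [RHS]ge0_integral_tupleS_swap//.
apply: eq_integral => t _.
(* The head value [0] is arbitrary, since [phi] ignores the head. *)
rewrite -[RHS](ge0_integral_shift (phi (tcons (0 : measurableTypeR R, t))))//.
  apply: eq_integral => x _; congr f.
  apply: eq_from_tnth => k.
  rewrite tnth_mktuple ij.
  case: (unliftP ord0 k) => [l|] ->.
    by rewrite !tcons_lift.
  rewrite !tcons_ord0 eqxx; congr (_ + _); apply: phii => k'.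
  by case: (unliftP ord0 k') => [l|] ->; rewrite ?tcons_lift ?ij.
by apply: measurableT_comp => //; exact: measurable_tcons1.
Qed.

Lemma measure_shear n (i : 'I_n) (phi : Rvec R n -> R) (A : set (Rvec R n)) :
  measurable_fun setT phi ->
  (forall t u : Rvec R n, (forall k, k != i -> tnth t k = tnth u k) -> phi t = phi u) ->
  measurable A ->
  lebesgue_Rvec R n (shear i phi @^-1` A) = lebesgue_Rvec R n A.
Proof.
move=> mphi phii mA.
have msA : measurable (shear i phi @^-1` A).
  by rewrite -[X in measurable X]setTI; exact: measurable_shear.
have intE B : measurable B ->
    (\int[lebesgue_Rvec R n]_t (EFin \o \1_B) t = lebesgue_Rvec R n B)%E.
  by move=> mB; rewrite integral_indic// setIT.
rewrite -!intE// -[RHS](@ge0_integral_shear _ i phi)//.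
  exact/measurable_EFinP.
by move=> t; rewrite lee_fin.
Qed.

End coordinate_shear.

Section givens.
Context (R : realType).

(* The rotation [(t_i, t_j) |-> (c t_i - s t_j, s t_i + c t_j)] of the plane of
   the coordinates [i] and [j], meaningful when [c ^+ 2 + s ^+ 2 = 1]. *)
Definition givens n (i j : 'I_n) (c s : R) (t : Rvec R n) : Rvec R n :=
  [tuple if k == i then c * (tnth t i : R) - s * (tnth t j : R)
         else if k == j then s * (tnth t i : R) + c * (tnth t j : R)
         else tnth t k | k < n].

Lemma givens_i n (i j : 'I_n) c s t :
  tnth (givens i j c s t) i = c * (tnth t i : R) - s * (tnth t j : R).
Proof. by rewrite tnth_mktuple eqxx. Qed.

Lemma givens_j n (i j : 'I_n) c s t : i != j ->
  tnth (givens i j c s t) j = s * (tnth t i : R) + c * (tnth t j : R).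
Proof. by move=> ij; rewrite tnth_mktuple eq_sym (negbTE ij) eqxx. Qed.

Lemma givens_k n (i j k : 'I_n) c s t : k != i -> k != j ->
  tnth (givens i j c s t) k = tnth t k.
Proof. by move=> /negbTE ki /negbTE kj; rewrite tnth_mktuple ki kj. Qed.

Lemma measurable_givens n (i j : 'I_n) c s : measurable_fun setT (givens i j c s).
Proof.
apply/measurable_fun_tnthP => k.
rewrite (_ : _ \o _ = fun t : Rvec R n =>
  if k == i then c * (tnth t i : R) - s * (tnth t j : R)
  else if k == j then s * (tnth t i : R) + c * (tnth t j : R) else tnth t k); last first.
  by apply/funext => t /=; rewrite tnth_mktuple.
case: (k == i); [|case: (k == j)]; last exact: measurable_tnth.
- by apply: measurable_funB; apply: measurable_funM => //; exact: measurable_tnth.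
- by apply: measurable_funD; apply: measurable_funM => //; exact: measurable_tnth.
Qed.

(** For c = cos theta and s = sin theta the slope (c - 1) / s is - tan (theta / 2): this is the
    classical factorization of a rotation into three shears. It divides by [s], whence the condition
    [s != 0] on rotations. *)
Lemma givens_shear n (i j : 'I_n) (c s : R) (t : Rvec R n) : i != j -> s != 0 ->
  c ^+ 2 + s ^+ 2 = 1 ->
  let f u := (c - 1) / s * (tnth u j : R) in
  givens i j c s t =
  shear i f (shear j (fun u => s * (tnth u i : R)) (shear i f t)).
Proof.
move=> ij s0 cs /=.
have ji : j != i by rewrite eq_sym.
apply: eq_from_tnth => k; rewrite /shear !tnth_mktuple.
rewrite !eqxx (negbTE ji).
case: eqVneq => [->|ki].
  rewrite (negbTE ij).
  transitivity (c * tnth t i - (1 - c ^+ 2) / s * tnth t j); last by field.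
  by rewrite -cs [c ^+ 2 + _]addrC addrK expr2 mulfK.
case: eqVneq => // ->; field.
by rewrite s0.
Qed.

Lemma lebesgue_givens n (i j : 'I_n) (c s : R) (A : set (Rvec R n)) :
  i != j -> s != 0 -> c ^+ 2 + s ^+ 2 = 1 -> measurable A ->
  lebesgue_Rvec R n (givens i j c s @^-1` A) = lebesgue_Rvec R n A.
Proof.
move=> ij s0 cs mA.
have mt (r : R) k : measurable_fun setT (fun u : Rvec R n => r * (tnth u k : R)).
  by apply: measurable_funM => //; exact: measurable_tnth.
pose f (u : Rvec R n) := (c - 1) / s * (tnth u j : R).
pose g (u : Rvec R n) := s * (tnth u i : R).
have fi (t u : Rvec R n) : (forall k, k != i -> tnth t k = tnth u k) -> f t = f u.
  by move=> tu; rewrite /f tu// eq_sym.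
have gj (t u : Rvec R n) : (forall k, k != j -> tnth t k = tnth u k) -> g t = g u.
  by move=> tu; rewrite /g tu.
have mp k h (B : set (Rvec R n)) : measurable_fun setT h -> measurable B ->
    measurable (@shear R n k h @^-1` B).
  by move=> mh mB; rewrite -[X in measurable X]setTI; exact: measurable_shear.
have -> : givens i j c s @^-1` A = shear i f @^-1` (shear j g @^-1` (shear i f @^-1` A)).
  by apply/seteqP; split => t /=; rewrite givens_shear.
have m1 := mp i f A (mt _ _) mA; have m2 := mp j g _ (mt _ _) m1.
rewrite (measure_shear (mt _ _) fi m2) (measure_shear (mt _ _) gj m1).
exact: (measure_shear (mt _ _) fi mA).
Qed.

Lemma sum_givens n (i j : 'I_n) (c s : R) (x y : Rvec R n) :
  i != j -> c ^+ 2 + s ^+ 2 = 1 ->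
  \sum_(k < n) (tnth (givens i j c s x) k : R) * (tnth (givens i j c s y) k : R) =
  \sum_(k < n) (tnth x k : R) * (tnth y k : R).
Proof.
move=> ij cs; have ji : j != i by rewrite eq_sym.
rewrite (bigD1 i)// (bigD1 j)//= [RHS](bigD1 i)// [in RHS](bigD1 j)//=.
rewrite !givens_i !givens_j// !addrA; congr (_ + _); last first.
  by apply: eq_bigr => k /andP[ki kj]; rewrite !givens_k.
transitivity ((c ^+ 2 + s ^+ 2) * ((tnth x i : R) * tnth y i + (tnth x j : R) * tnth y j)); first ring.
by rewrite cs mul1r.
Qed.

End givens.

(** * Polynomials on the sphere *)

Section sphere_polynomials_theory.
Import -(notations) mpoly.
Context (R : realType) (d : nat).
Local Notation S := (unit_sphere R d).
Local Notation mu := (sphere_measure R d).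
Local Notation SP := (sphere_polynomials R d).
Implicit Types (f g : Rvec R d.+1 -> R).

Lemma sphere_polynomialsP L f : SP L f <-> exists p : mpoly d.+1 R,
  (mmeasure (@mdeg d.+1) p <= L.+1)%N /\
  forall x, S x -> f x = meval (fun i => (tnth x i : R)) p.
Proof.
split=> -[p [pL fp]]; exists p; split=> //.
  rewrite msizeE; apply/bigmax_leqP_seq => m mp _.
  by rewrite ltnS; exact: (allP pL).
by apply/allP => m /msize_mdeg_lt mp; rewrite -ltnS (leq_trans mp).
Qed.

Lemma sphere_polynomials_mono L M f : (L <= M)%N -> SP L f -> SP M f.
Proof.
move=> LM /sphere_polynomialsP[p [pL fp]]; apply/sphere_polynomialsP.
by exists p; split => //; exact: leq_trans pL _.
Qed.

Lemma sphere_polynomials_ext L f g : (forall x, S x -> f x = g x) -> SP L g -> SP L f.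
Proof. by move=> fg [p [pL gp]]; exists p; split => // x Sx; rewrite fg// gp. Qed.

Lemma sphere_polynomials_cst L (c : R) : SP L (fun=> c).
Proof.
apply/sphere_polynomialsP; exists (mpolyC d.+1 c); split; last by move=> x _; rewrite mevalC.
by rewrite msizeC (leq_trans (leq_b1 _)).
Qed.

Lemma sphere_polynomials_coord (i : 'I_d.+1) : SP 1 (fun x => tnth x i : R).
Proof.
apply/sphere_polynomialsP; exists (mpolyX R (mnm1 i)); split; last by move=> x _; rewrite mevalXU.
by rewrite msizeX mdeg1.
Qed.

Lemma sphere_polynomialsD L f g : SP L f -> SP L g -> SP L (fun x => f x + g x).
Proof.
move=> /sphere_polynomialsP[p [pL fp]] /sphere_polynomialsP[q [qL gq]].
apply/sphere_polynomialsP; exists (p + q); split; last by move=> x Sx; rewrite mevalD fp// gq.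
by rewrite (leq_trans (msizeD_le _ _))// geq_max pL qL.
Qed.

Lemma sphere_polynomialsM L M f g : SP L f -> SP M g -> SP (L + M) (fun x => f x * g x).
Proof.
move=> /sphere_polynomialsP[p [pL fp]] /sphere_polynomialsP[q [qL gq]].
apply/sphere_polynomialsP; exists (p * q); split; last by move=> x Sx; rewrite mevalM fp// gq.
have [->|p0] := eqVneq p 0; first by rewrite mul0r msize0.
have [->|q0] := eqVneq q 0; first by rewrite mulr0 msize0.
by rewrite msizeM// -subn1 leq_subLR add1n -addSn -addnS leq_add.
Qed.

Lemma sphere_polynomialsZ L (c : R) f : SP L f -> SP L (fun x => c * f x).
Proof. by move=> /(sphere_polynomialsM (sphere_polynomials_cst 0 c)); rewrite add0n. Qed.

Lemma sphere_polynomials_sum L (I : Type) (r : seq I) (P : pred I) (F : I -> Rvec R d.+1 -> R) :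
  (forall i, P i -> SP L (F i)) -> SP L (fun x => \sum_(i <- r | P i) F i x).
Proof.
move=> FL; elim: r => [|i r IH].
  apply: (sphere_polynomials_ext _ (sphere_polynomials_cst L 0)).
  by move=> x _; rewrite big_nil.
case Pi : (P i); last first.
  by apply: sphere_polynomials_ext IH => x _; rewrite big_cons Pi.
apply: (sphere_polynomials_ext _ (sphere_polynomialsD (FL i Pi) IH)).
by move=> x _; rewrite big_cons Pi.
Qed.

Lemma sphere_polynomialsX L f n : SP L f -> SP (L * n) (fun x => f x ^+ n).
Proof.
move=> fL; elim: n => [|n IH]; first by rewrite muln0; exact: sphere_polynomials_cst.
rewrite mulnS; apply: (sphere_polynomials_ext _ (sphere_polynomialsM fL IH)).
by move=> x _; rewrite exprS.
Qed.

Lemma sphere_polynomials_prod (I : finType) (F : I -> Rvec R d.+1 -> R) (m : I -> nat) :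
  (forall i, SP 1 (F i)) -> SP (\sum_i m i)%N (fun x => \prod_i F i x ^+ m i).
Proof.
move=> F1; rewrite -[\sum_i _]/(\sum_(i <- index_enum I) m i)%N.
elim: (index_enum I) => [|i r IH].
  rewrite big_nil; apply: (sphere_polynomials_ext _ (sphere_polynomials_cst 0 1)).
  by move=> x _; rewrite big_nil.
rewrite big_cons; have := sphere_polynomialsX (m i) (F1 i); rewrite mul1n => Fi.
apply: (sphere_polynomials_ext _ (sphere_polynomialsM Fi IH)).
by move=> x _; rewrite big_cons.
Qed.

(** Reduces a property of the space to monomials. Stability under equality on the sphere is required
    because elements of the space are arbitrary elsewhere. *)
Lemma sphere_polynomials_ind L (P : (Rvec R d.+1 -> R) -> Prop) :
  (forall f g, (forall x, S x -> f x = g x) -> P g -> P f) ->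
  P (fun=> 0) -> (forall f g, P f -> P g -> P (fun x => f x + g x)) ->
  (forall c f, P f -> P (fun x => c * f x)) ->
  (forall m : 'I_d.+1 -> nat, (\sum_i m i <= L)%N ->
    P (fun x => \prod_i (tnth x i : R) ^+ m i)) ->
  forall f, SP L f -> P f.
Proof.
move=> Pext P0 PD PZ PX f [p [/allP pL fp]].
apply: (Pext _ _ fp); apply: (Pext _ (fun x => \sum_(m <- msupp p)
    mcoeff m p * \prod_i (tnth x i : R) ^+ m i)).
  by move=> x _; rewrite mevalE.
elim: (msupp p) pL => [_|m r IH pL].
  by apply: Pext P0 => x _; rewrite big_nil.
apply: (Pext _ (fun x => mcoeff m p * \prod_i (tnth x i : R) ^+ m i + \sum_(m <- r)
    mcoeff m p * \prod_i (tnth x i : R) ^+ m i)).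
  by move=> x _; rewrite big_cons.
apply: PD; last by apply: IH => m' mr; apply: pL; rewrite inE mr orbT.
by apply/PZ/PX; rewrite -mdegE; apply: pL; rewrite inE eqxx.
Qed.

End sphere_polynomials_theory.

(** * Integration over the sphere and its invariance under rotations *)

Section sphere_integration.
Context (R : realType) (d : nat).
Local Notation S := (unit_sphere R d).
Local Notation mu := (sphere_measure R d).
Local Notation SP := (sphere_polynomials R d).
Implicit Types (f g : Rvec R d.+1 -> R).

Lemma sphere_sum x : S x <-> \sum_(i < d.+1) (tnth x i : R) * tnth x i = 1.
Proof.
rewrite (eq_bigr (fun i => (tnth x i : R) ^+ 2)); last by move=> i _; rewrite expr2.
rewrite -sqr_enorm; split=> [->|]; first by rewrite expr1n.
by move=> /eqP; rewrite sqrf_eq1 => /orP[/eqP//|/eqP x1]; have := enorm_ge0 x; rewrite x1 ler0N1.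
Qed.

Lemma sphere_coord_le1 x i : S x -> `|(tnth x i : R)| <= 1.
Proof.
move=> /sphere_sum xS; rewrite -(@ler_pXn2r _ 2) ?nnegrE// expr1n real_normK ?num_real//.
by rewrite -xS (bigD1 i)//= -expr2 lerDl sumr_ge0// => j _; rewrite -expr2 sqr_ge0.
Qed.

Lemma measurable_sphere : measurable S.
Proof. exact: measurable_unit_sphere. Qed.

(** An element of the space may fail to be measurable off the sphere, hence the measurable
    representative [g]. *)
Lemma sphere_polynomials_measurable_bounded L f : SP L f ->
  (exists g, measurable_fun setT g /\ forall x, S x -> f x = g x) /\
  (exists M, forall x, S x -> `|f x| <= M).
Proof.
move: f; apply: sphere_polynomials_ind.
- move=> f g fg [[h [mh gh]] [M gM]]; split.
    by exists h; split => // x Sx; rewrite fg// gh.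
  by exists M => x Sx; rewrite fg// gM.
- by split; [exists (fun=> 0); split|exists 0 => x _; rewrite normr0].
- move=> f g [[f' [mf ff]] [M fM]] [[g' [mg gg]] [N gN]]; split.
    exists (fun x => f' x + g' x); split; first exact: measurable_funD.
    by move=> x Sx; rewrite ff// gg.
  by exists (M + N) => x Sx; rewrite (le_trans (ler_normD _ _))// lerD ?fM ?gN.
- move=> c f [[f' [mf ff]] [M fM]]; split.
    exists (fun x => c * f' x); split; first by apply: measurable_funM.
    by move=> x Sx; rewrite ff.
  by exists (`|c| * M) => x Sx; rewrite normrM ler_wpM2l ?fM.
- move=> m mL; split.
    exists (fun x => \prod_i (tnth x i : R) ^+ m i); split => //.
    apply: measurable_prod => i _; apply: measurable_funX; exact: measurable_tnth.
  exists 1 => x Sx; rewrite normr_prod.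
  apply: prodr_ile1 => i _.
  by rewrite normr_ge0/= normrX exprn_ile1// sphere_coord_le1.
Qed.

Lemma sphere_polynomials_measurable L f : SP L f -> measurable_fun S f.
Proof.
move=> /sphere_polynomials_measurable_bounded[[g [mg fg]] _].
apply: (@eq_measurable_fun _ _ _ _ S g); first by move=> x /set_mem Sx; rewrite fg.
exact: measurable_funTS.
Qed.

Lemma bounded_sphere_integrable f (M : R) : measurable_fun S f ->
  (forall x, S x -> `|f x| <= M) -> mu.-integrable S (EFin \o f).
Proof.
move=> mf fM; apply: measurable_bounded_integrable => //.
- exact: measurable_sphere.
- rewrite (@le_lt_trans _ _ (mu setT))//; last by rewrite probability_setT ltry.
  by apply: le_measure; rewrite ?inE//; exact: measurable_sphere.
- exists M; split; first exact: num_real.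
  by move=> N MN x Sx; exact: (le_trans (fM x Sx) (ltW MN)).
Qed.

Lemma sphere_polynomials_integrable L f : SP L f -> mu.-integrable S (EFin \o f).
Proof.
move=> fL; have [_ [M fM]] := sphere_polynomials_measurable_bounded fL.
exact: bounded_sphere_integrable (sphere_polynomials_measurable fL) fM.
Qed.

(** The condition [s != 0] is the one of [givens_shear]; the half turn is recovered as two quarter
    turns. *)
Definition sphere_rotation (i j : 'I_d.+1) (c s : R) :=
  [/\ i != j, s != 0 & c ^+ 2 + s ^+ 2 = 1].

Lemma givens_sphere i j c s x : sphere_rotation i j c s -> S (givens i j c s x) <-> S x.
Proof. by move=> [ij s0 cs]; rewrite !sphere_sum sum_givens. Qed.

Lemma enorm_givens i j c s (x : Rvec R d.+1) : sphere_rotation i j c s ->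
  enorm (givens i j c s x) = enorm x.
Proof.
move=> [ij s0 cs]; congr (Num.sqrt _).
rewrite (eq_bigr (fun k => (tnth (givens i j c s x) k : R) * tnth (givens i j c s x) k)); last by move=> k _; rewrite expr2.
by rewrite sum_givens//; apply: eq_bigr => k _; rewrite expr2.
Qed.

(** A rotation is linear and keeps the norm, so it commutes with [radial_proj]: the preimage of the
    cone over a set is the cone over its preimage. *)
Lemma sphere_measure_givens i j c s (A : set (Rvec R d.+1)) : sphere_rotation i j c s ->
  measurable A -> mu (givens i j c s @^-1` A) = mu A.
Proof.
move=> G mA; have [ij s0 cs] := G.
rewrite /sphere_measure; congr (_ * _)%E.
rewrite -[RHS](lebesgue_givens ij s0 cs); last first.
  apply: measurableI; first exact: measurable_unit_ball.
  by rewrite -[X in measurable X]setTI; exact: measurable_radial_proj.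
congr (lebesgue_Rvec _ _ _); apply/seteqP; split=> x /=.
  move=> [xB xA]; split; first by rewrite /unit_ball/= enorm_givens.
  rewrite (_ : radial_proj _ = givens i j c s (radial_proj x))//.
  apply: eq_from_tnth => k; rewrite !tnth_mktuple enorm_givens//.
  by case: ifP => _; [ring|case: ifP => // _; ring].
move=> [xB xA]; split; first by move: xB; rewrite /unit_ball/= enorm_givens.
rewrite (_ : givens i j c s (radial_proj x) = radial_proj (givens i j c s x))//.
apply: eq_from_tnth => k; rewrite !tnth_mktuple enorm_givens//.
by case: ifP => _; [ring|case: ifP => // _; ring].
Qed.

Lemma givens_preimage_sphere i j c s : sphere_rotation i j c s ->
  givens i j c s @^-1` S = S.
Proof. by move=> G; apply/seteqP; split=> x /= /(givens_sphere x G). Qed.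

Lemma ge0_integral_givens i j c s (f : Rvec R d.+1 -> \bar R) : sphere_rotation i j c s ->
  measurable_fun S f -> (forall x, S x -> 0 <= f x)%E ->
  (\int[mu]_(x in S) f (givens i j c s x) = \int[mu]_(x in S) f x)%E.
Proof.
move=> G mf f0; have mG := measurable_givens i j c s.
pose mixin := isMeasurableFun.Build _ _ _ _ _ mG.
pose phi : {mfun _ >-> _} := HB.pack (givens i j c s) mixin.
have := @ge0_integral_pushforward _ _ _ _ R phi mG (sphere_measure R d) S f
  measurable_sphere mf (fun x xS => f0 x (set_mem xS)).
have E : phi @^-1` S = S := givens_preimage_sphere G.
rewrite E => H; apply: etrans (esym H) _.
by apply: eq_measure_integral => A mA _; exact: sphere_measure_givens.
Qed.

Lemma integral_givens i j c s (f : Rvec R d.+1 -> \bar R) : sphere_rotation i j c s ->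
  measurable_fun S f ->
  (\int[mu]_(x in S) f (givens i j c s x) = \int[mu]_(x in S) f x)%E.
Proof.
move=> G mf; rewrite integralE [RHS]integralE; congr (_ - _)%E.
  rewrite -[X in X^\+%E]/(f \o givens i j c s) funepos_comp.
  exact: (ge0_integral_givens (f := f^\+%E) G (measurable_funepos mf) (fun x _ => funepos_ge0 f x)).
rewrite -[X in X^\-%E]/(f \o givens i j c s) funeneg_comp.
exact: (ge0_integral_givens (f := f^\-%E) G (measurable_funeneg mf) (fun x _ => funeneg_ge0 f x)).
Qed.

Lemma integrable_givens i j c s (f : Rvec R d.+1 -> R) : sphere_rotation i j c s ->
  mu.-integrable S (EFin \o f) -> mu.-integrable S (EFin \o (f \o givens i j c s)).
Proof.
move=> G /integrableP[mf foo]; apply/integrableP; split.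
  apply: (measurable_comp measurable_sphere _ mf).
    by move=> _ [x Sx <-]; exact/givens_sphere.
  exact: measurable_funTS (measurable_givens _ _ _ _).
rewrite (ge0_integral_givens G (f := abse \o (EFin \o f)))//.
  by apply: measurableT_comp.
by move=> x _; exact: abse_ge0.
Qed.

Lemma sphere_polynomials_givens i j c s L f : sphere_rotation i j c s -> SP L f ->
  SP L (f \o givens i j c s).
Proof.
move=> G; move: f; apply: sphere_polynomials_ind.
- move=> f g fg; apply: sphere_polynomials_ext => x Sx /=.
  by rewrite fg//; exact/givens_sphere.
- exact: sphere_polynomials_cst.
- by move=> f g; exact: sphere_polynomialsD.
- by move=> a f; exact: sphere_polynomialsZ.
- move=> m mL; apply: sphere_polynomials_mono mL _.
  apply: (sphere_polynomials_prod (F := fun k x => tnth (givens i j c s x) k : R)) => k.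
  apply: (@sphere_polynomials_ext _ _ _ _ (fun x => if k == i then c * (tnth x i : R) + (- s) * (tnth x j : R)
         else if k == j then s * (tnth x i : R) + c * (tnth x j : R)
         else tnth x k)).
    by move=> x _; rewrite tnth_mktuple mulNr.
  case: (k == i); last case: (k == j); last exact: sphere_polynomials_coord.
  + by apply: sphere_polynomialsD; apply: sphere_polynomialsZ; exact: sphere_polynomials_coord.
  + by apply: sphere_polynomialsD; apply: sphere_polynomialsZ; exact: sphere_polynomials_coord.
Qed.

End sphere_integration.

(** * Integration by parts along rotations *)

Section real_integrable.
Context dT (T : measurableType dT) (R : realType) (m : {measure set T -> \bar R}).
Variables (D : set T) (mD : measurable D).
Implicit Types f g : T -> R.

Lemma real_integrableD f g : m.-integrable D (EFin \o f) -> m.-integrable D (EFin \o g) ->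
  m.-integrable D (EFin \o (fun x => f x + g x)).
Proof. by move=> fi gi; apply: eq_integrable (integrableD mD fi gi). Qed.

Lemma real_integrableB f g : m.-integrable D (EFin \o f) -> m.-integrable D (EFin \o g) ->
  m.-integrable D (EFin \o (fun x => f x - g x)).
Proof. by move=> fi gi; apply: eq_integrable (integrableB mD fi gi). Qed.

Lemma real_integrableZl (c : R) f : m.-integrable D (EFin \o f) ->
  m.-integrable D (EFin \o (fun x => c * f x)).
Proof. by move=> fi; apply: eq_integrable (integrableZl mD c fi). Qed.

Lemma EFin_Rintegral f : m.-integrable D (EFin \o f) ->
  (\int[m]_(x in D) (f x)%:E)%E = (\int[m]_(x in D) f x)%:E.
Proof. by move=> fi; rewrite fineK// integrable_fin_num. Qed.

Lemma real_integrable_sum (I : Type) (r : seq I) (P : pred I) (F : I -> T -> R) :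
  (forall i, P i -> m.-integrable D (EFin \o F i)) ->
  m.-integrable D (EFin \o (fun x => \sum_(i <- r | P i) F i x)).
Proof.
move=> Fi; rewrite (_ : _ \o _ = fun x => (\sum_(i <- r | P i) (F i x)%:E)%E).
  exact: (@integrable_sum _ _ _ _ _ mD _ r P (fun i x => (F i x)%:E)).
by apply/funext => x /=; rewrite sumEFin.
Qed.

Lemma Rintegral_sum (I : Type) (r : seq I) (P : pred I) (F : I -> T -> R) :
  (forall i, P i -> m.-integrable D (EFin \o F i)) ->
  \int[m]_(x in D) (\sum_(i <- r | P i) F i x) = \sum_(i <- r | P i) \int[m]_(x in D) F i x.
Proof.
move=> Fi; elim: r => [|i r IH].
  by rewrite big_nil; under eq_Rintegral do rewrite big_nil; rewrite Rintegral_cst// mul0r.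
rewrite big_cons; under eq_Rintegral do rewrite big_cons.
case Pi : (P i) => //; rewrite RintegralD ?IH//; first exact: Fi.
exact: real_integrable_sum.
Qed.

End real_integrable.

Section rotation_derivative.
Context (R : realType) (d : nat).
Local Notation S := (unit_sphere R d).
Local Notation mu := (sphere_measure R d).
Local Notation SP := (sphere_polynomials R d).
Implicit Types (f g : Rvec R d.+1 -> R).

Definition bounded_on_sphere f := exists M : R, forall x, S x -> `|f x| <= M.

(* [f'] is the derivative of [f] along the rotation of angle [asin s] at [s = 0],
   with a uniform second-order error. *)
Definition rotation_derivative (j : 'I_d.+1) f f' :=
  [/\ bounded_on_sphere f, bounded_on_sphere f' &
  exists C : R, forall (x : Rvec R d.+1) (s : R), S x -> 0 < s <= 1 ->
    `|f (givens ord0 j (Num.sqrt (1 - s ^+ 2)) s x) - f x - s * f' x| <= C * s ^+ 2].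

Lemma small_sphere_rotation (j : 'I_d.+1) (s : R) : j != ord0 -> 0 < s <= 1 ->
  sphere_rotation ord0 j (Num.sqrt (1 - s ^+ 2)) s.
Proof.
move=> j0 /andP[s0 s1]; split; [by rewrite eq_sym|by rewrite gt_eqF|].
by rewrite sqr_sqrtr ?subrK// subr_ge0 expr_le1// ltW.
Qed.

(** 1 - c = s^2 / (1 + c) with c >= 0. *)
Lemma cos_bound (s : R) : 0 < s <= 1 -> 0 <= 1 - Num.sqrt (1 - s ^+ 2) <= s ^+ 2.
Proof.
move=> /andP[s0 s1].
have s2 : 0 <= 1 - s ^+ 2 by rewrite subr_ge0 expr_le1// ltW.
have := sqr_sqrtr s2; have := sqrtr_ge0 (1 - s ^+ 2); set c := Num.sqrt _ => c0 c2.
by apply/andP; split; nra.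
Qed.

Lemma rotation_derivativeM j f f' g g' : j != ord0 ->
  rotation_derivative j f f' -> rotation_derivative j g g' ->
  rotation_derivative j (fun x => f x * g x) (fun x => f' x * g x + f x * g' x).
Proof.
move=> j0 [[M fM] [M' fM'] [C fC]] [[N gN] [N' gN'] [D gD]]; split.
- by exists (M * N) => x Sx; rewrite normrM ler_pM ?fM ?gN.
- exists (M' * N + M * N') => x Sx; rewrite (le_trans (ler_normD _ _))// !normrM.
  by rewrite lerD// ler_pM ?fM ?gN ?fM' ?gN'.
exists (C * N + (M + M') * D + M' * N') => x s Sx s01.
set G := givens _ _ _ _.
have SG : S (G x) by apply/givens_sphere => //; exact: small_sphere_rotation.
have [s0 s1] := andP s01.
(* Discrete Leibniz rule: two second-order errors and one product of first-order terms. *)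
have -> : f (G x) * g (G x) - f x * g x - s * (f' x * g x + f x * g' x) =
  (f (G x) - f x - s * f' x) * g (G x) + (f x + s * f' x) * (g (G x) - g x - s * g' x)
  + s ^+ 2 * (f' x * g' x) by ring.
have h1 : `|(f (G x) - f x - s * f' x) * g (G x)| <= C * s ^+ 2 * N.
  by rewrite normrM ler_pM ?fC ?gN.
have h2 : `|(f x + s * f' x) * (g (G x) - g x - s * g' x)| <= (M + M') * (D * s ^+ 2).
  rewrite normrM ler_pM ?gD// (le_trans (ler_normD _ _))// lerD ?fM//.
  rewrite normrM (gtr0_norm s0) (le_trans (ler_wpM2r _ s1))// mul1r fM'//.
have h3 : `|s ^+ 2 * (f' x * g' x)| <= s ^+ 2 * (M' * N').
  by rewrite normrM (ger0_norm (sqr_ge0 s)) normrM ler_wpM2l ?sqr_ge0// ler_pM ?fM' ?gN'.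
rewrite (le_trans (ler_normD _ _))// (le_trans (lerD (ler_normD _ _) h3))//.
rewrite (le_trans (lerD (lerD h1 h2) (lexx _)))//.
by rewrite le_eqVlt; apply/orP; left; apply/eqP; ring.
Qed.

Lemma rotation_derivative_coord j : j != ord0 ->
  rotation_derivative j (fun x => tnth x j : R) (fun x => tnth x ord0 : R).
Proof.
move=> j0; split; [by exists 1 => x; exact: sphere_coord_le1|by exists 1 => x; exact: sphere_coord_le1|].
exists 1 => x s Sx s01; rewrite givens_j 1?eq_sym//.
have -> (c : R) : s * (tnth x ord0 : R) + c * tnth x j - tnth x j - s * tnth x ord0 =
  - ((1 - c) * tnth x j) by ring.
have /andP[c0 c1] := cos_bound s01.
rewrite normrN normrM ger0_norm// mulrC ler_pM//.
exact: sphere_coord_le1.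
Qed.

(** On the sphere this is |x - e|^2 / 4 for the pole e = (1, 0, ..., 0), with values in [0, 1]. *)
Definition vcoord (x : Rvec R d.+1) : R := (1 - (tnth x ord0 : R)) / 2.

Lemma rotation_derivative_vcoord j : j != ord0 ->
  rotation_derivative j vcoord (fun x => (tnth x j : R) / 2).
Proof.
move=> j0; split.
- exists 1 => x Sx; have := sphere_coord_le1 ord0 Sx.
  by rewrite /vcoord !ler_norml => /andP[? ?]; apply/andP; split; lra.
- exists 1 => x Sx; have := sphere_coord_le1 j Sx.
  by rewrite !ler_norml => /andP[? ?]; apply/andP; split; lra.
exists 1 => x s Sx s01; rewrite /vcoord givens_i.
have -> (c : R) : (1 - (c * (tnth x ord0 : R) - s * tnth x j)) / 2 - (1 - tnth x ord0) / 2
  - s * (tnth x j / 2) = (1 - c) * (tnth x ord0 / 2) by field.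
have /andP[c0 c1] := cos_bound s01.
rewrite normrM ger0_norm// mulrC ler_pM//.
have := sphere_coord_le1 ord0 Sx.
by rewrite !ler_norml => /andP[? ?]; apply/andP; split; lra.
Qed.

Lemma rotation_derivative_vcoordX j r : j != ord0 ->
  rotation_derivative j (fun x => vcoord x ^+ r) (fun x => r%:R * (vcoord x ^+ r.-1 * ((tnth x j : R) / 2))).
Proof.
move=> j0; elim: r => [|r IH].
  split; [by exists 1 => x _; rewrite normr1|by exists 0 => x _; rewrite mul0r normr0|].
  by exists 0 => x s _ _; rewrite !expr0 subrr mul0r mulr0 subrr normr0 mul0r.
rewrite (_ : (fun x => vcoord x ^+ r.+1) = (fun x => vcoord x * vcoord x ^+ r)); last first.
  by apply/funext => x; rewrite exprS.
rewrite (_ : (fun x => r.+1%:R * _) = (fun x => ((tnth x j : R) / 2) * vcoord x ^+ r +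
   vcoord x * (r%:R * (vcoord x ^+ r.-1 * ((tnth x j : R) / 2))))).
  exact: rotation_derivativeM (rotation_derivative_vcoord j0) IH.
apply/funext => x; move: (vcoord x) (tnth x j : R) => v y.
case: r {IH} => [|r] /=; first by rewrite !expr0; ring.
by rewrite exprS -!natr1; ring.
Qed.

(** Invariance makes f and its rotated copy have the same integral, so s times the integral of f' is
    the integral of the second-order error: |\int f'| <= C s for every s in ]0, 1]. *)
Lemma Rintegral_rotation_derivative j f f' L L' : j != ord0 ->
  SP L f -> SP L' f' -> rotation_derivative j f f' ->
  \int[mu]_(x in S) f' x = 0.
Proof.
move=> j0 fL fL' [_ _ [C fC]].
have mS := @measurable_sphere R d.
set I := \int[mu]_(x in S) f' x.
have bound (s : R) : 0 < s <= 1 -> `|I| <= C * s.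
  move=> s01; have /andP[s0 s1] := s01.
  rewrite -(ler_pM2l s0) -[X in X * `|_|](gtr0_norm s0) -normrM.
  have G := small_sphere_rotation j0 s01; set c := Num.sqrt _ in G.
  have iG : mu.-integrable S (EFin \o (f \o givens ord0 j c s)).
    by apply: integrable_givens => //; exact: sphere_polynomials_integrable fL.
  have i1 := sphere_polynomials_integrable fL.
  have i2 : mu.-integrable S (EFin \o (fun x => s * f' x)).
    by apply: sphere_polynomials_integrable (sphere_polynomialsZ s fL').
  have i3 := real_integrableB mS iG i1.
  have i4 := real_integrableB mS i3 i2.
  have E : \int[mu]_(x in S) (f (givens ord0 j c s x) - f x - s * f' x) = - (s * I).
    rewrite RintegralB// RintegralB// RintegralZl//; last exact: sphere_polynomials_integrable fL'.
    rewrite (_ : \int[mu]_(x in S) f (givens ord0 j c s x) = \int[mu]_(x in S) f x).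
      by rewrite subrr sub0r.
    congr fine; apply: (integral_givens (f := EFin \o f) G).
    by apply/measurable_EFinP; exact: sphere_polynomials_measurable fL.
  rewrite -normrN -E (le_trans (le_normr_Rintegral _ _))//.
  have mu1 : fine (mu S) = 1 by rewrite sphere_measure_sphere.
  have <- : \int[mu]_(x in S) (C * s ^+ 2) = s * (C * s).
    rewrite Rintegral_cst//; rewrite mu1; ring.
  apply: le_Rintegral => //.
  - exact: integrable_norm.
  - exact: sphere_polynomials_integrable (sphere_polynomials_cst _ 0 _).
  - by move=> x Sx; exact: fC.
apply/eqP; rewrite -normr_le0; apply/ler_addgt0Pr => e e0; rewrite add0r.
have C0 : 0 <= C.
  by have := bound 1; rewrite ltr01 lexx mulr1 => /(_ isT); exact: le_trans.
have C1 : 0 < C + 1 by rewrite ltr_wpDl.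
(* The bound is used at s = e / (C + 1), or at s = 1 if this exceeds 1; adding 1 to [C] keeps the
   denominator positive. *)
have [ec|ec] := leP (e / (C + 1)) 1.
  apply: (le_trans (bound (e / (C + 1)) _)); first by rewrite ec divr_gt0.
  rewrite mulrA ler_pdivrMr// mulrDr mulr1 mulrC lerDl ltW//.
apply: (le_trans (bound 1 _)); first by rewrite ltr01 lexx.
by rewrite mulr1; move: ec; rewrite ltr_pdivlMr// mul1r => /ltW; apply: le_trans; rewrite lerDl.
Qed.

Lemma sphere_polynomials_vcoord : SP 1 vcoord.
Proof.
apply: (sphere_polynomials_ext (g := fun x => 2^-1 + (- 2^-1) * (tnth x ord0 : R))).
  by move=> x _; rewrite /vcoord; field.
apply: sphere_polynomialsD; first exact: sphere_polynomials_cst.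
by apply: sphere_polynomialsZ; exact: sphere_polynomials_coord.
Qed.

Lemma sphere_polynomials_horner L (p : {poly R}) : (size p <= L.+1)%N ->
  SP L (fun x => p.[vcoord x]).
Proof.
move=> pL; apply: (sphere_polynomials_ext (g := fun x => \sum_(i < size p) p`_i * vcoord x ^+ i)).
  by move=> x _; rewrite horner_coef.
apply: sphere_polynomials_sum => i _; apply: sphere_polynomialsZ.
apply: sphere_polynomials_mono (sphere_polynomialsX i sphere_polynomials_vcoord).
by rewrite mul1n -ltnS (leq_trans (ltn_ord i)).
Qed.

(** For d > 0, the expectation of [p] under the Beta(d/2, d/2) law, as a linear form on
    polynomials. *)
Definition vint (p : {poly R}) : R := \int[mu]_(x in S) p.[vcoord x].

Lemma integrable_horner (p : {poly R}) : mu.-integrable S (EFin \o (fun x => p.[vcoord x])).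
Proof. exact: sphere_polynomials_integrable (@sphere_polynomials_horner (size p) p (leqnSn _)). Qed.

Lemma vint_linear : linear_for *%R vint.
Proof.
move=> a p q; rewrite /vint -RintegralZl//; [|exact: measurable_sphere|exact: integrable_horner].
rewrite -RintegralD//; [|exact: measurable_sphere| |exact: integrable_horner].
  by apply: eq_Rintegral => x _; rewrite !hornerE.
have := integrable_horner (a *: p); apply: eq_integrable; first exact: measurable_sphere.
by move=> x _ /=; rewrite !hornerE.
Qed.

HB.instance Definition _ := GRing.isLinear.Build R {poly R} R *%R vint vint_linear.

Lemma vintD p q : vint (p + q) = vint p + vint q.
Proof. exact: linearD. Qed.

Lemma vintB p q : vint (p - q) = vint p - vint q.
Proof. exact: linearB. Qed.

Lemma vintN p : vint (- p) = - vint p.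
Proof. exact: linearN. Qed.

Lemma vintZ c p : vint (c *: p) = c * vint p.
Proof. by rewrite linearZ. Qed.

Lemma vint1 : vint 1 = 1.
Proof.
rewrite /vint; under eq_Rintegral do rewrite hornerE.
rewrite Rintegral_cst; last exact: measurable_sphere.
rewrite [X in fine X](_ : _ = 1%E) ?mulr1//; exact: sphere_measure_sphere.
Qed.

Lemma vint_ge0 p : (forall v : R, 0 <= v <= 1 -> 0 <= p.[v]) -> 0 <= vint p.
Proof.
move=> p0; apply: Rintegral_ge0 => x Sx; apply: p0.
have := sphere_coord_le1 ord0 Sx.
by rewrite /vcoord !ler_norml => /andP[? ?]; apply/andP; split; lra.
Qed.

Lemma vint_le p q : (forall v : R, 0 <= v <= 1 -> p.[v] <= q.[v]) -> vint p <= vint q.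
Proof.
move=> pq; rewrite -subr_ge0 -linearB vint_ge0// => v v01.
by rewrite !hornerE subr_ge0 pq.
Qed.

(* Integration by parts: this is [\int (x_0 f - x_j ^+ 2 f') = 0] for [f = v ^+ r],
   summed over the [d] directions [j] orthogonal to the axis. *)
Lemma vintXn_by_parts r :
  r%:R * vint ('X^r - 'X^(r.+1)) + d%:R / 2 * vint ('X^r - 2 *: 'X^(r.+1)) = 0.
Proof.
have J (j : 'I_d) : \int[mu]_(x in S) ((tnth x ord0 : R) * vcoord x ^+ r +
    (tnth x (lift ord0 j) : R) * (r%:R * (vcoord x ^+ r.-1 * ((tnth x (lift ord0 j) : R) / 2)))) = 0.
  have j0 : lift ord0 j != ord0 by rewrite eq_sym neq_lift.
  have Vr k : SP k (fun x => vcoord x ^+ k).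
    by have := sphere_polynomialsX k sphere_polynomials_vcoord; rewrite mul1n.
  have c1 := @sphere_polynomials_coord R d.
  have s1 := sphere_polynomialsM (c1 ord0) (Vr r).
  have s2 := sphere_polynomialsM (c1 (lift ord0 j)) (sphere_polynomialsZ r%:R (sphere_polynomialsM (Vr r.-1) (sphere_polynomialsM (c1 (lift ord0 j)) (sphere_polynomials_cst d 0 2^-1)))).
  have := @Rintegral_rotation_derivative _ _ _ (1 + r) (maxn (1 + r) (1 + (r.-1 + (1 + 0)))) j0
    (sphere_polynomialsM (c1 (lift ord0 j)) (Vr r)) _
    (rotation_derivativeM j0 (rotation_derivative_coord j0) (rotation_derivative_vcoordX r j0)).
  apply; apply: sphere_polynomialsD; [apply: sphere_polynomials_mono s1|apply: sphere_polynomials_mono s2].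
    exact: leq_maxl.
  exact: leq_maxr.
have iJ (j : 'I_d) : mu.-integrable S (EFin \o (fun x => ((tnth x ord0 : R) * vcoord x ^+ r +
    (tnth x (lift ord0 j) : R) * (r%:R * (vcoord x ^+ r.-1 * ((tnth x (lift ord0 j) : R) / 2)))))).
  have Vr k : SP k (fun x => vcoord x ^+ k).
    by have := sphere_polynomialsX k sphere_polynomials_vcoord; rewrite mul1n.
  have c1 := @sphere_polynomials_coord R d.
  have s1 := sphere_polynomialsM (c1 ord0) (Vr r).
  have s2 := sphere_polynomialsM (c1 (lift ord0 j)) (sphere_polynomialsZ r%:R (sphere_polynomialsM (Vr r.-1) (sphere_polynomialsM (c1 (lift ord0 j)) (sphere_polynomials_cst d 0 2^-1)))).
  apply: (@sphere_polynomials_integrable _ _ (maxn (1 + r) (1 + (r.-1 + (1 + 0))))).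
  apply: sphere_polynomialsD; [apply: sphere_polynomials_mono s1|apply: sphere_polynomials_mono s2].
    exact: leq_maxl.
  exact: leq_maxr.
have : \sum_(j < d) \int[mu]_(x in S) ((tnth x ord0 : R) * vcoord x ^+ r +
    (tnth x (lift ord0 j) : R) * (r%:R * (vcoord x ^+ r.-1 * ((tnth x (lift ord0 j) : R) / 2)))) = 0.
  by rewrite big1.
have Rsum : \sum_(j < d) \int[mu]_(x in S) ((tnth x ord0 : R) * vcoord x ^+ r +
    (tnth x (lift ord0 j) : R) * (r%:R * (vcoord x ^+ r.-1 * ((tnth x (lift ord0 j) : R) / 2)))) =
    \int[mu]_(x in S) \sum_(j < d) ((tnth x ord0 : R) * vcoord x ^+ r +
    (tnth x (lift ord0 j) : R) * (r%:R * (vcoord x ^+ r.-1 * ((tnth x (lift ord0 j) : R) / 2)))).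
  by rewrite Rintegral_sum//; exact: measurable_sphere.
rewrite Rsum => H.
have : \int[mu]_(x in S) (((2 * r%:R) *: ('X^r - 'X^(r.+1)) + d%:R *: ('X^r - 2 *: 'X^(r.+1))).[vcoord x]) = 0.
  rewrite -H; apply: eq_Rintegral => x /set_mem Sx.
  rewrite big_split/= sumr_const card_ord.
  transitivity ((tnth x ord0 * vcoord x ^+ r) *+ d +
    (r%:R * vcoord x ^+ r.-1 / 2) * \sum_(j < d) (tnth x (lift ord0 j) : R) * tnth x (lift ord0 j)); last first.
    by congr (_ + _); rewrite mulr_sumr; apply: eq_bigr => j _; ring.
  have := (sphere_sum x).1 Sx; rewrite big_ord_recl => /(canRL (addKr _)) ->.
  have x0 : (tnth x ord0 : R) = 1 - 2 * vcoord x by rewrite /vcoord; field.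
  rewrite x0; move: (vcoord x) => v; rewrite !(hornerD, hornerN, hornerZ, hornerXn) -mulr_natr exprS.
  case: r {J iJ Rsum H} => [|r]; first by rewrite !expr0; ring.
  by rewrite /= !exprS; field.
rewrite -/(vint _) !linearD/= !linearZ/= => E.
apply: (mulfI (x := 2)); first by rewrite pnatr_eq0.
by rewrite mulr0 -E mulrDr mulrA; congr (_ + _); field.
Qed.

End rotation_derivative.

(** * Moments of the logarithm *)

Section log_polynomial.
Context (R : realType).

(** Taylor polynomials of [ln] at 1, decreasing to [ln v] on ]0, 1]. Unlike [ln] they are
    polynomials, so the integration by parts applies to them. *)
Definition logp (N : nat) : {poly R} := - \sum_(k < N) k.+1%:R^-1 *: (1 - 'X) ^+ k.+1.

Lemma logp_deriv N : 'X * (logp N)^`() = 1 - (1 - 'X) ^+ N.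
Proof.
elim: N => [|N IH]; first by rewrite /logp big_ord0 oppr0 derivC mulr0 expr0 subrr.
have -> : logp N.+1 = logp N - N.+1%:R^-1 *: (1 - 'X) ^+ N.+1.
  by rewrite /logp big_ord_recr/= opprD.
rewrite derivB mulrBr IH derivZ deriv_exp derivB derivX derivC sub0r.
rewrite -[(-1 * _) *+ _](@scaler_nat R) scalerA mulVf ?pnatr_eq0// scale1r /= exprS; ring.
Qed.

Lemma logp1 N : (logp N).[1] = 0.
Proof.
rewrite /logp hornerN horner_sum big1 ?oppr0// => k _.
by rewrite !hornerE subrr expr0n mulr0.
Qed.

Lemma logp_sum N v : (logp N).[v] = - \sum_(k < N) k.+1%:R^-1 * (1 - v) ^+ k.+1.
Proof.
rewrite /logp hornerN horner_sum; congr (- _); apply: eq_bigr => k _.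
by rewrite !hornerE.
Qed.

(** Mean value theorem on [v, 1]: the difference vanishes at 1 and has derivative - (1 - t)^N /
    t. *)
Lemma logp_bound N (v : R) : 0 < v <= 1 -> 0 <= (logp N).[v] - ln v <= (1 - v) ^+ N / v.
Proof.
move=> /andP[v0 v1].
have [||c /itvP cv E] := @MVT_segment R (fun t => (logp N).[t] - ln t) (fun t => - ((1 - t) ^+ N / t)) v 1 v1.
- move=> x; rewrite in_itv/= => /andP[vx x1].
  have x0 : 0 < x := lt_trans v0 vx.
  have dl := is_derive1_ln x0.
  apply: is_derive_eq.
  have /(congr1 (horner^~ x)) := logp_deriv N.
  rewrite !hornerE => /(canRL (mulKf (lt0r_neq0 x0))) ->.
  by field; rewrite gt_eqF.
- apply: derivable_within_continuous => x; rewrite in_itv/= => /andP[vx x1].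
  have x0 : 0 < x := lt_le_trans v0 vx.
  have dl := is_derive1_ln x0.
  apply: derivableB; [exact: derivable_horner|exact: ex_derive].
have c0 : 0 < c by rewrite (lt_le_trans v0)// cv.
move: E; rewrite logp1 ln1 subrr sub0r => /(canRL opprK) ->.
rewrite mulNr opprK; apply/andP; split.
  by rewrite mulr_ge0 ?divr_ge0 ?exprn_ge0 ?subr_ge0 ?cv// ltW.
rewrite -[leRHS]mulr1 ler_pM ?divr_ge0 ?exprn_ge0 ?subr_ge0 ?cv//; [by rewrite ltW| |by rewrite gerBl ltW].
rewrite ler_pM ?exprn_ge0 ?invr_ge0 ?subr_ge0 ?cv//; first by rewrite ltW.
- by rewrite lerXn2r ?nnegrE ?subr_ge0 ?cv// lerB ?cv.
- by rewrite lef_pV2 ?posrE// cv.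
Qed.

Lemma logp_le0 N (v : R) : 0 <= v <= 1 -> (logp N).[v] <= 0.
Proof.
move=> /andP[v0 v1]; rewrite logp_sum oppr_le0 sumr_ge0// => k _.
by rewrite mulr_ge0 ?invr_ge0 ?exprn_ge0 ?subr_ge0.
Qed.

Lemma logp_ndecr N M (v : R) : (N <= M)%N -> 0 <= v <= 1 -> (logp M).[v] <= (logp N).[v].
Proof.
move=> /subnK <- /andP[v0 v1]; rewrite !logp_sum lerN2.
elim: (M - N)%N => [//|k IH]; rewrite addSn big_ord_recr/= (le_trans IH)// lerDl.
by rewrite mulr_ge0 ?invr_ge0 ?exprn_ge0 ?subr_ge0.
Qed.

Lemma sub1_le_mul_ln (v : R) : 0 < v -> v - 1 <= v * ln v.
Proof.
move=> v0; have := @le_ln1Dx _ (v^-1 - 1); rewrite [1 + _]addrC subrK lnV ?posrE// => h.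
have : - ln v <= v^-1 - 1 by apply: h; rewrite ltrBDl subrr invr_gt0.
move=> /(ler_wpM2l (ltW v0)); rewrite mulrBr mulfV ?gt_eqF// mulrN mulr1; lra.
Qed.

(** For v > 0, v times [logp] is at least v ln v, hence at least v - 1. *)
Lemma vmul_logp_bound N (v : R) : 0 <= v <= 1 -> - 1 <= v * (logp N).[v].
Proof.
move=> /andP[]; rewrite le_eqVlt => /predU1P[<- _|v0 v1]; first by rewrite mul0r lerN10.
have /andP[/(ler_wpM2l (ltW v0)) + _] := @logp_bound N v (introT andP (conj v0 v1)).
rewrite mulr0 mulrBr subr_ge0; apply: le_trans.
by have := sub1_le_mul_ln v0; lra.
Qed.

End log_polynomial.

(** * Integrals of polynomials in [vcoord], with and without the factor [ln] *)

Section log_moments.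
Context (R : realType) (d : nat).
Hypothesis d0 : (0 < d)%N.
Local Notation S := (unit_sphere R d).
Local Notation mu := (sphere_measure R d).
Local Notation vI := (@vint R d).
Local Notation a := (d%:R / 2 : R).

Lemma a_gt0 : 0 < a. Proof. by rewrite divr_gt0// ltr0n. Qed.

Lemma vcoord_itv x : S x -> 0 <= vcoord x <= 1.
Proof.
move=> /(sphere_coord_le1 ord0).
by rewrite /vcoord ler_norml => /andP[? ?]; apply/andP; split; lra.
Qed.

(** In terms of the Beta(a, a) density w, this is (v (1 - v) w)' = a (1 - 2 v) w tested against
    p. *)
Lemma vint_by_parts p :
  vI ('X * (1 - 'X) * p^`()) + a * vI ((1 - 2 *: 'X) * p) = 0.
Proof.
rewrite -[p]coefK poly_def raddf_sum/= !mulr_sumr !raddf_sum/= mulr_sumr -big_split/=.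
rewrite big1// => i _; rewrite derivZ -!scalerAr !linearZ/=.
rewrite mulrCA -mulrDr.
apply/eqP; rewrite mulf_eq0; apply/orP; right; apply/eqP.
rewrite -(vintXn_by_parts R d i); congr (_ + _ * _); last first.
  by congr (vI _); rewrite mulrDl mul1r -scalerAl mulNr scalerN -exprS.
case: i => [[|i] _]/=; first by rewrite derivXn mulr0n mulr0 linear0 mul0r.
rewrite derivXn mulrnAr raddfMn/= -[LHS]mulr_natl; congr (_ * vI _).
by rewrite !exprS; ring.
Qed.

Lemma horner_bounded (p : {poly R}) : exists2 M, 0 <= M & forall v : R, 0 <= v <= 1 -> `|p.[v]| <= M.
Proof.
exists (\sum_(i < size p) `|p`_i|); first by apply: sumr_ge0.
move=> v /andP[v0 v1]; rewrite horner_coef (le_trans (ler_norm_sum _ _ _))// ler_sum// => i _.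
by rewrite normrM ler_piMr// normrX exprn_ile1// ger0_norm.
Qed.

(** Integrate by parts with [logp] itself: by [logp_deriv] the derivative term is the integral of P
    = (1 - v) (1 - (1 - v)^N), at most 1, and it controls the part (1 - 2 v) logp; the remaining
    part 2 v logp is at least -2. *)
Lemma vint_logp_bound N : - vI (logp R N) <= a^-1 + 2.
Proof.
have a0 := a_gt0.
have := vint_by_parts (logp R N).
rewrite [in X in vI X]mulrAC [_ * (logp R N)^`() * _]mulrC [_ * (_ * _)]mulrC logp_deriv.
set P := (1 - (1 - 'X) ^+ N) * (1 - 'X) => E.
have P1 : vI P <= 1.
  rewrite -[leRHS](vint1 R d); apply: vint_le => v /andP[v0 v1]; rewrite /P !hornerE.
  have : 0 <= (1 - v) ^+ N <= 1 by rewrite exprn_ge0 ?exprn_ile1 ?subr_ge0// gerBl.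
  by move=> /andP[? ?]; rewrite mulr_ile1 ?subr_ge0// gerBl.
have X1 : - 1 <= vI ('X * logp R N).
  rewrite -(vint1 R d) -vintN; apply: vint_le => v v01.
  by rewrite hornerN -polyC1 hornerC hornerM hornerX; exact: vmul_logp_bound.
have -> : logp R N = (1 - 2 *: 'X) * logp R N + 2 *: ('X * logp R N).
  by rewrite mulrBl mul1r -scalerAl subrK.
have -> : vI ((1 - 2 *: 'X) * logp R N + 2 *: ('X * logp R N)) =
    vI ((1 - 2 *: 'X) * logp R N) + 2 * vI ('X * logp R N).
  by rewrite vintD vintZ.
have -> : vI ((1 - 2 *: 'X) * logp R N) = - (a^-1 * vI P).
  rewrite -[LHS](mulKf (lt0r_neq0 a0)) -mulrN; congr (_ * _).
  by apply/eqP; rewrite -addr_eq0 addrC E.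
have : a^-1 * vI P <= a^-1 by rewrite ler_piMr// invr_ge0 ltW.
lra.
Qed.

Definition qint N := vI ((1 - 'X) ^+ N).

Lemma qint_ge0 N : 0 <= qint N.
Proof. by apply: vint_ge0 => v /andP[? ?]; rewrite !hornerE exprn_ge0// subr_ge0. Qed.

Lemma qint_ndecr N M : (N <= M)%N -> qint M <= qint N.
Proof.
move=> NM; apply: vint_le => v /andP[v0 v1].
by rewrite !hornerE ler_wiXn2l ?subr_ge0// gerBl.
Qed.

(** Each (1 - v)^(k+1) with k < N dominates (1 - v)^N. Divergence of the harmonic series will then
    force [qint] to tend to 0, which shows that the pole is negligible. *)
Lemma qint_harmonic N : qint N * series (@harmonic R) N <= a^-1 + 2.
Proof.
apply: le_trans (vint_logp_bound N).
rewrite -vintN mulrC -vintZ; apply: vint_le => v /andP[v0 v1].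
rewrite hornerZ [leRHS]hornerN logp_sum opprK !hornerE seriesEord/= mulr_suml ler_sum// => k _.
by rewrite ler_wpM2l ?invr_ge0// ler_wiXn2l ?subr_ge0// gerBl.
Qed.

Lemma qint_cvg0 : qint n @[n --> \oo] --> 0.
Proof.
have cq : cvgn qint.
  apply: nonincreasing_is_cvgn; last by exists 0 => _ [n _ <-]; exact: qint_ge0.
  by move=> n m; exact: qint_ndecr.
suff -> : 0 = limn qint by [].
apply/esym/eqP; rewrite eq_le; apply/andP; split; last first.
  by apply: limr_ge => //; apply: nearW => n; exact: qint_ge0.
rewrite leNgt; apply/negP => l0; apply: (@dvg_harmonic R).
apply: nondecreasing_is_cvgn.
  by apply: nondecreasing_series => n _ _; exact: harmonic_ge0.
exists ((a^-1 + 2) / limn qint) => _ [n _ <-].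
rewrite ler_pdivlMr// mulrC (le_trans _ (qint_harmonic n))// ler_wpM2r//.
  by rewrite seriesEord/= sumr_ge0// => i _; exact: harmonic_ge0.
apply: nonincreasing_cvgn_ge => //.
by move=> k m; exact: qint_ndecr.
Qed.

Definition vzero : set (Rvec R d.+1) := [set x | vcoord x = 0].

Lemma measurable_vcoord : measurable_fun setT (@vcoord R d).
Proof.
apply: measurable_funM => //; apply: measurable_funB => //; exact: measurable_tnth.
Qed.

Lemma measurable_vzero : measurable vzero.
Proof.
rewrite (_ : vzero = setT `&` @vcoord R d @^-1` [set 0]); last by rewrite setTI.
exact: measurable_vcoord.
Qed.

Lemma sphere_measure_vzero : mu (S `&` vzero) = 0%E.
Proof.
have mS := @measurable_sphere R d; have mV := measurable_vzero.
have le N : (mu (S `&` vzero) <= (qint N)%:E)%E.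
  rewrite setIC -integral_indic// /qint.
  rewrite -(EFin_Rintegral mS (integrable_horner d _)).
  apply: ge0_le_integral => //.
  - exact/measurable_EFinP.
  - by apply/measurable_EFinP; have /integrableP[/measurable_EFinP] := integrable_horner d ((1 - 'X) ^+ N : {poly R}).
  - move=> x Sx; rewrite lee_fin indicE; have /andP[v0 v1] := vcoord_itv Sx.
    case: (boolP (x \in vzero)) => [/set_mem xV|_] /=.
      by rewrite !hornerE xV subr0 expr1n.
    by rewrite !hornerE exprn_ge0// subr_ge0.
apply/eqP; rewrite eq_le measure_ge0 andbT.
apply/lee_addgt0Pr => e e0; rewrite add0e.
have /cvgrPdist_le/(_ _ e0)[N _ /(_ N (leqnn _))] := qint_cvg0.
rewrite sub0r normrN ger0_norm ?qint_ge0// => qe.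
by rewrite (le_trans (le N))// lee_fin.
Qed.

Local Notation S0 := (S `\` vzero).

Lemma measurable_S0 : measurable S0.
Proof. apply: measurableD; [exact: measurable_sphere|exact: measurable_vzero]. Qed.

Lemma Rintegral_S0 (f : Rvec R d.+1 -> R) : mu.-integrable S (EFin \o f) ->
  \int[mu]_(x in S) f x = \int[mu]_(x in S0) f x.
Proof.
have mS := @measurable_sphere R d; have mV := measurable_vzero.
move=> fi; congr fine; rewrite (negligible_integral _ mS fi sphere_measure_vzero).
  by rewrite setDIr setDv set0U.
exact: measurableI.
Qed.

Lemma measurable_ln_vcoord : measurable_fun setT (fun x : Rvec R d.+1 => ln (vcoord x)).
Proof. by apply: (measurableT_comp (@measurable_ln R)); exact: measurable_vcoord. Qed.

Lemma integrable_S0_horner p : mu.-integrable S0 (EFin \o (fun x : Rvec R d.+1 => p.[vcoord x])).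
Proof.
apply: integrableS (integrable_horner d p) => //; [exact: measurable_sphere|exact: measurable_S0].
Qed.

Lemma S0_itv x : S0 x -> 0 < vcoord x <= 1.
Proof.
move=> [Sx xv]; have /andP[v0 ->] := vcoord_itv Sx; rewrite andbT lt_neqAle v0 andbT.
by apply/negP => /eqP v00; apply: xv.
Qed.

Lemma logp_cvg (v : R) : 0 < v <= 1 -> (logp R n).[v] @[n --> \oo] --> ln v.
Proof.
move=> v01; have /andP[v0 v1] := v01.
apply/subr_cvg0; apply: (@squeeze_cvgr _ _ _ _ (cst 0) (fun n => (1 - v) ^+ n / v)).
- by apply: nearW => n; exact: logp_bound.
- exact: cvg_cst.
- rewrite -[X in _ --> X](mul0r v^-1); apply: cvgMl.
  by apply: cvg_expr; rewrite ger0_norm ?subr_ge0// gtrBl.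
Qed.

(** Monotone convergence, away from the pole, of - logp increasing to - ln v. With [vint_logp_bound]
    it makes [ln v] integrable. *)
Lemma cvg_integral_logp :
  (- vI (logp R n))%:E @[n --> \oo] --> (\int[mu]_(x in S0) (- ln (vcoord x))%:E)%E.
Proof.
have mS0 := measurable_S0.
pose g n (x : Rvec R d.+1) : \bar R := (- (logp R n).[vcoord x])%:E.
have gE n : (- vI (logp R n))%:E = (\int[mu]_(x in S0) g n x)%E.
  rewrite -vintN /vint Rintegral_S0; last exact: integrable_horner.
  rewrite -EFin_Rintegral//; last exact: integrable_S0_horner.
  by apply: eq_integral => x _; rewrite hornerN.
under eq_fun do rewrite gE.
have -> : (\int[mu]_(x in S0) (- ln (vcoord x))%:E = \int[mu]_(x in S0) limn (g ^~ x))%E.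
  apply: eq_integral => x /set_mem xS0; apply/esym/cvg_lim => //.
  apply: cvg_EFin; first exact: nearW.
  by apply: cvgN; exact: logp_cvg (S0_itv xS0).
apply: cvg_monotone_convergence => //.
- move=> n; apply/measurable_EFinP; apply: measurableT_comp => //.
  by have /integrableP[/measurable_EFinP] := integrable_S0_horner (logp R n).
- move=> n x /S0_itv /andP[v0 v1]; rewrite lee_fin oppr_ge0 logp_le0// v1 ltW//.
- move=> x /S0_itv /andP[v0 v1] n m nm; rewrite lee_fin lerN2 logp_ndecr// v1 ltW//.
Qed.

Lemma integrable_S0_ln : mu.-integrable S0 (EFin \o (fun x : Rvec R d.+1 => ln (vcoord x))).
Proof.
apply/integrableP; split.
  by apply/measurable_EFinP/measurable_funTS; exact: measurable_ln_vcoord.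
apply: (@le_lt_trans _ _ (a^-1 + 2)%:E); last exact: ltry.
have -> : (\int[mu]_(x in S0) `|(EFin \o (fun x : Rvec R d.+1 => ln (vcoord x))) x| =
    \int[mu]_(x in S0) (- ln (vcoord x))%:E)%E.
  apply: eq_integral => x /set_mem /S0_itv v01; rewrite /= ler0_norm//.
  by rewrite -ln1 ler_ln ?posrE//; case/andP : v01.
apply: cvge_le cvg_integral_logp.
by apply: nearW => n; rewrite lee_fin vint_logp_bound.
Qed.

Lemma integrable_ln : mu.-integrable S (EFin \o (fun x : Rvec R d.+1 => ln (vcoord x))).
Proof.
have mS := @measurable_sphere R d; have mV := measurable_vzero.
apply/(negligible_integrable _ mS _ sphere_measure_vzero).
- exact: measurableI.
- by apply/measurable_EFinP/measurable_funTS; exact: measurable_ln_vcoord.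
- by rewrite setDIr setDv set0U; exact: integrable_S0_ln.
Qed.

Lemma vint_logp_cvg : vI (logp R n) @[n --> \oo] --> \int[mu]_(x in S) ln (vcoord x).
Proof.
have := cvg_integral_logp.
rewrite (_ : (\int[mu]_(x in S0) (- ln (vcoord x))%:E)%E = (- \int[mu]_(x in S) ln (vcoord x))%:E).
  by move=> /fine_cvg /cvgN; rewrite !opprK.
rewrite Rintegral_S0; last exact: integrable_ln.
rewrite EFinN -EFin_Rintegral; [|exact: measurable_S0|exact: integrable_S0_ln].
transitivity (\int[mu]_(x in S0) ((- 1)%:E * (ln (vcoord x))%:E))%E.
  by apply: eq_integral => x _; rewrite -EFinM mulN1r.
rewrite integralZl ?EFinN ?mulN1e//; [exact: measurable_S0|exact: integrable_S0_ln].
Qed.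

Definition lint (p : {poly R}) : R := \int[mu]_(x in S) (p.[vcoord x] * ln (vcoord x)).

Lemma integrable_lint p :
  mu.-integrable S (EFin \o (fun x : Rvec R d.+1 => p.[vcoord x] * ln (vcoord x))).
Proof.
have mS := @measurable_sphere R d.
have [M M0 pM] := horner_bounded p.
apply: (le_integrable mS) (integrable_norm (integrableZl mS M integrable_ln)).
- apply/measurable_EFinP; apply: measurable_funM.
    by have /integrableP[/measurable_EFinP] := integrable_horner d p.
  exact: measurable_funTS measurable_ln_vcoord.
- move=> x Sx; rewrite lee_fin normr_id !normrM (ger0_norm M0) ler_wpM2r ?pM//.
  exact: vcoord_itv.
Qed.

Lemma lintD p q : lint (p + q) = lint p + lint q.
Proof.
rewrite /lint -RintegralD; [|exact: measurable_sphere|exact: integrable_lint|exact: integrable_lint].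
by apply: eq_Rintegral => x _; rewrite hornerD mulrDl.
Qed.

Lemma lintZ c p : lint (c *: p) = c * lint p.
Proof.
rewrite /lint -RintegralZl; [|exact: measurable_sphere|exact: integrable_lint].
by apply: eq_Rintegral => x _; rewrite hornerZ mulrA.
Qed.

Lemma lint_linear : linear_for *%R lint.
Proof. by move=> c p q; rewrite lintD lintZ. Qed.

HB.instance Definition _ := GRing.isLinear.Build R {poly R} R *%R lint lint_linear.

(** Since logp - ln is nonnegative, the error with a factor [q] is at most the bound of [q] times
    the error with the factor 1, which tends to 0. *)
Lemma vint_mul_logp_bound q M N : (forall v : R, 0 <= v <= 1 -> `|q.[v]| <= M) ->
  `|vI (q * logp R N) - lint q| <= M * (vI (logp R N) - \int[mu]_(x in S) ln (vcoord x)).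
Proof.
move=> qM; have mS0 := measurable_S0; have mS := @measurable_sphere R d.
have iS0 (f : Rvec R d.+1 -> R) : mu.-integrable S (EFin \o f) -> mu.-integrable S0 (EFin \o f).
  by apply: integrableS => //; exact: mS0.
have i1 := integrable_horner d (q * logp R N); have i2 := integrable_lint q.
have i3 := integrable_horner d (logp R N); have i4 := integrable_ln.
rewrite /vint /lint -!RintegralB// -RintegralZl//; last exact: real_integrableB.
rewrite [X in `|X|]Rintegral_S0; last exact: real_integrableB.
rewrite [leRHS]Rintegral_S0; last by apply: real_integrableZl => //; exact: real_integrableB.
apply: le_trans (le_normr_Rintegral _ _) _ => //.
  by apply: iS0; exact: real_integrableB.
apply: le_Rintegral => //.
- by apply/integrable_norm/iS0; exact: real_integrableB.
- by apply/iS0/real_integrableZl => //; exact: real_integrableB.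
move=> x /S0_itv v01; rewrite hornerM -mulrBr normrM.
have /andP[l0 _] := logp_bound N v01; rewrite (ger0_norm l0) ler_wpM2r// qM//.
by have /andP[v0 ->] := v01; rewrite ltW.
Qed.

(** Limit of the integration by parts for p * logp. By [logp_deriv], differentiating the logarithm
    contributes (1 - v) p, up to an error that carries the factor (1 - v)^N. *)
Lemma lint_by_parts p :
  lint ('X * (1 - 'X) * p^`()) + a * lint ((1 - 2 *: 'X) * p) + vI ((1 - 'X) * p) = 0.
Proof.
set Q := 'X * (1 - 'X) * p^`() + a *: ((1 - 2 *: 'X) * p).
rewrite -lintZ -lintD -/Q.
have E N : vI (Q * logp R N) + vI ((1 - 'X) * p) = vI ((1 - 'X) * p * (1 - 'X) ^+ N).
  apply/eqP; rewrite -subr_eq0 -vintD -vintB; apply/eqP.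
  rewrite -[RHS](vint_by_parts (p * logp R N)) -vintZ -vintD; congr (vI _).
  rewrite derivM mulrDr [X in _ = (_ + X) + _](_ : _ = (1 - 'X) * p * (1 - (1 - 'X) ^+ N)).
    by rewrite /Q -!mul_polyC; ring.
  by rewrite -logp_deriv; ring.
have [M M0 QM] := horner_bounded Q; have [M' M'0 pM] := horner_bounded ((1 - 'X) * p).
set l := lint Q + _.
have bound N : `|l| <= M * (vI (logp R N) - \int[mu]_(x in S) ln (vcoord x)) + M' * qint N.
  have -> : l = (lint Q - vI (Q * logp R N)) + vI ((1 - 'X) * p * (1 - 'X) ^+ N).
    by rewrite -E /l; ring.
  rewrite (le_trans (ler_normD _ _))// lerD//; first by rewrite distrC vint_mul_logp_bound.
  rewrite /qint -vintZ ler_norml -vintN; apply/andP; split; apply: vint_le => v /andP[v0 v1].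
    rewrite hornerN hornerZ [leRHS]hornerM -mulNr ler_wpM2r//.
      by rewrite !hornerE exprn_ge0// subr_ge0.
    by have := pM v; rewrite v0 v1 => /(_ isT); rewrite ler_norml => /andP[].
  rewrite hornerZ [leLHS]hornerM ler_wpM2r//.
    by rewrite !hornerE exprn_ge0// subr_ge0.
  by have := pM v; rewrite v0 v1 => /(_ isT); rewrite ler_norml => /andP[].
apply/eqP; rewrite -normr_le0.
have c : M * (vI (logp R n) - \int[mu]_(x in S) ln (vcoord x)) + M' * qint n @[n --> \oo] --> 0.
  rewrite -[X in _ --> X]addr0; apply: cvgD.
    rewrite -[X in _ --> X](mulr0 M); apply: cvgMr; apply/subr_cvg0; exact: vint_logp_cvg.
  rewrite -[X in _ --> X](mulr0 M'); apply: cvgMr; exact: qint_cvg0.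
by rewrite -(cvg_lim _ c)//; apply: limr_ge; [apply/cvg_ex; exists 0|exact: nearW].
Qed.

Lemma vintXS s : (s%:R + 2 * a) * vI 'X^(s.+1) = (s%:R + a) * vI 'X^s.
Proof. by have := vintXn_by_parts R d s; rewrite !vintB vintZ; lra. Qed.

Lemma vintX_gt0 s : 0 < vI 'X^s.
Proof.
have a0 := a_gt0; elim: s => [|s IH]; first by rewrite expr0 vint1.
have p1 : 0 < s%:R + a by rewrite ltr_wpDl.
have p2 : 0 < s%:R + 2 * a by rewrite ltr_wpDl// mulr_gt0.
by rewrite -(pmulr_rgt0 _ p2) vintXS pmulr_rgt0.
Qed.

(* Ratio of the moments [\int v ^+ s ln v] and [\int v ^+ s]: its increments are
   explicit, and it is squeezed to [0] by [1 - 1 / v <= ln v <= 0]. *)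
Definition log_ratio s := lint 'X^s / vI 'X^s.

Lemma lintXS s :
  (s%:R + 2 * a) * lint 'X^(s.+1) = (s%:R + a) * lint 'X^s + vI 'X^s - vI 'X^(s.+1).
Proof.
have := lint_by_parts 'X^s.
have -> : 'X * (1 - 'X) * ('X^s)^`() = s%:R *: ('X^s - 'X^(s.+1)) :> {poly R}.
  case: s => [|s]; first by rewrite derivXn mulr0n mulr0 scale0r.
  by rewrite derivXn mulrnAr -scaler_nat; congr (_ *: _); rewrite !exprS; ring.
have -> : (1 - 2 *: 'X) * 'X^s = 'X^s - 2 *: 'X^(s.+1) :> {poly R}.
  by rewrite mulrBl mul1r -scalerAl -exprS.
have -> : (1 - 'X) * 'X^s = 'X^s - 'X^(s.+1) :> {poly R}.
  by rewrite mulrBl mul1r -exprS.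
rewrite lintZ vintB.
have lB p q : lint (p - q) = lint p - lint q by exact: linearB.
rewrite !lB lintZ; lra.
Qed.

Lemma log_ratioS s : log_ratio s.+1 = log_ratio s + (s%:R + a)^-1 - (s%:R + 2 * a)^-1.
Proof.
have a0 := a_gt0.
have s1 : s%:R + a != 0 by rewrite gt_eqF// ltr_wpDl.
have s2 : s%:R + 2 * a != 0 by rewrite gt_eqF// ltr_wpDl// mulr_gt0.
have m0 := vintX_gt0 s; have m1 := vintX_gt0 s.+1.
have E1 : lint 'X^(s.+1) = ((s%:R + a) * lint 'X^s + vI 'X^s - vI 'X^(s.+1)) / (s%:R + 2 * a).
  by rewrite -lintXS mulrC mulKf.
have E2 : vI 'X^(s.+1) = (s%:R + a) * vI 'X^s / (s%:R + 2 * a).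
  by rewrite -vintXS mulrC mulKf.
rewrite /log_ratio E1 E2 {E1 E2 m1}; move: (vI _) m0 (lint _) => m m0 l.
move: (a) a0 s1 s2 => b b0 s1 s2; field.
by rewrite s1 s2 gt_eqF.
Qed.

Lemma log_ratio_sum N :
  log_ratio N = lint 1 + \sum_(k < N) ((k%:R + a)^-1 - (k%:R + 2 * a)^-1).
Proof.
elim: N => [|N IH]; first by rewrite big_ord0 addr0 /log_ratio expr0 vint1 divr1.
by rewrite log_ratioS IH big_ord_recr/= !addrA.
Qed.

Lemma log_ratio_bound N : - (a / (N%:R + a)) <= log_ratio N.+1 <= 0.
Proof.
have a0 := a_gt0; have m1 := vintX_gt0 N.+1; have m0 := vintX_gt0 N.
rewrite /log_ratio; apply/andP; split; last first.
  rewrite pmulr_lle0 ?invr_gt0//.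
  rewrite -oppr_ge0 -mulN1r -lintZ; apply: Rintegral_ge0 => x Sx.
  have /andP[v0 v1] := vcoord_itv Sx.
  rewrite scaleN1r hornerN mulNr oppr_ge0 hornerXn.
  move: v0; rewrite le_eqVlt => /predU1P[<-|v0]; first by rewrite expr0n mul0r.
  by rewrite pmulr_rle0 ?exprn_gt0// -ln1 ler_ln ?posrE.
rewrite ler_pdivlMr// mulNr.
have -> : a / (N%:R + a) * vI 'X^(N.+1) = vI ('X^N - 'X^(N.+1)).
  rewrite vintB; have := vintXS N.
  have s1 : N%:R + a != 0 by rewrite gt_eqF// ltr_wpDl.
  move=> E; apply: (mulfI s1); rewrite mulrBr -E mulrA mulrCA mulfV// mulr1.
  by move: (vI _) => m; ring.
rewrite -vintN /vint /lint; apply: le_Rintegral.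
- exact: measurable_sphere.
- exact: integrable_horner.
- exact: integrable_lint.
move=> x Sx; have /andP[v0 v1] := vcoord_itv Sx.
rewrite hornerN hornerD hornerN !hornerXn.
move: v0; rewrite le_eqVlt => /predU1P[<-|v0].
  by rewrite !(expr0n,exprS) !mul0r subr0 oppr_le0; case: (N == 0)%N.
rewrite exprSr -[X in X - _]mulr1 -mulrBr -mulrN opprB -mulrA ler_wpM2l ?exprn_ge0 ?(ltW v0)//.
exact: sub1_le_mul_ln.
Qed.

Lemma log_ratio_cvg0 : log_ratio n @[n --> \oo] --> 0.
Proof.
have a0 := a_gt0.
rewrite -cvg_shiftS.
apply: (@squeeze_cvgr _ _ _ _ (fun n => - (a / (n%:R + a))) (cst 0)).
- by apply: nearW => n; exact: log_ratio_bound.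
- rewrite -[X in _ --> X]oppr0; apply: cvgN.
  apply: (@squeeze_cvgr _ _ _ _ (cst 0) (fun n => (a + 1) * n.+1%:R^-1)).
  + apply: nearW => n; apply/andP; split; first by rewrite divr_ge0 ?addr_ge0// ltW.
    rewrite ler_pdivrMr ?ltr_wpDl// mulrAC ler_pdivlMr// -natr1.
    have : 0 <= (n%:R : R) by [].
    nra.
  + exact: cvg_cst.
  + rewrite -[X in _ --> X](mulr0 (a + 1)); apply: cvgMr; exact: cvg_harmonic.
- exact: cvg_cst.
Qed.

(** [log_ratio] telescopes from its value [lint 1] at 0 to its limit 0. *)
Lemma cvg_lint1 : \sum_(k < n) ((k%:R + a)^-1 - (k%:R + 2 * a)^-1) @[n --> \oo] --> - lint 1.
Proof.
have := log_ratio_cvg0.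
under eq_fun do rewrite log_ratio_sum.
move=> /(@cvgD _ _ _ _ _ (cst (- lint 1)) _ (- lint 1) _) => /(_ (cvg_cst _)).
rewrite addr0; apply: cvg_trans; apply: near_eq_cvg; apply: nearW => n /=.
by rewrite !fctE addKr.
Qed.

End log_moments.

(** * Gauss' formula for the digamma function at half-integers *)

Section gamma.
Context (R : realType).
Local Notation mu := (@lebesgue_measure R).
Implicit Types x y h t : R.

Definition gamma_integrand x t : R := t `^ (x - 1) * expR (- t).

(** Compact exhaustion of ]0, +oo[. [A 0] is the single point 1, so identities on proper segments
    are used from index n.+1 on. *)
Let A n : set R := `[(n.+1%:R : R)^-1, n.+1%:R]%classic.

Lemma is_derive_continuous (f : R -> R) t df : is_derive t 1 f df -> {for t, continuous f}.
Proof. by move=> [D _]; apply: differentiable_continuous; exact/derivable1_diffP. Qed.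

Lemma is_derive_gamma_primitive x t : 0 < t ->
  is_derive t 1 (fun t => t `^ x * expR (- t)) (x * gamma_integrand x t - gamma_integrand (x + 1) t).
Proof.
move=> t0; have dp := is_derive1_powR x t0.
apply: is_derive_eq.
rewrite /gamma_integrand addrK /GRing.scale/=; ring.
Qed.

Lemma continuous_gamma_integrand x (a b : R) : 0 < a -> {within `[a, b], continuous (gamma_integrand x)}.
Proof.
move=> a0; apply: derivable_within_continuous => t; rewrite in_itv/= => /andP[ta _].
have t0 := lt_le_trans a0 ta.
by have dp := is_derive1_powR (x - 1) t0; rewrite /gamma_integrand; apply: derivableM => //; apply: ex_derive.
Qed.

Lemma integrable_gamma_integrand_segment x (a b : R) : 0 < a ->
  mu.-integrable `[a, b] (EFin \o gamma_integrand x).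
Proof.
by move=> a0; apply: continuous_compact_integrable; [exact: segment_compact|exact: continuous_gamma_integrand].
Qed.

Lemma gamma_parts_segment x (a b : R) : 0 < a -> a < b ->
  x * \int[mu]_(t in `[a, b]) gamma_integrand x t =
  \int[mu]_(t in `[a, b]) gamma_integrand (x + 1) t + (b `^ x * expR (- b) - a `^ x * expR (- a)).
Proof.
move=> a0 ab; apply/eqP; rewrite addrC -subr_eq; apply/eqP.
have i1 := integrable_gamma_integrand_segment x b a0.
have i2 := integrable_gamma_integrand_segment (x + 1) b a0.
have mI : measurable (`[a, b]%classic : set (measurableTypeR R)) by exact: measurable_itv.
rewrite -RintegralZl// -RintegralB//; last exact: real_integrableZl.
rewrite /Rintegral.
have := @continuous_FTC2 R (fun t => x * gamma_integrand x t - gamma_integrand (x + 1) t) (fun t => t `^ x * expR (- t)) a b ab.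
move=> -> //.
- apply/subspace_continuousP => t tab; apply: cvgB.
    by apply: cvgMr; have /subspace_continuousP := @continuous_gamma_integrand x a b a0; apply.
  by have /subspace_continuousP := @continuous_gamma_integrand (x + 1) a b a0; apply.
- split.
  + move=> t; rewrite in_itv/= => /andP[/(lt_trans a0) t0 _].
    by have [] := is_derive_gamma_primitive x t0.
  + apply: cvg_at_right_filter; exact: is_derive_continuous (is_derive_gamma_primitive x a0).
  + apply: cvg_at_left_filter.
    exact: is_derive_continuous (is_derive_gamma_primitive x (lt_trans a0 ab)).
- move=> t; rewrite in_itv/= => /andP[/(lt_trans a0) t0 _].
  by rewrite derive1E; have [_ ->] := is_derive_gamma_primitive x t0.
Qed.

(* [e ^ (t / (2 x)) >= t / (2 x)] *)
Lemma powR_expR_bound x t : 0 < x -> 0 <= t -> t `^ x * expR (- t) <= (2 * x) `^ x * expR (- (t / 2)).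
Proof.
move=> x0 t0.
have -> : expR (- t) = expR (- (t / 2)) * expR (- (t / 2)) by rewrite -expRD; congr expR; field.
rewrite mulrA ler_wpM2r ?expR_ge0// expRN ler_pdivrMr ?expR_gt0//.
have -> : expR (t / 2) = (expR (t / (2 * x))) `^ x.
  by rewrite -expRM_natl || (rewrite /powR gt_eqF ?expR_gt0// expRK; congr expR; field; rewrite gt_eqF).
rewrite -powRM ?expR_ge0//; last by rewrite mulr_ge0// ltW.
apply: ge0_ler_powR; rewrite ?nnegrE ?(ltW x0)//.
  by rewrite !mulr_ge0 ?expR_ge0// ltW.
have := expR_ge1Dx (t / (2 * x)); move=> /(ler_wpM2l (ltW (mulr_gt0 (ltr0Sn R 1) x0))).
apply: le_trans; rewrite mulrDr mulr1 mulrC [X in _ + X]mulrC divfK ?lerDr ?mulr_ge0 ?(ltW x0)//.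
by rewrite gt_eqF// mulr_gt0.
Qed.

Lemma continuous_expR_half : continuous (fun t : R => expR (- (t / 2))).
Proof.
move=> t; apply: is_derive_continuous (_ : is_derive t 1 _ (- (expR (- (t / 2)) / 2))).
by apply: is_derive_eq; rewrite /GRing.scale/=; field.
Qed.

Lemma Rintegral_expR_half_bound (a b : R) : 0 < a -> a < b ->
  \int[mu]_(t in `[a, b]) expR (- (t / 2)) <= 2.
Proof.
move=> a0 ab; rewrite /Rintegral.
have D t : is_derive t 1 (fun t : R => - (2 * expR (- (t / 2)))) (expR (- (t / 2))).
  by apply: is_derive_eq; rewrite /GRing.scale/=; field.
have C t := is_derive_continuous (D t).
have C' := continuous_expR_half.
rewrite (@continuous_FTC2 R _ (fun t => - (2 * expR (- (t / 2)))) a b ab)//=.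
- have e1 : expR (- (a / 2)) <= 1 by rewrite -expR0 ler_expR oppr_le0 divr_ge0// ltW.
  have e2 := expR_ge0 (- (b / 2)); lra.
- by apply: continuous_subspaceT => t; exact: C'.
- split.
  + by move=> t _; have [] := D t.
  + apply: cvg_at_right_filter; exact: C.
  + apply: cvg_at_left_filter; exact: C.
- by move=> t _; rewrite derive1E; have [_ ->] := D t.
Qed.

Definition gamma_approx x n := \int[mu]_(t in A n) gamma_integrand x t.

Let A0 n : 0 < (n.+1%:R : R)^-1. Proof. by rewrite invr_gt0. Qed.

Let Alt n : ((n.+2%:R : R)^-1 < n.+2%:R)%R.
Proof. by rewrite (@lt_trans _ _ 1)// ?invf_lt1// ltr1n. Qed.

Let mA n : measurable (A n : set (measurableTypeR R)). Proof. exact: measurable_itv. Qed.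

Lemma gamma_integrand_ge0 x t : 0 <= gamma_integrand x t.
Proof. by rewrite mulr_ge0 ?powR_ge0 ?expR_ge0. Qed.

Lemma measurable_gamma_integrand x (D : set (measurableTypeR R)) :
  measurable_fun D (EFin \o gamma_integrand x).
Proof.
apply/measurable_EFinP; apply: measurable_funTS.
apply: measurable_funM; first exact: measurable_powR.
by apply: measurableT_comp => //; exact: measurable_funN.
Qed.

Lemma gamma_approx_le x n : 0 < x -> gamma_approx (x + 1) n.+1 <= 2 * (2 * x) `^ x.
Proof.
move=> x0; rewrite /gamma_approx.
have iE : mu.-integrable (A n.+1) (EFin \o (fun t : R => expR (- (t / 2)))).
  apply: continuous_compact_integrable; first exact: segment_compact.
  by apply: continuous_subspaceT; exact: continuous_expR_half.
apply: (@le_trans _ _ (\int[mu]_(t in A n.+1) ((2 * x) `^ x * expR (- (t / 2))))).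
  apply: le_Rintegral => //.
  - exact: integrable_gamma_integrand_segment (A0 n.+1).
  - exact: real_integrableZl.
  move=> t; rewrite /A/= in_itv/= => /andP[t0 _].
  rewrite /gamma_integrand addrK powR_expR_bound//.
  by apply: le_trans t0; rewrite ltW.
rewrite RintegralZl// mulrC ler_wpM2r ?powR_ge0//.
exact: Rintegral_expR_half_bound (A0 n.+1) (Alt n).
Qed.

Lemma gamma_approxS x n : 0 < x -> x * gamma_approx x n.+1 = gamma_approx (x + 1) n.+1 +
  (n.+2%:R `^ x * expR (- n.+2%:R) - n.+2%:R^-1 `^ x * expR (- n.+2%:R^-1)).
Proof. by move=> x0; exact: gamma_parts_segment (A0 n.+1) (Alt n). Qed.

Lemma bigcup_A : \bigcup_n A n = `]0, +oo[%classic.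
Proof.
apply/seteqP; split=> t /=.
  by move=> [n _]; rewrite /A/= !in_itv/= andbT => /andP[t0 _]; apply: lt_le_trans t0.
rewrite in_itv/= andbT => t0.
have [n nt] : exists n, Num.max t t^-1 <= n.+1%:R.
  exists (Num.truncn (Num.max t t^-1)); apply/ltW; exact: truncnS_gt.
exists n => //; rewrite /A/= in_itv/=.
move: nt; rewrite ge_max => /andP[-> /=]; rewrite andbT => nt.
by rewrite -[t]invrK lef_pV2 ?posrE ?invr_gt0.
Qed.

Lemma cvg_gamma_approx_ereal x : (gamma_approx x n)%:E @[n --> \oo] -->
  (\int[mu]_(t in `]0%R, +oo[) (gamma_integrand x t)%:E)%E.
Proof.
rewrite -bigcup_A.
rewrite (_ : (fun n => (gamma_approx x n)%:E) = (fun n => \int[mu]_(t in A n) (gamma_integrand x t)%:E)%E).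
  apply: (@ge0_nondecreasing_set_cvg_integral _ (measurableTypeR R) R A (EFin \o gamma_integrand x) mu).
  - apply/nondecreasing_seqP => n; rewrite subsetEset => t; rewrite /A/= !in_itv/= => /andP[t0 t1].
    rewrite (le_trans _ t0) ?(le_trans t1) ?ler_nat// lef_pV2 ?posrE// ler_nat//.
  - by move=> n; exact: mA.
  - by move=> n; exact: measurable_gamma_integrand.
  - by move=> n t _; rewrite lee_fin gamma_integrand_ge0.
apply/funext => n; rewrite /gamma_approx EFin_Rintegral//.
exact: integrable_gamma_integrand_segment (A0 n).
Qed.

(** The segment recurrence trades x for x + 1, whose integrand stays bounded near 0; this covers 0 <
    x < 1. *)
Lemma gamma_approx_bound x : 0 < x -> exists M : R, forall n, gamma_approx x n.+1 <= M.
Proof.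
move=> x0; exists (x^-1 * (2 * (2 * x) `^ x + (2 * x) `^ x)) => n.
rewrite -(ler_pM2l x0) mulrA mulfV ?gt_eqF// mul1r gamma_approxS// lerD ?gamma_approx_le//.
apply: (@le_trans _ _ (n.+2%:R `^ x * expR (- n.+2%:R))).
  by rewrite gerBl mulr_ge0 ?powR_ge0 ?expR_ge0.
apply: le_trans (powR_expR_bound x0 (ler0n _ _)) _.
by rewrite ler_piMr ?powR_ge0// -expR0 ler_expR oppr_le0 divr_ge0.
Qed.

Lemma integrable_gamma x : 0 < x -> mu.-integrable `]0, +oo[ (EFin \o gamma_integrand x).
Proof.
move=> x0; apply/integrableP; split.
  exact: measurable_gamma_integrand.
have [M HM] := gamma_approx_bound x0.
apply: (@le_lt_trans _ _ M%:E); last exact: ltry.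
rewrite (_ : (\int[mu]_(t in `]0%R, +oo[) `|(EFin \o gamma_integrand x) t| = \int[mu]_(t in `]0%R, +oo[) (gamma_integrand x t)%:E)%E).
  apply: cvge_le (@cvg_gamma_approx_ereal x).
  by exists 1%N => // -[//|n] _; rewrite /= lee_fin.
by apply: eq_integral => t _; rewrite /= ger0_norm// gamma_integrand_ge0.
Qed.

Lemma cvg_gamma_approx x : 0 < x -> gamma_approx x n @[n --> \oo] --> gamma_fun x.
Proof.
move=> x0; have := @cvg_gamma_approx_ereal x.
rewrite EFin_Rintegral; [|exact: measurable_itv|exact: integrable_gamma].
exact: fine_cvg.
Qed.

Lemma cvg_gamma_boundary x : 0 < x ->
  n.+2%:R `^ x * expR (- n.+2%:R) - (n.+2%:R : R)^-1 `^ x * expR (- n.+2%:R^-1) @[n --> \oo] --> 0.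
Proof.
move=> x0; rewrite -[X in _ --> X](subr0 0); apply: cvgB.
  apply: (@squeeze_cvgr _ _ _ _ (cst 0) (fun n => (2 * x) `^ x * 2 * n.+1%:R^-1)).
  - apply: nearW => n; rewrite mulr_ge0 ?powR_ge0 ?expR_ge0//=.
    apply: le_trans (powR_expR_bound x0 (ler0n _ _)) _.
    rewrite -mulrA ler_wpM2l ?powR_ge0// expRN ler_pdivlMr// mulrC ler_pdivrMr ?expR_gt0//.
    have := expR_ge1Dx (n.+2%:R / 2 : R); move: (expR _) => e; rewrite -(natr1 n.+1).
    by move: (n.+1%:R : R) => N; lra.
  - exact: cvg_cst.
  - rewrite -[X in _ --> X](mulr0 ((2 * x) `^ x * 2)); apply: cvgMr; exact: cvg_harmonic.
apply: (@squeeze_cvgr _ _ _ _ (cst 0) (fun n => (n.+2%:R : R)^-1 `^ x)).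
- apply: nearW => n; rewrite mulr_ge0 ?powR_ge0 ?expR_ge0//=.
  by rewrite ler_piMr ?powR_ge0// -expR0 ler_expR oppr_le0 invr_ge0.
- exact: cvg_cst.
- have /cvg_at_rightP := powR_cvg0 x0; apply; split; first by move=> n; rewrite invr_gt0.
  have h := @cvg_harmonic R; rewrite -cvg_shiftS in h; exact: h.
Qed.

Lemma gamma_funS x : 0 < x -> gamma_fun (x + 1) = x * gamma_fun x.
Proof.
move=> x0; have x1 : 0 < x + 1 by rewrite addr_gt0.
have cS y : 0 < y -> gamma_approx y n.+1 @[n --> \oo] --> gamma_fun y.
  by move=> y0; have h := cvg_gamma_approx y0; rewrite -cvg_shiftS in h; exact: h.
have c3 : x * gamma_approx x n.+1 @[n --> \oo] --> gamma_fun (x + 1).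
  rewrite (_ : (fun n => x * gamma_approx x n.+1) = (fun n => gamma_approx (x + 1) n.+1 +
    (n.+2%:R `^ x * expR (- n.+2%:R) - n.+2%:R^-1 `^ x * expR (- n.+2%:R^-1)))).
    by rewrite -[X in _ --> X]addr0; apply: cvgD; [exact: cS|exact: cvg_gamma_boundary].
  by apply/funext => n; rewrite gamma_approxS.
have c4 : x * gamma_approx x n.+1 @[n --> \oo] --> x * gamma_fun x.
  by apply: cvgMr; exact: cS.
by rewrite -(cvg_lim _ c3)// -(cvg_lim _ c4).
Qed.

(** On [1, 2] the integrand is at least e^(-2) / 2, because t^(x-1) = t^x / t >= 1/2. *)
Lemma gamma_fun_gt0 x : 0 < x -> 0 < gamma_fun x.
Proof.
move=> x0.
have i1 : mu.-integrable `[1, 2] (EFin \o gamma_integrand x) by exact: integrable_gamma_integrand_segment.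
have mI : measurable (`[1, 2]%classic : set (measurableTypeR R)) by exact: measurable_itv.
have e0 := expR_gt0 (- 2 : R).
apply: (@lt_le_trans _ _ (\int[mu]_(t in `[1, 2]) (2^-1 * expR (- 2)))).
  have m12 : mu `[1%R, 2%R]%classic = 1%E.
    by rewrite lebesgue_measure_itv/= lte_fin ltr1n -EFinB (_ : 2 - 1 = 1 :> R)//; ring.
  rewrite (@Rintegral_cst _ _ _ mu `[1, 2] mI) [X in fine X](_ : _ = 1%E)//.
  by rewrite mulr1 mulr_gt0// invr_gt0.
apply: (@le_trans _ _ (\int[mu]_(t in `[1, 2]) gamma_integrand x t)).
  apply: le_Rintegral => //.
    have := @integrable_gamma_integrand_segment 1 1 2 ltr01.
    move=> _; apply: continuous_compact_integrable; first exact: segment_compact.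
    by apply: continuous_subspaceT => t; exact: cst_continuous.
  move=> t /=; rewrite in_itv/= => /andP[t1 t2]; have t0 : 0 < t by exact: lt_le_trans t1.
  rewrite /gamma_integrand ler_pM ?invr_ge0 ?expR_ge0//; last by rewrite ler_expR lerN2.
  rewrite powRB; last by rewrite (gt_eqF t0) implybT.
  rewrite powRr1 ?(ltW t0)// -[2^-1]mul1r; apply: ler_pM; rewrite ?invr_ge0//.
    rewrite [leLHS](_ : 1 = 1 `^ x); last by rewrite powR1.
    by apply: ge0_ler_powR; rewrite ?nnegrE ?(ltW x0) ?(ltW t0).
  by rewrite lef_pV2 ?posrE.
rewrite /gamma_fun /Rintegral fine_le//.
- by apply: integrable_fin_num => //; exact: i1.
- by apply: integrable_fin_num; [exact: measurable_itv|exact: integrable_gamma].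
- apply: ge0_subset_integral => //.
  + exact: measurable_gamma_integrand.
  + by move=> t _; rewrite lee_fin gamma_integrand_ge0.
  + by move=> t /=; rewrite !in_itv/= andbT => /andP[t1 _]; exact: lt_le_trans t1.
Qed.

(** Tangent line at [y] of the concave function t^h. With s = t / y and z = 1 + h (s - 1), adding h
    times ln (s/z) <= s/z - 1 and 1 - h times ln (1/z) <= 1/z - 1 gives h ln s <= ln z, since the
    right-hand sides add up to 0. *)
Lemma powR_tangent (y h t : R) : 0 < y -> 0 <= h <= 1 -> 0 < t ->
  t `^ h <= y `^ h + h * y `^ h / y * (t - y).
Proof.
move=> y0 /andP[h0 h1] t0.
have -> : t `^ h = (t / y) `^ h * y `^ h.
  by rewrite -powRM ?divfK ?divr_ge0 ?gt_eqF ?ltW.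
have -> : y `^ h + h * y `^ h / y * (t - y) = (1 + h * (t / y - 1)) * y `^ h.
  by field; rewrite gt_eqF.
rewrite ler_wpM2r ?powR_ge0//.
set s := t / y; have s0 : 0 < s by rewrite divr_gt0.
have z0 : 0 < 1 + h * (s - 1).
  by move: h0; rewrite le_eqVlt => /predU1P[<-|h0]; [rewrite mul0r addr0|nra].
rewrite /powR gt_eqF// -[leRHS]lnK ?posrE// ler_expR.
set z := 1 + _ in z0 *.
have ln_le (u : R) : 0 < u -> ln u <= u - 1.
  by move=> u0; have := @le_ln1Dx _ (u - 1); rewrite addrCA subrr addr0; apply; lra.
have h2 : h * (ln s - ln z) <= h * (s / z - 1).
  by rewrite ler_wpM2l// -ln_div ?posrE// ln_le// divr_gt0.
have h3 : (1 - h) * - ln z <= (1 - h) * (z^-1 - 1).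
  by rewrite ler_wpM2l ?subr_ge0// -lnV ?posrE// ln_le// invr_gt0.
have : h * (s / z - 1) + (1 - h) * (z^-1 - 1) = 0.
  rewrite (_ : _ + _ = z / z - 1); last by rewrite /z; ring.
  by rewrite divff ?gt_eqF// subrr.
lra.
Qed.

(** Integrate the tangent bound against t^(y-1) e^(-t). The point of tangency [y] is the mean of the
    Gamma(y) law, so the linear term integrates to 0. *)
Lemma gamma_fun_wendel y h : 0 < y -> 0 <= h <= 1 -> gamma_fun (y + h) <= y `^ h * gamma_fun y.
Proof.
move=> y0 h01; have /andP[h0 h1] := h01.
have yh : 0 < y + h by rewrite ltr_pwDl.
have y1 : 0 < y + 1 by rewrite addr_gt0.
pose c := h * y `^ h / y.
have -> : y `^ h * gamma_fun y = (y `^ h - c * y) * gamma_fun y + c * gamma_fun (y + 1).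
  by rewrite gamma_funS//; ring.
have mI : measurable (`]0, +oo[%classic : set (measurableTypeR R)) by exact: measurable_itv.
rewrite /gamma_fun -!RintegralZl//; [|exact: integrable_gamma|exact: integrable_gamma].
rewrite -RintegralD//; [|apply: real_integrableZl => //; exact: integrable_gamma|apply: real_integrableZl => //; exact: integrable_gamma].
apply: le_Rintegral => //.
- exact: integrable_gamma.
- by apply: real_integrableD => //; apply: real_integrableZl => //; exact: integrable_gamma.
move=> t /=; rewrite in_itv/= andbT => t0.
rewrite !mulrA -mulrDl ler_wpM2r ?expR_ge0//.
have pD u : t `^ (u + (y - 1)) = t `^ u * t `^ (y - 1).
  by rewrite powRD// (gt_eqF t0) implybT.
have -> : y + h - 1 = h + (y - 1) by ring.
have -> : y + 1 - 1 = 1 + (y - 1) by ring.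
rewrite !pD powRr1 ?(ltW t0)// mulrA -mulrDl ler_wpM2r ?powR_ge0//.
by apply: le_trans (powR_tangent y0 h01 t0) _; rewrite -/c le_eqVlt; apply/orP; left; apply/eqP; ring.
Qed.

(** * Derivative of ln Gamma and Gauss' limit *)

Definition ln_gamma x := ln (gamma_fun x).

Lemma ln_gammaD1 x : 0 < x -> ln_gamma (x + 1) = ln_gamma x + ln x.
Proof.
by move=> x0; rewrite /ln_gamma gamma_funS// lnM ?posrE ?gamma_fun_gt0// addrC.
Qed.

Lemma ln_gammaDn x n : 0 < x -> ln_gamma (x + n%:R) = ln_gamma x + \sum_(k < n) ln (x + k%:R).
Proof.
move=> x0; elim: n => [|n IH]; first by rewrite big_ord0 !addr0.
by rewrite -natr1 addrA ln_gammaD1 ?ltr_wpDr// IH big_ord_recr/= addrA.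
Qed.

Lemma ln_diff_le (u v : R) : 0 < u -> 0 < v -> ln v - ln u <= (v - u) / u.
Proof.
move=> u0 v0; rewrite -ln_div ?posrE//; have -> : v / u = 1 + (v - u) / u by field; rewrite gt_eqF.
by apply: le_ln1Dx; rewrite ltr_pdivlMr//; lra.
Qed.

Lemma ln_gamma_upper y h : 0 < y -> 0 <= h <= 1 -> ln_gamma (y + h) <= ln_gamma y + h * ln y.
Proof.
move=> y0 h01; have /andP[h0 h1] := h01.
have yh : 0 < y + h by rewrite ltr_pwDl.
rewrite /ln_gamma -ln_powR [leRHS]addrC -lnM ?posrE ?powR_gt0 ?gamma_fun_gt0//.
by rewrite ler_ln ?posrE ?mulr_gt0 ?powR_gt0 ?gamma_fun_gt0// gamma_fun_wendel.
Qed.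

(** The upper bound from y + h with step 1 - h ends at y + 1, and the functional equation leads back
    to y. *)
Lemma ln_gamma_lower y h : 0 < y -> 0 <= h <= 1 ->
  ln_gamma y + h * (ln y - y^-1) <= ln_gamma (y + h).
Proof.
move=> y0 h01; have /andP[h0 h1] := h01.
have yh : 0 < y + h by rewrite ltr_pwDl.
have := @ln_gamma_upper (y + h) (1 - h) yh.
rewrite subr_ge0 h1 gerBl h0 => /(_ isT).
rewrite (_ : y + h + (1 - h) = y + 1); last by ring.
rewrite ln_gammaD1//.
have := ln_diff_le y0 yh; rewrite (_ : y + h - y = h); last by ring.
have yi : 0 < y^-1 by rewrite invr_gt0.
move: (ln (y + h)) (ln y) (ln_gamma y) (ln_gamma (y + h)) y^-1 yi => l2 l g1 g2 u u0 H1 H2.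
have h1' : 0 <= 1 - h by rewrite subr_ge0.
have := ler_wpM2l h1' H1; have := mulr_ge0 (mulr_ge0 h0 h0) (ltW u0).
move: H2; lra.
Qed.

(** For h < 0 the one-sided bounds are applied from y + h, which is at least y - 1: one 1 / (y - 1)
    pays for (y + h)^-1, the other for ln y - ln (y + h). *)
Lemma ln_gamma_slope y h : 2 <= y -> `|h| <= 1 ->
  `|ln_gamma (y + h) - ln_gamma y - h * ln y| <= `|h| * (2 / (y - 1)).
Proof.
move=> y2 h1; have y0 : 0 < y by lra.
have y1 : 0 < y - 1 by lra.
have yi : y^-1 <= (y - 1)^-1 by rewrite lef_pV2 ?posrE//; lra.
have [h0|h0] := leP 0 h.
  rewrite ger0_norm// in h1 *.
  have h01 : 0 <= h <= 1 by rewrite h0.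
  have H1 := ln_gamma_upper y0 h01; have H2 := ln_gamma_lower y0 h01.
  have C : 0 < (y - 1)^-1 by rewrite invr_gt0.
  have H3 := ler_wpM2l h0 yi; have H4 := mulr_ge0 h0 (ltW C).
  move: (ln_gamma (y + h)) (ln_gamma y) (ln y) (y^-1) ((y - 1)^-1) H1 H2 H3 H4 => g2 g1 l u w H1 H2 H3 H4.
  by rewrite ler_norml; apply/andP; split; lra.
rewrite ltr0_norm// in h1 *.
have h01 : 0 <= - h <= 1 by rewrite oppr_ge0 ltW.
have [k0 _] := andP h01.
have yh : 0 < y + h by lra.
have yhi : (y + h)^-1 <= (y - 1)^-1 by rewrite lef_pV2 ?posrE//; lra.
have H3 : ln y - ln (y + h) <= (y - 1)^-1.
  apply: le_trans (ln_diff_le yh y0) _.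
  have -> : y - (y + h) = - h by ring.
  apply: le_trans yhi; rewrite ler_piMl// invr_ge0; lra.
have H4 : ln (y + h) <= ln y by rewrite ler_ln ?posrE//; lra.
have H1 := ln_gamma_upper yh h01; have H2 := ln_gamma_lower yh h01.
rewrite (_ : y + h + - h = y) in H1 H2; last by ring.
have H5 := ler_wpM2l k0 yhi; have H6 := ler_wpM2l k0 H3; have H7 := ler_wpM2l k0 H4.
have H8 : 0 < (y - 1)^-1 by rewrite invr_gt0.
have H9 := mulr_ge0 k0 (ltW H8).
move: (ln_gamma (y + h)) (ln_gamma y) (ln y) (ln (y + h)) ((y + h)^-1) ((y - 1)^-1) H1 H2 H5 H6 H7 H9.
move=> g2 g1 l l2 u w H1 H2 H5 H6 H7 H9.
by rewrite ler_norml; apply/andP; split; lra.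
Qed.

(* Truncations of Gauss' formula for the digamma function. *)
Definition digamma_approx x n := ln (x + n%:R) - \sum_(k < n) (x + k%:R)^-1.

Lemma digamma_approx_nincr x : 0 < x -> nonincreasing_seq (digamma_approx x).
Proof.
move=> x0; apply/nonincreasing_seqP => n; rewrite /digamma_approx big_ord_recr/=.
have xn : 0 < x + n%:R by rewrite ltr_wpDr.
have := ln_diff_le xn (ltr_wpDr (ler0n R 1) xn).
rewrite -addrA natr1 (_ : x + n.+1%:R - (x + n%:R) = 1); last by rewrite -natr1; ring.
by rewrite div1r; move: (ln _) (ln _) (\sum_(_ < _) _) (_^-1) => ? ? ? ?; lra.
Qed.

Lemma digamma_approx_bound x n : 0 < x -> ln x - x^-1 <= digamma_approx x n.
Proof.
move=> x0; rewrite /digamma_approx.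
suff H : \sum_(k < n) (x + k%:R)^-1 <= x^-1 + ln (x + n%:R) - ln x by lra.
case: n => [|n].
  by rewrite big_ord0 addr0 addrK invr_ge0 ltW.
(* The induction proves the stronger bound with x + n in place of x + n.+1, the one that the
   integral comparison gives. *)
have lemono : ln (x + n%:R) <= ln (x + n.+1%:R).
  by rewrite ler_ln ?posrE ?ltr_wpDr// lerD2l ler_nat.
suff H : \sum_(k < n.+1) (x + k%:R)^-1 <= x^-1 + ln (x + n%:R) - ln x by lra.
elim: n {lemono} => [|n IH]; first by rewrite big_ord1 addr0 addrK.
rewrite big_ord_recr/=.
have xn : 0 < x + n%:R by rewrite ltr_wpDr.
have xn1 : 0 < x + n.+1%:R by rewrite ltr_wpDr.
have := ln_diff_le xn1 xn.
rewrite (_ : x + n%:R - (x + n.+1%:R) = -1); last by rewrite -natr1; ring.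
rewrite mulN1r.
by move: IH; move: (ln _) (ln _) (ln _) (\sum_(_ < _) _) (_^-1) (_^-1) => ? ? ? ? ? ?; lra.
Qed.

Lemma is_cvg_digamma_approx x : 0 < x -> cvgn (digamma_approx x).
Proof.
move=> x0; apply: nonincreasing_is_cvgn; first exact: digamma_approx_nincr.
by exists (ln x - x^-1) => _ [n _ <-]; exact: digamma_approx_bound.
Qed.

Lemma is_derive_quotient (f : R -> R) t df : is_derive t 1 f df ->
  h^-1 * (f (h + t) - f t) @[h --> 0^'] --> df.
Proof.
move=> [D <-]; have := D; rewrite /derivable => /cvg_ex[l c].
have E : (fun h : R => h^-1 *: (f (h *: (1 : R) + t) - f t)) =
         (fun h => h^-1 * (f (h + t) - f t)).
  by apply/funext => h; rewrite [h *: _]mulr1.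
rewrite /derive; rewrite E in c *; move: (c) => /cvg_lim -> //.
Qed.

(* For large [n], [ln_gamma (x + n + h) - ln_gamma (x + n)] is close to [h * ln (x + n)];
   the functional equation brings this back to [x]. *)
Lemma is_derive_ln_gamma x : 0 < x -> is_derive x 1 ln_gamma (limn (digamma_approx x)).
Proof.
move=> x0; set l := limn _.
suff c : h^-1 *: (ln_gamma (h + x) - ln_gamma x) @[h --> 0^'] --> l.
  have E : (fun h => h^-1 *: (ln_gamma (h *: (1 : R) + x) - ln_gamma x)) =
           (fun h => h^-1 *: (ln_gamma (h + x) - ln_gamma x)).
    by apply/funext => h; rewrite [h *: _]mulr1.
  apply: DeriveDef; first by rewrite /derivable E; apply/cvg_ex; exists l.
  by rewrite /derive E; exact: cvg_lim c.
apply/cvgrPdist_le => e e0.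
have e3 : 0 < e / 3 by rewrite divr_gt0.
have /cvgrPdist_le/(_ _ e3)[N0 _ HN0] : digamma_approx x n @[n --> \oo] --> l.
  exact: is_cvg_digamma_approx.
(* [N0] brings the truncation within e / 3 of [l], [2] meets the hypothesis of [ln_gamma_slope], and
   the last summand brings its error below e / 3. *)
pose N := (N0 + 2 + Num.truncn (6 / e))%N.
have lN : `|l - digamma_approx x N| <= e / 3 by apply: HN0; rewrite /= /N -addnA leq_addr.
have N2 : 2 <= x + N%:R.
  rewrite (@le_trans _ _ (N%:R : R)) ?lerDr ?(ltW x0)// ?lerDl ?(ltW x0)//.
  by rewrite ler_nat /N addnAC leq_addl.
have Ne : 2 / (x + N%:R - 1) <= e / 3.
  have p : 0 < x + N%:R - 1 by lra.
  rewrite ler_pdivrMr//.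
  have : 6 / e <= x + N%:R - 1.
    have : (Num.truncn (6 / e))%:R + 2 <= (N%:R : R).
      by rewrite -natrD ler_nat /N -addnA [leqRHS]addnC [(2 + _)%N]addnC leq_addr.
    have := truncnS_gt (6 / e); rewrite -(natr1 (Num.truncn (6 / e))).
    move: ((Num.truncn (6 / e))%:R : R) (6 / e) (N%:R : R) => A1 C1 B1; move: x0 {p}; lra.
  rewrite ler_pdivrMr// => h6; lra.
have cN : \sum_(k < N) h^-1 * (ln (h + (x + k%:R)) - ln (x + k%:R)) @[h --> 0^'] -->
    \sum_(k < N) (x + k%:R)^-1.
  elim: (N) => [|M IH].
    under eq_fun do rewrite big_ord0; rewrite big_ord0; exact: cvg_cst.
  under eq_fun do rewrite big_ord_recr/=; rewrite big_ord_recr/=.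
  apply: cvgD; first exact: IH.
  by apply: is_derive_quotient; apply: is_derive1_ln; rewrite ltr_wpDr.
have /cvgrPdist_le/(_ _ e3) near3 := cN.
near=> h.
have h0 : h != 0 by near: h; exact: nbhs_dnbhs_neq.
have h1 : `|h| <= 1.
  near: h; apply: nbhs_dnbhs; have := @nbhs0_le R R 1 ltr01; apply: filterS => t; exact.
have hx : `|h| < x.
  near: h; apply: nbhs_dnbhs; have := @nbhs0_lt R R x x0; apply: filterS => t; exact.
have H3 : `|\sum_(k < N) (x + k%:R)^-1 - \sum_(k < N) h^-1 * (ln (h + (x + k%:R)) - ln (x + k%:R))| <= e / 3.
  by near: h.
have xh : 0 < x + h by move: hx; rewrite ltr_norml => /andP[]; lra.
have := ln_gamma_slope N2 h1.
have -> : x + N%:R + h = x + h + N%:R by ring.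
rewrite !ln_gammaDn//.
have -> : \sum_(k < N) ln (x + h + k%:R) = \sum_(k < N) ln (x + k%:R) +
    h * \sum_(k < N) h^-1 * (ln (h + (x + k%:R)) - ln (x + k%:R)).
  rewrite -mulr_sumr mulVKf// -big_split/=; apply: eq_bigr => k _.
  have -> : x + h + k%:R = h + (x + k%:R) by ring.
  by rewrite addrC subrK.
move: lN H3; rewrite /digamma_approx.
move: (\sum_(k < N) ln _) (\sum_(k < N) _^-1) (\sum_(k < N) _ * _) => A1 A2 A3.
rewrite (addrC h x) -[_ *: _]/(h^-1 * _).
move: (ln_gamma (x + h)) (ln_gamma x) (ln (x + N%:R)) (2 / _) Ne => g2 g1 lx w Ne lN H3 H4.
have {}H4 : `|lx - h^-1 * (g2 - g1) - A3| <= e / 3.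
  rewrite -(ler_pM2l (_ : 0 < `|h|)) ?normr_gt0//.
  have E : h * (lx - h^-1 * (g2 - g1) - A3) = - (g2 + (A1 + h * A3) - (g1 + A1) - h * lx) by field.
  by rewrite -normrM E normrN; exact: le_trans H4 (ler_wpM2l (normr_ge0 h) Ne).
(* Three errors of e / 3: truncation of Gauss' formula, slope of [ln_gamma] at x + N, difference
   quotients of the N logarithms. *)
rewrite (_ : l - h^-1 * (g2 - g1) = (l - (lx - A2)) + (lx - h^-1 * (g2 - g1) - A3) - (A2 - A3)); last by ring.
rewrite (le_trans (ler_normB _ _))// (le_trans (lerD (ler_normD _ _) (lexx _)))//.
by move: lN H3 H4; lra.
Unshelve. all: by end_near. Qed.

Lemma cvg_digamma x : 0 < x -> digamma_approx x n @[n --> \oo] --> digamma x.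
Proof.
move=> x0; have [_ D] := is_derive_ln_gamma x0.
have -> : digamma x = limn (digamma_approx x) by rewrite /digamma derive1E; exact: D.
exact: is_cvg_digamma_approx.
Qed.

Lemma cvg_div_addn (c x : R) : 0 < x -> c / (x + n%:R) @[n --> \oo] --> 0.
Proof.
move=> x0; have : `|c| / (x + n%:R) @[n --> \oo] --> 0.
  apply: (@squeeze_cvgr _ _ _ _ (cst 0) (fun n => (`|c| * (1 + x^-1)) * n.+1%:R^-1)).
  - apply: nearW => n; have xn : 0 < x + n%:R by rewrite ltr_wpDr.
    rewrite divr_ge0 ?(ltW xn)//= -mulrA ler_wpM2l//.
    rewrite ler_pdivlMr// mulrC ler_pdivrMr// -natr1 mulrDl mul1r mulrDr mulVf ?gt_eqF//.
    have : 0 <= x^-1 * n%:R by rewrite mulr_ge0// invr_ge0 ltW.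
    by move: x0; move: (n%:R : R) (x^-1 * n%:R) => A1 A2; lra.
  - exact: cvg_cst.
  - by rewrite -[X in _ --> X](mulr0 (`|c| * (1 + x^-1))); apply: cvgMr; exact: cvg_harmonic.
rewrite (_ : (fun n => `|c| / (x + n%:R)) = (fun n => `|c / (x + n%:R)|)); first exact: norm_cvg0.
by apply/funext => n; rewrite normrM normfV (@ger0_norm _ (x + n%:R))// ltW// ltr_wpDr.
Qed.

Lemma cvg_ln_diff x y : 0 < x -> 0 < y -> ln (x + n%:R) - ln (y + n%:R) @[n --> \oo] --> 0.
Proof.
move=> x0 y0.
apply: (@squeeze_cvgr _ _ _ _ (fun n => (x - y) / (x + n%:R)) (fun n => (x - y) / (y + n%:R))).
- apply: nearW => n; have xn : 0 < x + n%:R by rewrite ltr_wpDr.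
  have yn : 0 < y + n%:R by rewrite ltr_wpDr.
  have E (u v : R) : u + n%:R - (v + n%:R) = u - v by ring.
  have := ln_diff_le xn yn; have := ln_diff_le yn xn; rewrite !E => H1 H2.
  by apply/andP; split => //; rewrite -lerN2 -mulNr !opprB.
- exact: cvg_div_addn.
- exact: cvg_div_addn.
Qed.

(** * Differences of digamma values as series *)

Lemma cvg_digamma_diff x y : 0 < x -> 0 < y ->
  \sum_(k < n) ((x + k%:R)^-1 - (y + k%:R)^-1) @[n --> \oo] --> digamma y - digamma x.
Proof.
move=> x0 y0.
rewrite (_ : (fun n => _) = (fun n => digamma_approx y n - digamma_approx x n +
    (ln (x + n%:R) - ln (y + n%:R)))).
  rewrite -[X in _ --> X]addr0; apply: cvgD; last exact: cvg_ln_diff.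
  by apply: cvgB; exact: cvg_digamma.
by apply/funext => n; rewrite /digamma_approx sumrB; ring.
Qed.

(** The series of psi(m + 1) - psi(1): raising m by 1 changes the partial sum by 1 / (m + 1) - 1 /
    (m + 1 + n), by telescoping. *)
Lemma cvg_harmonic_number m :
  \sum_(k < n) ((1 + k%:R)^-1 - (m.+1%:R + k%:R)^-1) @[n --> \oo] --> harmonic_number R m.
Proof.
elim: m => [|m IH].
  rewrite /harmonic_number big_geq// (_ : (fun n => _) = cst 0); first exact: cvg_cst.
  by apply/funext => n; rewrite big1// => k _; rewrite subrr.
rewrite (_ : (fun n => _) = (fun n => \sum_(k < n) ((1 + k%:R)^-1 - (m.+1%:R + k%:R)^-1) +
    (m.+1%:R^-1 - 1 / (m.+1%:R + n%:R) : R))).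
  rewrite /harmonic_number big_nat_recr//=; apply: cvgD; first exact: IH.
  rewrite -[X in _ --> X]subr0; apply: cvgB; first exact: cvg_cst.
  exact: cvg_div_addn.
apply/funext => n; elim: n => [|n IHn]; first by rewrite !big_ord0 addr0 div1r subrr addr0.
rewrite !big_ord_recr/= {}IHn; move: (\sum_(i < n) _) => s.
rewrite -[m.+2%:R]natr1 -[n.+1%:R]natr1 !div1r.
have -> : m.+1%:R + 1 + n%:R = m.+1%:R + (n%:R + 1) :> R by ring.
by move: ((1 + n%:R)^-1) ((m.+1%:R + n%:R)^-1) ((m.+1%:R + (n%:R + 1))^-1) (m.+1%:R^-1 : R) => b1 b2 b3 b4; ring.
Qed.

(** As 1 / (1/2 + k) = 2 / (2 k + 1), the partial sums of the series of psi(1) - psi(1/2) are 2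
    (H_(2n) - H_n). *)
Lemma digamma_half : digamma (1 : R) - digamma (1 / 2 : R) = 2 * ln 2.
Proof.
have h0 : 0 < 1 / 2 :> R by rewrite divr_gt0.
pose hs n := \sum_(k < n) ((1 : R) + k%:R)^-1.
have c1 := cvg_digamma_diff h0 (ltr01 : 0 < 1 :> R).
have E : (fun n => \sum_(k < n) ((1 / 2 + k%:R)^-1 - ((1 : R) + k%:R)^-1)) =
    (fun n => 2 * (hs n.*2 - hs n)).
  apply/funext => n; rewrite /hs; elim: n => [|n IH]; first by rewrite !big_ord0 subrr mulr0.
  rewrite doubleS !big_ord_recr/= IH -[n.*2.+1%:R]natr1 -mul2n natrM.
  move: (\sum_(k < _) _) (\sum_(k < n) _) => s1 s2.
  have n0 : 0 <= n%:R :> R by [].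
  move: (n%:R : R) n0 => m m0.
  by field; rewrite !gt_eqF//; lra.
rewrite E in c1.
have cd : digamma_approx 1 n @[n --> \oo] --> digamma (1 : R) by exact: cvg_digamma.
have cd2 : digamma_approx 1 n.*2 @[n --> \oo] --> digamma (1 : R).
  apply: (cvg_comp _ _ _ cd).
  move=> A1 [N _ NA]; exists N => // n /= Nn; apply: NA => /=.
  by rewrite (leq_trans Nn)// -addnn leq_addr.
have cl : ln (1 + n.*2%:R) - ln (1 + n%:R) @[n --> \oo] --> (ln 2 : R).
  rewrite (_ : (fun n => _) = (fun n => ln 2 - (ln (2 + n.*2%:R) - ln (1 + n.*2%:R)))); last first.
    apply/funext => n; have -> : 2 + n.*2%:R = 2 * (1 + n%:R) :> R.
      by rewrite -mul2n natrM; ring.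
    by rewrite lnM ?posrE ?ltr_wpDr//; ring.
  rewrite -[X in _ --> X]subr0; apply: cvgB; first exact: cvg_cst.
  have c := @cvg_ln_diff 2 1 (ltr0Sn _ _) ltr01.
  apply: (cvg_comp _ _ _ c).
  move=> A1 [N _ NA]; exists N => // n /= Nn; apply: NA => /=.
  by rewrite (leq_trans Nn)// -addnn leq_addr.
have c2 : 2 * (hs n.*2 - hs n) @[n --> \oo] --> 2 * ln 2.
  rewrite (_ : (fun n => _) = (fun n => 2 * ((ln (1 + n.*2%:R) - ln (1 + n%:R)) -
     (digamma_approx 1 n.*2 - digamma_approx 1 n)))); last first.
    by apply/funext => n; rewrite /digamma_approx -/(hs n) -/(hs n.*2); ring.
  rewrite -[ln 2]subr0 -[X in _ - X](subrr (digamma (1 : R))).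
  by apply: cvgMr; exact: (cvgB cl (cvgB cd2 cd)).
by rewrite -(cvg_lim _ c1)// -(cvg_lim _ c2).
Qed.

(** The series of - \int ln v, routed through the points 1/2 and 1: this turns psi(d) into H_(d-1)
    and produces the 2 ln 2 that finally cancels the factor 2 of |x - y| = 2 sqrt v. *)
Lemma cvg_digamma_sum d : (0 < d)%N ->
  \sum_(k < n) ((k%:R + d%:R / 2)^-1 - (k%:R + 2 * (d%:R / 2))^-1) @[n --> \oo] -->
  2 * ln 2 + harmonic_number R (d - 1) - (digamma (d%:R / 2 : R) - digamma (1 / 2 : R)).
Proof.
case: d => // d _; rewrite subn1/=.
have h0 : 0 < 1 / 2 :> R by rewrite divr_gt0.
have a0 : 0 < d.+1%:R / 2 :> R by rewrite divr_gt0.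
have c1 := cvg_digamma_diff h0 (ltr01 : 0 < 1 :> R).
rewrite digamma_half in c1.
have c2 := cvg_digamma_diff h0 a0.
have c3 := @cvg_harmonic_number d.
rewrite (_ : (fun n => _) = (fun n =>
   \sum_(k < n) ((1 / 2 + k%:R)^-1 - (1 + k%:R)^-1)
   + \sum_(k < n) ((1 + k%:R)^-1 - (d.+1%:R + k%:R)^-1)
   - \sum_(k < n) ((1 / 2 + k%:R)^-1 - (d.+1%:R / 2 + k%:R)^-1))).
  exact: (cvgB (cvgD c1 c3) c2).
apply/funext => n; rewrite -big_split/= -sumrB; apply: eq_bigr => k _.
have -> : k%:R + 2 * (d.+1%:R / 2) = d.+1%:R + k%:R :> R by field.
by rewrite [k%:R + _]addrC; ring.
Qed.

End gamma.

(** * Reproducing kernels *)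

Section reproducing_kernel.
Context (R : realType) (d L : nat).
Local Notation S := (unit_sphere R d).
Local Notation mu := (sphere_measure R d).
Local Notation SP := (sphere_polynomials R d).
Implicit Types (K : Rvec R d.+1 -> Rvec R d.+1 -> R).

(* Apply the reproducing property of each kernel to a section of the other. *)
Lemma reproducing_kernel_flip K1 K2 x z : is_reproducing_kernel (SP L) K1 ->
  is_reproducing_kernel (SP L) K2 -> S x -> S z -> K1 z x = K2 x z.
Proof.
move=> H1 H2 Sx Sz; have [V1 E1] := H1 x Sx; have [V2 E2] := H2 z Sz.
have := E2 _ V1; under eq_integral do rewrite mulrC.
by rewrite E1// => -[].
Qed.

Lemma reproducing_kernel_unique K1 K2 x z : is_reproducing_kernel (SP L) K1 ->
  is_reproducing_kernel (SP L) K2 -> S x -> S z -> K1 z x = K2 z x.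
Proof.
by move=> H1 H2 Sx Sz; rewrite (reproducing_kernel_flip H1 H1)// (reproducing_kernel_flip H1 H2).
Qed.

Lemma givensNK i j c s (x : Rvec R d.+1) : sphere_rotation i j c s ->
  givens i j c (- s) (givens i j c s x) = x.
Proof.
move=> [ij s0 cs]; have ji : j != i by rewrite eq_sym.
apply: eq_from_tnth => k.
have [->|ki] := eqVneq k i.
  rewrite !givens_i givens_j//; transitivity ((c ^+ 2 + s ^+ 2) * (tnth x i : R)); first by ring.
  by rewrite cs mul1r.
have [->|kj] := eqVneq k j; last by rewrite !givens_k.
rewrite !givens_j// givens_i; transitivity ((c ^+ 2 + s ^+ 2) * (tnth x j : R)); first by ring.
by rewrite cs mul1r.
Qed.

Lemma sphere_rotationN i j c s : @sphere_rotation R d i j c s -> @sphere_rotation R d i j c (- s).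
Proof. by move=> [ij s0 cs]; split; rewrite ?oppr_eq0// sqrrN. Qed.

(** Both the space and the measure are rotation invariant; combined with uniqueness, this makes the
    kernel invariant. *)
Lemma reproducing_kernel_givens K i j c s : sphere_rotation i j c s ->
  is_reproducing_kernel (SP L) K ->
  is_reproducing_kernel (SP L) (fun x y => K (givens i j c s x) (givens i j c s y)).
Proof.
move=> G HK x Sx; have SG : S (givens i j c s x) by exact/givens_sphere.
have [V E] := HK _ SG; split; first exact: (sphere_polynomials_givens G V).
move=> f Vf.
have Vf' := sphere_polynomials_givens (sphere_rotationN G) Vf.
(* Composed with the rotation G, [F] becomes the wanted integrand f y * K (G y) (G x). *)
pose F y : \bar R := (f (givens i j c (- s) y) * K y (givens i j c s x))%:E.
have mF : measurable_fun S F.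
  by apply/measurable_EFinP; apply: sphere_polynomials_measurable (sphere_polynomialsM Vf' V).
have := E _ Vf'; rewrite -(integral_givens G mF) /= givensNK// => <-.
by apply: eq_integral => y _; rewrite /F givensNK.
Qed.

Section invariance.
Variable K : Rvec R d.+1 -> Rvec R d.+1 -> R.
Hypothesis HK : is_reproducing_kernel (SP L) K.

Lemma kernel_sym x y : S x -> S y -> K x y = K y x.
Proof. by move=> Sx Sy; exact: reproducing_kernel_flip. Qed.

Lemma kernel_givens i j c s x y : sphere_rotation i j c s -> S x -> S y ->
  K (givens i j c s x) (givens i j c s y) = K x y.
Proof.
move=> G Sx Sy.
exact: (reproducing_kernel_unique (reproducing_kernel_givens G HK) HK Sy Sx).
Qed.

End invariance.

(** Clears the coordinates in [J] one by one, moving their mass onto coordinate [i] by rotations of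
    the planes (i, j). That the other coordinates stay put lets [zonal_kernel] keep track of
    coordinate 0. *)
Lemma rotation_reduce (T : Type) (F : Rvec R d.+1 -> T) (i : 'I_d.+1) (J : seq 'I_d.+1) x :
  i \notin J -> S x ->
  (forall j c s y, j \in J -> sphere_rotation i j c s -> S y -> F (givens i j c s y) = F y) ->
  exists y, [/\ S y, F y = F x, forall j, j \in J -> (tnth y j : R) = 0 &
     forall k, k \notin J -> k != i -> tnth y k = tnth x k].
Proof.
elim: J => [|j J IH] iJ Sx FG; first by exists x; split.
move: iJ; rewrite inE negb_or => /andP[ij iJ].
have ji : j != i by rewrite eq_sym.
have [|y [Sy Fy y0 yk]] := IH iJ Sx.
  by move=> l c s z lJ; apply: FG; rewrite inE lJ orbT.
have [yj|yj] := eqVneq (tnth y j : R) 0.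
  exists y; split => //.
    by move=> k; rewrite inE => /predU1P[->//|]; exact: y0.
  by move=> k; rewrite inE negb_or => /andP[_]; exact: yk.
pose r := Num.sqrt ((tnth y i : R) ^+ 2 + (tnth y j : R) ^+ 2).
have r0 : 0 < r.
  by rewrite sqrtr_gt0 ltr_wpDl ?sqr_ge0// exprn_even_gt0.
have r2 : r ^+ 2 = (tnth y i : R) ^+ 2 + (tnth y j : R) ^+ 2.
  by rewrite sqr_sqrtr// addr_ge0// sqr_ge0.
(* This rotation sends (y_i, y_j) to (r, 0). The case y_j = 0 was set aside because it would give s
   = 0. *)
have G : sphere_rotation i j ((tnth y i : R) / r) (- (tnth y j : R) / r).
  split => //; first by rewrite mulf_neq0 ?oppr_eq0// invr_eq0 gt_eqF.
  by rewrite !exprMn sqrrN -mulrDl -r2 exprVn mulfV// expf_neq0// gt_eqF.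
exists (givens i j ((tnth y i : R) / r) (- (tnth y j : R) / r) y); split.
- exact/givens_sphere.
- by rewrite FG// inE eqxx.
- move=> k; rewrite inE => /predU1P[->|kJ]; first by rewrite givens_j//; ring.
  have ki : k != i by apply: contraNneq iJ => <-.
  have [->|kj] := eqVneq k j; first by rewrite givens_j//; ring.
  by rewrite givens_k// y0.
- move=> k; rewrite inE negb_or => /andP[kj kJ] ki.
  by rewrite givens_k// yk.
Qed.

Hypothesis d0 : (0 < d)%N.

Let i1 : 'I_d.+1 := Ordinal (d0 : (1 < d.+1)%N).

Definition plane_point (t s : R) : Rvec R d.+1 :=
  [tuple if k == ord0 then t else if k == i1 then s else 0 | k < d.+1].

Definition pole : Rvec R d.+1 := plane_point 1 0.

Lemma plane_point_sphere t s : t ^+ 2 + s ^+ 2 = 1 -> S (plane_point t s).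
Proof.
move=> ts; apply/sphere_sum; rewrite (bigD1 ord0)//= (bigD1 i1)//= big1.
  by rewrite !tnth_mktuple/= addr0 -ts !expr2.
by move=> k /andP[k0 k1]; rewrite tnth_mktuple (negbTE k0) (negbTE k1) mulr0.
Qed.

Lemma sphere_pole : S pole.
Proof. by apply: plane_point_sphere; rewrite expr1n expr0n addr0. Qed.

Lemma sphere_plane_point y : S y -> (forall k, k != ord0 -> k != i1 -> tnth y k = 0 :> R) ->
  exists t s, y = plane_point t s /\ t ^+ 2 + s ^+ 2 = 1.
Proof.
move=> Sy y0; have yE : y = plane_point (tnth y ord0) (tnth y i1).
  apply: eq_from_tnth => k; rewrite tnth_mktuple.
  have [->//|k0] := eqVneq k ord0; have [->//|k1] := eqVneq k i1; exact: y0.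
exists (tnth y ord0), (tnth y i1); split => //.
have /sphere_sum := Sy; rewrite (bigD1 ord0)//= (bigD1 i1)//= big1 ?addr0//.
by move=> k /andP[k0 k1]; rewrite y0// mulr0.
Qed.

Lemma givens_plane_point t s c s' :
  givens ord0 i1 c s' (plane_point t s) = plane_point (c * t - s' * s) (s' * t + c * s).
Proof.
apply: eq_from_tnth => k; rewrite [RHS]tnth_mktuple.
have [->|k0] := eqVneq k ord0; first by rewrite givens_i !tnth_mktuple.
have [->|k1] := eqVneq k i1; first by rewrite givens_j// !tnth_mktuple.
by rewrite givens_k// tnth_mktuple (negbTE k0) (negbTE k1).
Qed.

(** Once every coordinate but 0 is cleared, the point is the pole or its antipode. *)
Lemma rotation_invariant_const (T : Type) (F : Rvec R d.+1 -> T) x :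
  (forall i j c s y, sphere_rotation i j c s -> S y -> F (givens i j c s y) = F y) ->
  S x -> F x = F pole.
Proof.
move=> FG Sx.
have [||y [Sy <- y0 _]] := @rotation_reduce T F ord0 (enum [pred k | k != ord0]) x _ Sx.
- by rewrite mem_enum inE eqxx.
- by move=> j c s y _; exact: FG.
have [|t [s [yE ts]]] := sphere_plane_point Sy.
  by move=> k k0 _; apply: y0; rewrite mem_enum.
have s0 : s = 0 by have := y0 i1; rewrite yE tnth_mktuple/= mem_enum inE => ->.
move: ts; rewrite yE s0 expr0n addr0 => /eqP; rewrite sqrf_eq1 => /orP[/eqP->//|/eqP->].
(* Two quarter turns bring the antipode to the pole, as the half turn has s = 0. *)
have G : @sphere_rotation R d ord0 i1 0 1 by split=> //; rewrite ?oner_eq0// expr0n expr1n add0r.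
rewrite -(FG _ _ _ _ _ G); last by apply: plane_point_sphere; rewrite sqrrN expr1n expr0n addr0.
rewrite givens_plane_point.
rewrite -(FG _ _ _ _ _ G); last by apply: plane_point_sphere; rewrite !(mulr0, mul0r, mul1r) subr0 expr0n addr0 sqrrN expr1n add0r.
rewrite givens_plane_point /pole; congr (F (plane_point _ _)); ring.
Qed.

(** * Zonal form of the kernel *)

Section zonal.
Variable K : Rvec R d.+1 -> Rvec R d.+1 -> R.
Hypothesis HK : is_reproducing_kernel (SP L) K.

Lemma kernel_diag x : S x -> K x x = K pole pole.
Proof.
apply: (@rotation_invariant_const _ (fun x => K x x)) => i j c s y G Sy.
exact: kernel_givens.
Qed.

(** The rotation taking (t, s) to the pole takes the pole to (t, -s), and [K] is symmetric. On the
    circle no rotation fixing the pole exchanges the two points, so symmetry has to enter. *)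
Lemma kernel_plane_pointN t s : t ^+ 2 + s ^+ 2 = 1 ->
  K (plane_point t (- s)) pole = K (plane_point t s) pole.
Proof.
move=> ts; have [->|s0] := eqVneq s 0; first by rewrite oppr0.
have ts' : t ^+ 2 + (- s) ^+ 2 = 1 by rewrite sqrrN.
have Sp := plane_point_sphere ts; have Sp' := plane_point_sphere ts'; have Se := sphere_pole.
have G : @sphere_rotation R d ord0 i1 t (- s) by split; rewrite ?oppr_eq0.
rewrite -(kernel_givens HK G Sp Se) kernel_sym; [|exact: HK|exact: Sp'|exact: Se].
rewrite !givens_plane_point.
congr (K (plane_point _ _) (plane_point _ _)); rewrite ?(mulr1, mulr0, subr0, addr0)//.
  by rewrite -ts; ring.
by ring.
Qed.

(** Adding the values at s and -s kills the odd powers of s, and the even ones are polynomials in t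
    because s^2 = 1 - t^2. *)
Lemma sphere_polynomials_even f : SP L f -> exists2 q : {poly R}, (size q <= L.+1)%N &
  forall t s, t ^+ 2 + s ^+ 2 = 1 -> f (plane_point t s) + f (plane_point t (- s)) = 2 * q.[t].
Proof.
move: f; apply: sphere_polynomials_ind.
- move=> f g fg [q qL gq]; exists q => // t s ts.
  by rewrite !fg ?gq//; apply: plane_point_sphere; rewrite ?sqrrN.
- by exists 0; rewrite ?size_poly0// => t s _; rewrite horner0 mulr0 addr0.
- move=> f g [p pL fp] [q qL gq]; exists (p + q).
    by rewrite (leq_trans (size_polyD _ _))// geq_max pL qL.
  by move=> t s ts; rewrite hornerD mulrDr -(fp _ _ ts) -(gq _ _ ts); ring.
- move=> c f [p pL fp]; exists (c *: p); first by rewrite (leq_trans (size_scale_leq _ _)).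
  by move=> t s ts; rewrite hornerZ mulrCA -(fp _ _ ts) mulrDr.
move=> m mL.
have mon t s : \prod_i (tnth (plane_point t s) i : R) ^+ m i =
    t ^+ m ord0 * s ^+ m i1 * \prod_(i | (i != ord0) && (i != i1)) (0 : R) ^+ m i.
  rewrite (bigD1 ord0)//= (bigD1 i1)//= !tnth_mktuple/= mulrA; congr (_ * _).
  by apply: eq_bigr => k /andP[/negbTE k0 /negbTE k1]; rewrite tnth_mktuple k0 k1.
(* [c] is 0 if the monomial involves a coordinate outside the plane, and 1 otherwise because
   [0 ^+ 0 = 1]. *)
set c := \prod_(i | _) _ in mon.
have m01 : (m ord0 + m i1 <= L)%N.
  by apply: leq_trans mL; rewrite (bigD1 ord0)//= (bigD1 i1)//= addnA leq_addr.
case odd1 : (odd (m i1)).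
  exists 0; first by rewrite size_poly0.
  by move=> t s ts; rewrite !mon horner0 exprNn -signr_odd odd1 expr1 mulN1r mulr0; ring.
exists (c *: ('X^(m ord0) * (1 - 'X^2) ^+ (m i1)./2)).
  rewrite (leq_trans (size_scale_leq _ _))// (leq_trans (size_polyMleq _ _))//.
  rewrite size_polyXn addSn/= (leq_trans _ (_ : (m ord0 + m i1).+1 <= _)%N)// -addnS leq_add2l.
  rewrite (leq_trans (size_poly_exp_leq _ _))// ltnS.
  rewrite -[X in (_ <= X)%N](odd_double_half (m i1)) odd1 add0n -mul2n leq_mul2r.
  apply/orP; right; rewrite -subn1 leq_subLR (leq_trans (size_polyD _ _))// size_polyN size_polyXn size_poly1//.
move=> t s ts; rewrite !mon.
have -> : (c *: ('X^(m ord0) * (1 - 'X^2) ^+ (m i1)./2)).[t] =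
    c * (t ^+ m ord0 * (1 - t ^+ 2) ^+ (m i1)./2) by rewrite !hornerE.
have s2 : 1 - t ^+ 2 = s ^+ 2 by rewrite -ts addrC addKr.
have se : s ^+ m i1 = (1 - t ^+ 2) ^+ (m i1)./2.
  by rewrite s2 -exprM mul2n -[in LHS](odd_double_half (m i1)) odd1 add0n.
rewrite exprNn -signr_odd odd1 expr0 mul1r se; ring.
Qed.

(** Rotations of planes avoiding coordinate 0 fix the pole and bring [y] into the plane of [ord0]
    and [i1], where K(., pole) equals its even part. Composing with 1 - 2 X expresses coordinate 0
    through [vcoord]. *)
Lemma zonal_kernel : exists2 k : {poly R}, (size k <= L.+1)%N &
  forall y, S y -> K y pole = k.[vcoord y].
Proof.
have [V _] := HK sphere_pole; have [q qL Hq] := sphere_polynomials_even V.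
exists (q \Po (1 - 2 *: 'X)).
  rewrite size_comp_poly2//.
  by rewrite addrC size_polyDl ?size_polyN ?size_scale ?size_polyX ?size_poly1 ?pnatr_eq0.
move=> y Sy.
have [||z [Sz Kz z0 zk]] := @rotation_reduce R (fun y => K y pole) i1
  (enum [pred k | (k != ord0) && (k != i1)]) y _ Sy.
- by rewrite mem_enum inE eqxx andbF.
- move=> j c s z; rewrite mem_enum inE => /andP[j0 j1] G Sz.
  rewrite -[RHS](kernel_givens HK G Sz sphere_pole); congr (K _ _).
  apply: eq_from_tnth => k.
  have pole0 l : l != ord0 -> tnth pole l = 0 :> R.
    by move=> /negbTE l0; rewrite tnth_mktuple l0 if_same.
  have [->|k1] := eqVneq k i1; first by rewrite givens_i !pole0// !mulr0 subr0.
  have [->|kj] := eqVneq k j; last by rewrite givens_k.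
  by rewrite givens_j 1?eq_sym// !pole0// !mulr0 addr0.
rewrite -Kz; have [|t [s [zE ts]]] := sphere_plane_point Sz.
  by move=> k k0 k1; apply: z0; rewrite mem_enum inE k0.
rewrite zE; apply: (mulfI (x := 2)); first by rewrite pnatr_eq0.
have -> : (q \Po (1 - 2 *: 'X)).[vcoord y] = q.[t].
  rewrite horner_comp !hornerE; congr (q.[_]).
  have := zk ord0; rewrite zE tnth_mktuple/= mem_enum inE eqxx => -> //.
  by rewrite /vcoord; field.
by rewrite -(Hq _ _ ts) kernel_plane_pointN//; ring.
Qed.

End zonal.

End reproducing_kernel.

(** * The zonal kernel as a Jacobi polynomial *)

Section jacobi.
Context (R : realType) (d L : nat).
Hypothesis d0 : (0 < d)%N.
Local Notation S := (unit_sphere R d).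
Local Notation mu := (sphere_measure R d).
Local Notation SP := (sphere_polynomials R d).
Local Notation m := (@vint R d).
Local Notation l := (@lint R d).
Local Notation a := (d%:R / 2 : R).
Variable k : {poly R}.
Hypothesis size_k : (size k <= L.+1)%N.
Hypothesis repr_k : forall q : {poly R}, (size q <= L.+1)%N -> m (k * q) = q.[0].
Hypothesis definite : forall r : {poly R}, (size r <= L)%N -> m ('X * r * r) = 0 -> r = 0.

Let lD p q : l (p + q) = l p + l q. Proof. exact: lintD. Qed.
Let lZ c p : l (c *: p) = c * l p. Proof. exact: lintZ. Qed.
Let lB p q : l (p - q) = l p - l q. Proof. by rewrite -scaleN1r lintD// lintZ// mulN1r. Qed.

Let a0 : 0 < a. Proof. exact: a_gt0. Qed.
Let a2 : 0 < 2 * a. Proof. exact: mulr_gt0. Qed.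
Let natDa n : n%:R + a != 0. Proof. exact: lt0r_neq0 (ltr_wpDl (ler0n _ n) a0). Qed.

(** The hypergeometric operator of the Jacobi polynomials for the weight v^a (1 - v)^(a-1), that is,
    up to a constant, v times the Beta(a, a) density. Its eigenvalue in degree n is - n (n + 2
    a). *)
Definition jacobi_op (p : {poly R}) : {poly R} :=
  'X * (1 - 'X) * p^`()^`() + ((a + 1)%:P - (2 * a + 1) *: 'X) * p^`().

(* [jacobi_op] in divergence form; the last term is symmetric in [p] and [q]. *)
Lemma jacobi_op_div (p q : {poly R}) :
  'X * jacobi_op p * q = ('X * (1 - 'X) * ('X * p^`() * q)^`() + a *: ((1 - 2 *: 'X) * ('X * p^`() * q)))
    - 'X ^+ 2 * (1 - 'X) * p^`() * q^`().
Proof.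
rewrite /jacobi_op !derivM derivX -!mul_polyC; move: (a) => b.
rewrite !(polyCD, polyCM, polyC1); move: p^`()^`() p^`() q^`() (b%:P) => p2 p1 q1 c; ring.
Qed.

Lemma vint_jacobi_sym (p q : {poly R}) : m ('X * jacobi_op p * q) = m ('X * p * jacobi_op q).
Proof.
have E (f g : {poly R}) : m ('X * jacobi_op f * g) = - m ('X ^+ 2 * (1 - 'X) * f^`() * g^`()).
  by rewrite jacobi_op_div vintB vintD vintZ vint_by_parts// sub0r.
rewrite E (_ : 'X * p * jacobi_op q = 'X * jacobi_op q * p); last by ring.
by rewrite E; congr (- m _); ring.
Qed.

(** The logarithm breaks the symmetry by terms free of [ln]. One more integration by parts arranges
    them so that [p] is not differentiated: for p = k the reproducing property then evaluates
    them. *)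
Lemma lint_jacobi_skew (p q : {poly R}) : l ('X * jacobi_op p * q) - l ('X * p * jacobi_op q) =
  a * m ((1 - 2 *: 'X) * (p * q)) + 2 * m ('X * (1 - 'X) * p * q^`()).
Proof.
have E (f g : {poly R}) : l ('X * jacobi_op f * g) =
    - m ((1 - 'X) * ('X * f^`() * g)) - l ('X ^+ 2 * (1 - 'X) * f^`() * g^`()).
  rewrite jacobi_op_div lB lD lZ; congr (_ - _).
  by apply/eqP; rewrite -addr_eq0 lint_by_parts.
rewrite (_ : 'X * p * jacobi_op q = 'X * jacobi_op q * p); last by ring.
rewrite !E.
have -> : 'X ^+ 2 * (1 - 'X) * q^`() * p^`() = 'X ^+ 2 * (1 - 'X) * p^`() * q^`() by ring.
have := vint_by_parts d (p * q).
have -> : 'X * (1 - 'X) * (p * q)^`() =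
    (1 - 'X) * ('X * p^`() * q) + 'X * (1 - 'X) * p * q^`() by rewrite derivM; ring.
have -> : (1 - 'X) * ('X * q^`() * p) = 'X * (1 - 'X) * p * q^`() by ring.
rewrite vintD; move: (m _) (m _) (m _) (l _) => x1 x2 x3 x4; lra.
Qed.

Lemma coef_jacobi_op p j : (jacobi_op p)`_j =
  j.+1%:R * (j.+1%:R + a) * p`_j.+1 - j%:R * (j%:R + 2 * a) * p`_j.
Proof.
rewrite /jacobi_op mulrBr mulr1 mulrBl !mulrBl -!mulrA -scalerAl coefD !coefB coefZ.
rewrite !coefXM coefCM !coef_deriv.
move: (a) => b; case: j => [|[|j]] /=.
- by move: (p`_1) (p`_0) => c1 c0; ring.
- by move: (p`_2) (p`_1) => c1 c0; ring.
- by move: (p`_j.+3) (p`_j.+2) => c1 c0; ring.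
Qed.

Local Notation lam := (L%:R * (L%:R + 2 * a) : R).
Local Notation Y i := (m (k * 'X^i)).
Local Notation Xl i := (l (k * 'X^i)).

Lemma vint_kernelXn i : (i <= L)%N -> Y i = (i == 0%N)%:R.
Proof.
by move=> iL; rewrite repr_k ?size_polyXn// hornerXn; case: i iL => [|i] _; rewrite ?expr0// exprS mul0r.
Qed.

Lemma jacobi_opXn i : jacobi_op 'X^i =
  (i%:R * (i%:R + a)) *: 'X^(i.-1) - (i%:R * (i%:R + 2 * a)) *: 'X^i.
Proof.
apply/polyP => j; rewrite coef_jacobi_op coefB !coefZ !coefXn.
case: i => [|i]; first by case: j => [|j] //=; ring.
rewrite /= eqSS; have [->|ji] := eqVneq j i; first by rewrite (_ : i == i.+1 = false) ?mulr0//; elim: i.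
by have [->|] := eqVneq j i.+1; rewrite !mulr0 ?subr0.
Qed.

(** [r] has degree below L because [lam] cancels the coefficient of degree L, and it is orthogonal
    to the lower powers for the form \int v p q, because [jacobi_op] is symmetric and [k] is
    orthogonal to X, ..., X^L. *)
Lemma jacobi_eigen : jacobi_op k = - (lam *: k).
Proof.
pose r := jacobi_op k + lam *: k.
suff r0 : r = 0 by apply/eqP; rewrite -addr_eq0 -/r r0.
have size_r : (size r <= L)%N.
  apply/leq_sizeP => j Lj; rewrite coefD coef_jacobi_op coefZ.
  rewrite [k`_j.+1]nth_default ?(leq_trans size_k)// mulr0 sub0r.
  move: Lj; rewrite leq_eqVlt => /predU1P[<-|Lj]; first by rewrite addNr.
  by rewrite nth_default ?(leq_trans size_k)// !mulr0 oppr0 addr0.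
apply: definite => //.
have rX i : (i < L)%N -> m ('X * r * 'X^i) = 0.
  move=> iL; rewrite /r mulrDr mulrDl vintD vint_jacobi_sym jacobi_opXn.
  have -> : 'X * k * (i%:R * (i%:R + a) *: 'X^(i.-1) - i%:R * (i%:R + 2 * a) *: 'X^i) =
     (i%:R * (i%:R + a)) *: (k * ('X * 'X^(i.-1))) - (i%:R * (i%:R + 2 * a)) *: (k * 'X^(i.+1)).
    by rewrite -!mul_polyC exprS; ring.
  have -> : 'X * (lam *: k) * 'X^i = lam *: (k * 'X^(i.+1)).
    by rewrite -!mul_polyC exprS; ring.
  rewrite vintB !vintZ (vint_kernelXn (i := i.+1))// !mulr0 subr0 addr0.
  case: i iL => [|i] iL; first by rewrite !mul0r.
  by rewrite -exprS/= vint_kernelXn ?mulr0// ltnW.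
rewrite -[X in _ * X]coefK poly_def mulr_sumr.
rewrite (_ : m _ = \sum_(i < size r) m ('X * r * (r`_i *: 'X^i))); last exact: linear_sum.
rewrite big1// => i _; rewrite -scalerAr vintZ rX ?mulr0//.
exact: leq_trans (ltn_ord i) size_r.
Qed.

Lemma kernel_coef_rec j : j.+1%:R * (j.+1%:R + a) * k`_j.+1 = (j%:R * (j%:R + 2 * a) - lam) * k`_j.
Proof.
have := congr1 (fun p : {poly R} => p`_j) jacobi_eigen; rewrite coef_jacobi_op coefN coefZ.
by move=> /eqP; rewrite subr_eq => /eqP ->; ring.
Qed.

(** [lint_jacobi_skew] with q = X^i. Its error terms are multiples of [Y i] and [Y i.+1], all zero
    except that [Y 0 = 1] leaves the term [a]. *)
Lemma lint_kernelXn_rec i : (i < L)%N ->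
  (i%:R * (i%:R + 2 * a) - lam) * Xl i.+1 = i%:R * (i%:R + a) * Xl i + (i == 0%N)%:R * a.
Proof.
move=> iL; have := lint_jacobi_skew k 'X^i.
rewrite jacobi_eigen jacobi_opXn.
have -> : 'X * - (lam *: k) * 'X^i = (- lam) *: (k * 'X^(i.+1)).
  by rewrite -!mul_polyC polyCN exprS; ring.
have -> : 'X * k * (i%:R * (i%:R + a) *: 'X^(i.-1) - i%:R * (i%:R + 2 * a) *: 'X^i) =
   (i%:R * (i%:R + a)) *: (k * ('X * 'X^(i.-1))) - (i%:R * (i%:R + 2 * a)) *: (k * 'X^(i.+1)).
  by rewrite -!mul_polyC exprS; ring.
have -> : (1 - 2 *: 'X) * (k * 'X^i) = k * 'X^i - 2 *: (k * 'X^(i.+1)).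
  by rewrite -!mul_polyC exprS; ring.
have -> : 'X * (1 - 'X) * k * ('X^i)^`() = i%:R *: (k * 'X^i - k * 'X^(i.+1)).
  rewrite derivXn; case: i {iL} => [|i]; first by rewrite mulr0n mulr0 scale0r.
  by rewrite -scaler_nat -!mul_polyC !exprS/=; ring.
rewrite lB !lZ !vintB !vintZ !vintB (vint_kernelXn (i := i.+1))// (vint_kernelXn (i := i)) ?(ltnW iL)//.
case: i iL => [|i] iL; rewrite /= ?mulr0n ?mulr1n.
  by move: (l _) (l _) (l _) => x1 x2 x3; lra.
by rewrite -exprS; move: (l _) (l _) => x1 x2; lra.
Qed.

(* [c_j * \int k v ^+ j ln v] satisfies a first-order recurrence with rational coefficients. *)
Lemma coef_lint_kernelXn j : (0 < j <= L)%N -> k`_j * Xl j = k`_0 * (j%:R^-1 - (j%:R + a)^-1).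
Proof.
case/andP; case: j => // j _; elim: j => [|j IH] jL.
  have L0 : 0 < (L%:R : R) by rewrite ltr0n.
  have lam0 : lam != 0 by exact: lt0r_neq0 (mulr_gt0 L0 (addr_gt0 L0 a2)).
  have E1 := kernel_coef_rec 0; have E2 := lint_kernelXn_rec jL.
  rewrite !mul0r sub0r mul1r add0r in E1 E2.
  rewrite mulr1n mul1r in E2.
  have a1 : 1 + a != 0 := natDa 1.
  apply: (mulfI lam0); apply: (mulfI a1).
  rewrite [LHS]mulrA [LHS]mulrACA.
  have E3 : lam * Xl 1 = - a by rewrite -[LHS]opprK -mulNr E2.
  rewrite E1 E3; move: (lam) (k`_0) => b c; move: (a) a1 => e e1; field.
  by rewrite e1.
have /IH {}IH := ltnW jL.
have j1 : j.+1%:R + a != 0 by exact: natDa.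
have j2 : j.+2%:R + a != 0 by exact: natDa.
have E1 := kernel_coef_rec j.+1; have E2 := lint_kernelXn_rec jL.
rewrite /= mul0r addr0 in E2.
have n2 : (j.+2%:R : R) != 0 by rewrite pnatr_eq0.
have n1 : (j.+1%:R : R) != 0 by rewrite pnatr_eq0.
apply: (mulfI n2); apply: (mulfI j2).
rewrite [LHS]mulrCA [LHS]mulrA [LHS]mulrA E1 [LHS]mulrAC E2.
rewrite -[LHS]mulrA [Xl _ * _]mulrC IH; move: (k`_0) => c.
by move: (j.+1%:R : R) (j.+2%:R : R) n1 n2 (a) j1 j2 => u v n1 n2 e j1 j2; field; rewrite ?n1 ?n2 ?j1 ?j2.
Qed.

Let poly_coef_sum (q : {poly R}) n : (size q <= n)%N -> q = \sum_(i < n) q`_i *: 'X^i.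
Proof.
move=> qn; rewrite -poly_def; apply/polyP => i; rewrite coef_poly.
by case: ltnP => // ni; rewrite nth_default// (leq_trans qn).
Qed.

Lemma vint_poly_sum (p q : {poly R}) n : (size q <= n)%N ->
  m (p * q) = \sum_(i < n) q`_i * m (p * 'X^i).
Proof.
move=> /poly_coef_sum {1}->.
rewrite mulr_sumr (_ : m _ = \sum_(i < n) m (p * (q`_i *: 'X^i))); last exact: linear_sum.
by apply: eq_bigr => i _; rewrite -scalerAr vintZ.
Qed.

Lemma lint_poly_sum (p q : {poly R}) n : (size q <= n)%N ->
  l (p * q) = \sum_(i < n) q`_i * l (p * 'X^i).
Proof.
move=> /poly_coef_sum {1}->.
rewrite mulr_sumr (_ : l _ = \sum_(i < n) l (p * (q`_i *: 'X^i))); last exact: linear_sum.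
by apply: eq_bigr => i _; rewrite -scalerAr lZ.
Qed.

Lemma deriv_prod_linear (I : Type) (r : seq I) (b : I -> R) : (forall i, b i != 0) ->
  (\prod_(i <- r) ('X + (b i)%:P))^`().[0] = (\prod_(i <- r) b i) * \sum_(i <- r) (b i)^-1.
Proof.
move=> b0; elim: r => [|i r IH]; first by rewrite !big_nil derivC hornerC mulr0.
rewrite !big_cons derivM derivD derivX derivC addr0 mul1r hornerD hornerM IH.
rewrite horner_prod hornerD hornerX hornerC add0r.
have -> : \prod_(j <- r) ('X + (b j)%:P).[0] = \prod_(j <- r) b j.
  by apply: eq_bigr => j _; rewrite hornerD hornerX hornerC add0r.
move: (\prod_(j <- r) _) (\sum_(j <- r) _) (b i) (b0 i) => x1 x2 x3 x0; field.
by rewrite x0.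
Qed.

(** In rising factorials, the s + b_ji are the factors of (s + a)_j (s + 2a + j)_(L-j): the ratio of
    the moments s + j and s over the denominator (s + 2a)_L common to all j. *)
Local Notation b j i := ((if (i < j)%N then a else 2 * a) + i%:R : R).

Lemma prod_moment s j : (j <= L)%N ->
  (\prod_(i < L) (s%:R + b j i)) * m 'X^s = (\prod_(i < L) (s%:R + (2 * a + i%:R))) * m 'X^(s + j).
Proof.
elim: j => [|j IH] jL; first by rewrite addn0; congr (_ * _).
have p2 : s%:R + (2 * a + j%:R) != 0 := lt0r_neq0 (ltr_wpDl (ler0n _ s) (ltr_wpDr (ler0n _ j) a2)).
apply: (mulfI p2); rewrite [RHS]mulrCA addnS.
have -> : (s%:R + (2 * a + j%:R)) * m 'X^((s + j).+1) = (s%:R + (a + j%:R)) * m 'X^(s + j).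
  by have := vintXS R d (s + j); rewrite natrD; move: (m _) (m _) => x y; lra.
rewrite [RHS]mulrCA -IH; last exact: ltnW.
rewrite [LHS]mulrA [RHS]mulrA; congr (_ * _).
rewrite (bigD1 (Ordinal jL))//= [in RHS](bigD1 (Ordinal jL))//= ltnS leqnn ltnn.
rewrite (eq_bigr (fun i : 'I_L => s%:R + b j i)); last first.
  move=> i ij; rewrite ltnS leq_eqVlt (_ : (i == j :> nat) = false)//.
  by apply: negbTE; apply: contraNneq ij => ij; apply/eqP/val_inj.
exact: mulrCA.
Qed.

(** Numerator, over (s + 2a)_L, of the quotient of \int k v^s by \int v^s: a polynomial in s of
    degree at most L, compared with the integrals at natural numbers s. *)
Definition moment_poly : {poly R} := \sum_(j < L.+1) k`_j *: \prod_(i < L) ('X + (b j i)%:P).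

Lemma moment_poly_horner s : moment_poly.[s%:R] * m 'X^s =
  (\prod_(i < L) (s%:R + (2 * a + i%:R))) * Y s.
Proof.
have -> : Y s = \sum_(j < L.+1) k`_j * m 'X^(s + j).
  by rewrite mulrC (vint_poly_sum _ size_k); apply: eq_bigr => i _; rewrite -exprD.
rewrite horner_sum mulr_suml mulr_sumr; apply: eq_bigr => -[j jL] _ /=.
rewrite hornerZ horner_prod -mulrA [RHS]mulrCA; congr (_ * _).
rewrite -prod_moment//; congr (_ * _); apply: eq_bigr => i _.
by rewrite hornerD hornerX hornerC.
Qed.

Lemma size_moment_poly : (size moment_poly <= L.+1)%N.
Proof.
apply: (leq_trans (size_sum _ _ _)); apply/bigmax_leqP => j _.
rewrite (leq_trans (size_scale_leq _ _))//.
have H (r : seq 'I_L) : (size (\prod_(i <- r) ('X + (b j i)%:P))%R <= (size r).+1)%N.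
  elim: r => [|i r IH]; first by rewrite big_nil size_poly1.
  rewrite big_cons (leq_trans (size_polyMleq _ _))//= size_XaddC add2n/=.
  by rewrite ltnS.
by apply: leq_trans (H _) _; rewrite /index_enum -enumT size_enum_ord.
Qed.

(** Such a [p] is a constant times the product of the X - i for i = 1, ..., L, so its logarithmic
    derivative at 0 is - H_L; the product form allows p = 0. *)
Lemma deriv0_of_roots (p : {poly R}) : (size p <= L.+1)%N -> (forall i, (i < L)%N -> p.[i.+1%:R] = 0) ->
  p^`().[0] = - p.[0] * \sum_(i < L) i.+1%:R^-1.
Proof.
move=> pL p0; pose rs := [seq (i.+1%:R : R) | i <- iota 0 L].
have urs : uniq_roots rs.
  rewrite uniq_rootsE map_inj_uniq ?iota_uniq// => i j /eqP.
  by rewrite eqr_nat => /eqP[].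
have [q pq] : exists q, p = q * \prod_(z <- rs) ('X - z%:P).
  apply: uniq_roots_prod_XsubC => //; apply/allP => _ /mapP[i + ->].
  by rewrite mem_iota add0n => /= iL; apply/rootP; exact: p0.
have q1 : (size q <= 1)%N.
  have [->|q0] := eqVneq q 0; first by rewrite size_poly0.
  have r0 : \prod_(z <- rs) ('X - z%:P) != 0 by rewrite monic_neq0// monic_prod_XsubC.
  move: pL; rewrite pq size_mul//.
  by rewrite size_prod_XsubC size_map size_iota addnS/= -add1n leq_add2r.
rewrite pq (size1_polyC q1) mul_polyC derivZ !hornerZ.
rewrite big_map.
have -> : \prod_(i <- iota 0 L) ('X - (i.+1%:R : R)%:P) = \prod_(i <- iota 0 L) ('X + (- i.+1%:R : R)%:P).
  by apply: eq_bigr => i _; rewrite polyCN.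
rewrite deriv_prod_linear; last by move=> i; rewrite oppr_eq0 pnatr_eq0.
rewrite horner_prod.
have -> : \prod_(i <- iota 0 L) ('X + (- i.+1%:R : R)%:P).[0] = \prod_(i <- iota 0 L) - i.+1%:R.
  by apply: eq_bigr => i _; rewrite hornerD hornerX hornerC add0r.
have -> : \sum_(i <- iota 0 L) (- i.+1%:R : R)^-1 = - \sum_(i < L) i.+1%:R^-1.
  rewrite -sumrN -(big_mkord xpredT (fun i => - (i.+1%:R^-1 : R))) /index_iota subn0.
  by apply: eq_bigr => i _; rewrite invrN.
by rewrite !mulrN mulrA mulNr.
Qed.

Local Notation D := (\sum_(i < L) (2 * a + i%:R)^-1).

(** Formally, \int k ln v is the derivative of \int k v^s at s = 0. The derivative is taken
    algebraically, on [moment_poly], whose roots and value at 0 come from the reproducing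
    property. *)
Lemma lint_kernel : l k = l 1 - D - \sum_(i < L) i.+1%:R^-1.
Proof.
have m0 s : m 'X^s != 0 by rewrite gt_eqF// vintX_gt0.
have P0 (s : nat) : \prod_(i < L) (s%:R + (2 * a + i%:R)) != 0.
  by apply: lt0r_neq0; apply: prodr_gt0 => i _; exact: ltr_wpDl (ler0n _ s) (ltr_wpDr (ler0n _ i) a2).
have roots i : (i < L)%N -> moment_poly.[i.+1%:R] = 0.
  by move=> iL; apply: (mulIf (m0 i.+1)); rewrite mul0r moment_poly_horner vint_kernelXn// mulr0.
have N0 : moment_poly.[0] = \prod_(i < L) (2 * a + i%:R).
  have := moment_poly_horner 0; rewrite vint_kernelXn// expr0 vint1 !mulr1 => ->.
  by apply: eq_bigr => i _; rewrite add0r.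
have := deriv0_of_roots size_moment_poly roots; rewrite N0.
have b0 j i : b j i != 0 by apply: lt0r_neq0; apply: ltr_wpDr (ler0n _ _) _; case: ifP.
have -> : moment_poly^`().[0] = \sum_(j < L.+1) k`_j * ((\prod_(i < L) b j i) * \sum_(i < L) (b j i)^-1).
  rewrite raddf_sum horner_sum; apply: eq_bigr => j _.
  by rewrite /= derivZ hornerZ deriv_prod_linear.
have E (j : 'I_L.+1) : k`_j * ((\prod_(i < L) b j i) * \sum_(i < L) (b j i)^-1) =
    (\prod_(i < L) (2 * a + i%:R)) * (k`_j * l 'X^j + (D - l 1) * (k`_j * m 'X^j)).
  have -> : \prod_(i < L) b j i = (\prod_(i < L) (2 * a + i%:R)) * m 'X^j.
    have := prod_moment 0 (leq_ord j); rewrite expr0 vint1 mulr1 add0n.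
    by under eq_bigr do rewrite add0r; under [X in _ = X * _]eq_bigr do rewrite add0r.
  (* The factors i < j contribute 1 / (a + i) instead of 1 / (2a + i); these differences are the
     increments of [log_ratio]. *)
  have -> : \sum_(i < L) (b j i)^-1 = D - l 1 + log_ratio R d j.
    rewrite log_ratio_sum// addrA subrK.
    rewrite (big_ord_widen L (fun i => (i%:R + a)^-1 - (i%:R + 2 * a)^-1) (leq_ord j)).
    rewrite [X in _ = _ + X]big_mkcond/= -big_split/=; apply: eq_bigr => i _.
    by case: ifP => _; rewrite ?addr0// [i%:R + 2 * a]addrC addrCA subrr addr0 addrC.
  rewrite /log_ratio; move: (\prod_(i < L) _) D (l 1) (l 'X^j) (k`_j) => x1 x2 x3 x4 x5.
  by move: (m 'X^j) (m0 j) => x6 x60; field.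
rewrite (eq_bigr _ (fun j _ => E j)) -mulr_sumr big_split/= -mulr_sumr.
have -> : \sum_(j < L.+1) k`_j * l 'X^j = l k.
  rewrite -[k in RHS]mul1r (lint_poly_sum 1 size_k).
  by apply: eq_bigr => j _; rewrite mul1r.
have -> : \sum_(j < L.+1) k`_j * m 'X^j = 1.
  rewrite -[RHS](vint_kernelXn (i := 0))// mulr1 -[k in RHS]mul1r (vint_poly_sum 1 size_k).
  by apply: eq_bigr => j _; rewrite mul1r.
have : \prod_(i < L) (2 * a + i%:R) != 0.
  by have := P0 0; under eq_bigr do rewrite add0r.
move: (\prod_(i < L) _) (D) (\sum_(i < L) _) (l k) (l 1) => x1 x2 x3 x4 x5 x10.
by rewrite mulr1 mulNr -mulrN => /(mulfI x10); lra.
Qed.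

(** Expand one factor [k] in powers of v. The sum of the 1 / j over j > 0 cancels the H_L of the
    moment j = 0. *)
Lemma lint_kernel_sqr :
  l (k * k) = k.[0] * (l 1 - D - \sum_(i < L) (i.+1%:R + a)^-1).
Proof.
rewrite (lint_poly_sum k size_k) big_ord_recl/= expr0 mulr1 lint_kernel horner_coef0.
have -> : \sum_(i < L) k`_(bump 0 i) * l (k * 'X^(bump 0 i)) =
    k`_0 * \sum_(i < L) (i.+1%:R^-1 - (i.+1%:R + a)^-1).
  by rewrite mulr_sumr; apply: eq_bigr => i _; rewrite coef_lint_kernelXn ?ltn_ord.
rewrite sumrB -mulrDr; congr (_ * _).
by move: D (\sum_(i < L) i.+1%:R^-1) (\sum_(i < L) _) (l 1) => x1 x2 x3 x4; lra.
Qed.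

End jacobi.

(** * Integration over tuples *)

Section density.
Context dT (T : measurableType dT) (R : realType).
Variables (nu : {finite_measure set T -> \bar R}) (m : {sigma_finite_measure set T -> \bar R}).
Variable rho : T -> R.
Hypothesis irho : m.-integrable setT (EFin \o rho).
Hypothesis nuE : forall A, measurable A -> nu A = (\int[m]_(x in A) (rho x)%:E)%E.

(* A density of a measure is almost everywhere its Radon-Nikodym derivative, hence
   almost everywhere nonnegative. *)
Lemma integral_density (f : T -> R) : measurable_fun setT f ->
  m.-integrable setT (EFin \o (fun x => f x * rho x)) ->
  nu.-integrable setT (EFin \o f) /\
  (\int[nu]_x (f x)%:E = \int[m]_x (f x * rho x)%:E)%E.
Proof.
move=> mf ifr.
have dom : nu `<< m.
  apply/null_content_dominatesP => A mA mA0; rewrite nuE//.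
  apply: null_set_integral => //; exact/measurable_funTS/(measurable_int _ irho).
pose g := Radon_Nikodym_SigmaFinite.f nu m.
have mg := Radon_Nikodym_SigmaFinite.f_integrable dom.
have ae1 : ae_eq m setT g (EFin \o rho).
  apply: integral_ae_eq => //; first exact: measurable_int irho.
  by move=> A _ mA; rewrite -Radon_Nikodym_SigmaFinite.f_integral// nuE.
have mrho : measurable_fun setT rho by apply/measurable_EFinP; exact: measurable_int irho.
have key (h : T -> \bar R) : measurable_fun setT h -> (forall x, 0 <= h x)%E ->
    (\int[nu]_x h x = \int[m]_x (h x * (rho x)%:E))%E.
  move=> mh h0; rewrite -(Radon_Nikodym_SigmaFinite.change_of_variables dom)//.
  apply: ae_eq_integral => //.
  - by apply: emeasurable_funM => //; exact: measurable_int mg.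
  - by apply: emeasurable_funM => //; exact/measurable_EFinP.
  - by apply: filterS ae1 => x gx xT; congr (_ * _)%E; exact: gx.
have iabs : m.-integrable setT (EFin \o (fun x => `|f x| * rho x)).
  apply: (le_integrable measurableT) ifr.
    by apply/measurable_EFinP/measurable_funM => //; exact: measurableT_comp.
  by move=> x _; rewrite lee_fin !normrM normr_id.
have inu : nu.-integrable setT (EFin \o f).
  apply/integrableP; split; first exact/measurable_EFinP.
  rewrite key//; last by apply: measurableT_comp => //; exact/measurable_EFinP.
  have /integrableP[_] := iabs; apply: le_lt_trans.
  apply: le_integral => //; last by move=> x _; rewrite -EFinM lee_fin ler_norm.
  exact: integrable_abse.
split => //.
rewrite -(Radon_Nikodym_change_of_variables dom)//.
apply: ae_eq_integral => //.
- apply: emeasurable_funM; first exact/measurable_EFinP.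
  exact/measurable_int/Radon_Nikodym_integrable.
- by apply/measurable_EFinP/measurable_funM.
have : ae_eq m setT (Radon_Nikodym (charge_of_finite_measure nu) m) (EFin \o rho).
  apply: integral_ae_eq => //; [exact: Radon_Nikodym_integrable|exact: measurable_int irho|].
  by move=> A _ mA; rewrite -Radon_Nikodym_integral// -nuE.
by apply: filterS => x gx xT; rewrite (gx xT).
Qed.

End density.

Section product_integral.
Context d1 d2 (T1 : measurableType d1) (T2 : measurableType d2) (R : realType).
Variables (m1 : {sigma_finite_measure set T1 -> \bar R}) (m2 : {sigma_finite_measure set T2 -> \bar R}).

Lemma integrable_prodM (f : T1 -> R) (g : T2 -> R) :
  m1.-integrable setT (EFin \o f) -> m2.-integrable setT (EFin \o g) ->
  (m1 \x m2)%E.-integrable setT (EFin \o (fun z => f z.1 * g z.2)) /\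
  \int[(m1 \x m2)%E]_z (f z.1 * g z.2) = (\int[m1]_x f x) * \int[m2]_x g x.
Proof.
move=> fi gi.
have mf : measurable_fun setT f by apply/measurable_EFinP; exact: measurable_int fi.
have mg : measurable_fun setT g by apply/measurable_EFinP; exact: measurable_int gi.
have mfg : measurable_fun setT (EFin \o (fun z : T1 * T2 => f z.1 * g z.2)).
  by apply/measurable_EFinP/measurable_funM; apply: measurableT_comp.
have ifg : (m1 \x m2)%E.-integrable setT (EFin \o (fun z => f z.1 * g z.2)).
  apply/integrable12ltyP => //=.
  have E x : (\int[m2]_y `|f x * g y|%:E = `|f x|%:E * \int[m2]_y `|g y|%:E)%E.
    under eq_integral do rewrite normrM EFinM.
    by rewrite ge0_integralZl//; apply/measurable_EFinP; exact: measurableT_comp.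
  under eq_integral do rewrite E.
  have /integrableP[_ /= goo] := gi; have /integrableP[_ /= foo] := fi.
  rewrite ge0_integralZr//; first by rewrite lte_mul_pinfty ?integral_ge0// ge0_fin_numE// integral_ge0.
  - by apply/measurable_EFinP; exact: measurableT_comp.
  - exact: integral_ge0.
split => //.
rewrite [LHS]/Rintegral -(integral12_prod_meas1 ifg) /fubini_F/=.
have E x : (\int[m2]_y (f x * g y)%:E = (\int[m2]_y g y * f x)%:E)%E.
  under eq_integral do rewrite EFinM.
  by rewrite integralZl// EFin_Rintegral// -EFinM mulrC.
under eq_integral do rewrite E.
by rewrite [RHS]mulrC -RintegralZl.
Qed.

End product_integral.

Section tuple_fubini.
Context dT (T : measurableType dT) (R : realType).
Variable m : probability T R.
Local Notation M n := (tuple_measure m n).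

Lemma integral_tupleS n (F : n.+1.-tuple T -> R) : measurable_fun setT F ->
  (m \x M n)%E.-integrable setT (EFin \o (F \o @tcons _ T n)) ->
  (M n.+1).-integrable setT (EFin \o F) /\
  \int[M n.+1]_t F t = \int[(m \x M n)%E]_z F (tcons z).
Proof.
move=> mF iF; have mt := @measurable_tcons _ T n.
have mF' : measurable_fun setT (EFin \o F) by exact/measurable_EFinP.
have iF' : (m \x M n)%E.-integrable (@tcons _ T n @^-1` setT) ((EFin \o F) \o @tcons _ T n).
  by rewrite preimage_setT.
split; first exact: (integrable_pushforward mt mF' iF' measurableT).
by congr fine; have := integral_pushforward mt mF' iF' measurableT; rewrite preimage_setT.
Qed.

Lemma measurable_tuple_prod n (f : 'I_n -> T -> R) : (forall i, measurable_fun setT (f i)) ->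
  measurable_fun setT (fun t : n.-tuple T => \prod_i f i (tnth t i)).
Proof.
move=> mf; apply: measurable_prod => i _; apply: measurableT_comp => //; exact: measurable_tnth.
Qed.

Lemma tuple_integral_prod n (f : 'I_n -> T -> R) : (forall i, m.-integrable setT (EFin \o f i)) ->
  (M n).-integrable setT (EFin \o (fun t => \prod_i f i (tnth t i))) /\
  \int[M n]_t (\prod_i f i (tnth t i)) = \prod_i \int[m]_x f i x.
Proof.
elim: n f => [|n IH] f fi.
  under [X in _.-integrable _ X]eq_fun do rewrite big_ord0.
  under eq_Rintegral do rewrite big_ord0.
  rewrite big_ord0; split; first exact: (@finite_measure_integrable_cst _ _ _ (\d_ ([tuple] : 0.-tuple T)) _ 1).
  have := @integral_dirac _ _ ([tuple] : 0.-tuple T) R setT measurableT (cst 1%:E) (measurable_cst _).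
  by rewrite diracT mul1e => /(congr1 fine).
have [i1 e1] := IH (fun i => f (lift ord0 i)) (fun i => fi _).
have mf i : measurable_fun setT (f i) by apply/measurable_EFinP; exact: measurable_int (fi i).
have [i2 e2] := integrable_prodM (fi ord0) i1.
have E z : \prod_i f i (tnth (tcons z) i) = f ord0 z.1 * \prod_i f (lift ord0 i) (tnth z.2 i).
  by rewrite big_ord_recl; congr (_ * _); apply: eq_bigr => i _; case: z => x t; rewrite tnthS.
have [] := @integral_tupleS n (fun t => \prod_i f i (tnth t i)).
- exact: measurable_tuple_prod.
- by apply: eq_integrable i2 => // z _ /=; rewrite E.
move=> -> ->; split => //; under eq_Rintegral do rewrite E.
by rewrite e2 e1 big_ord_recl.
Qed.

(** With the head x frozen, H x is absorbed into the factor of coordinate [q] and the integrand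
    becomes a product over coordinates. The bound [C], uniform in x, gives integrability. *)
Lemma tuple_integral_pair0 n (q : 'I_n) (f : 'I_n.+1 -> T -> R) (H : T -> T -> R) C :
  (forall i, measurable_fun setT (f i)) -> (forall i, exists B, forall x, `|f i x| <= B) ->
  measurable_fun setT (fun z => H z.1 z.2) ->
  (forall x, (\int[m]_y `|H x y|%:E <= C%:E)%E) ->
  (M n.+1).-integrable setT
    (EFin \o (fun t => H (tnth t ord0) (tnth t (lift ord0 q)) * \prod_i f i (tnth t i))) /\
  \int[M n.+1]_t (H (tnth t ord0) (tnth t (lift ord0 q)) * \prod_i f i (tnth t i)) =
  (\int[m]_x \int[m]_y (H x y * (f ord0 x * f (lift ord0 q) y))) *
   \prod_(i | (i != ord0) && (i != lift ord0 q)) \int[m]_x f i x.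
Proof.
move=> mf /choice[B fB] mH HC.
have mHx x : measurable_fun setT (H x).
  apply: (measurableT_comp (f := fun z => H z.1 z.2) (g := pair x)) => //.
have ifi i : m.-integrable setT (EFin \o f i).
  apply: (le_integrable measurableT) (finite_measure_integrable_cst m (B i) measurableT).
    exact/measurable_EFinP.
  by move=> x _; rewrite lee_fin (le_trans (fB i x))// ler_norm.
have iHx x : m.-integrable setT (EFin \o H x).
  apply/integrableP; split; first exact/measurable_EFinP.
  by apply: le_lt_trans (HC x) _; rewrite ltry.
pose F (t : n.+1.-tuple T) := H (tnth t ord0) (tnth t (lift ord0 q)) * \prod_i f i (tnth t i).
have mF : measurable_fun setT F.
  apply: measurable_funM; last exact: measurable_tuple_prod.
  apply: (measurableT_comp (f := fun z => H z.1 z.2)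
     (g := fun t : n.+1.-tuple T => (tnth t ord0, tnth t (lift ord0 q)))) => //.
  by apply: measurable_fun_pair; exact: measurable_tnth.
pose g x i y := (if i == q then H x y else 1) * f (lift ord0 i) y.
have ig x i : m.-integrable setT (EFin \o g x i).
  have [iq|iq] := eqVneq i q; last first.
    by apply: eq_integrable (ifi (lift ord0 i)) => // y _ /=; rewrite /g (negbTE iq) mul1r.
  apply: (le_integrable measurableT) (integrable_norm (real_integrableZl measurableT (B (lift ord0 i)) (iHx x))).
    by rewrite /g iq eqxx; apply/measurable_EFinP/measurable_funM.
  by move=> y _; rewrite /g iq eqxx lee_fin normr_id !normrM mulrC ler_wpM2r// (le_trans (fB _ _))// ler_norm.
have FE x t : F (tcons (x, t)) = f ord0 x * \prod_i g x i (tnth t i).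
  rewrite /F tnthS big_ord_recl mulrCA; congr (_ * _).
  rewrite big_split/= -big_mkcond big_pred1_eq; congr (_ * _).
  by apply: eq_bigr => i _; rewrite tnthS.
have prodM (u : 'I_n -> T -> R) (w : T -> R) : \prod_i \int[m]_x ((if i == q then w x else 1) * u i x) =
    \int[m]_x (w x * u q x) * \prod_(i | i != q) \int[m]_x u i x.
  rewrite (bigD1 q)//= eqxx; congr (_ * _); apply: eq_bigr => i /negbTE ->.
  by apply: eq_Rintegral => x _; rewrite mul1r.
have iF : (m \x M n)%E.-integrable setT (EFin \o (F \o @tcons _ T n)).
  apply/integrable12ltyP.
    by apply/measurable_EFinP; apply: measurableT_comp => //; exact: measurable_tcons.
  pose P := \prod_i `|B i|.
  have P0 : 0 <= P by exact: prodr_ge0.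
  apply: (@le_lt_trans _ _ (P * C)%:E); last exact: ltry.
  rewrite -[leRHS]mule1 -(probability_setT m) -integral_cst//.
  apply: ge0_le_integral => //.
  - by move=> x _; exact: integral_ge0.
  - apply: (measurable_fun_fubini_tonelli_F (abse \o (EFin \o (F \o @tcons _ T n)))) => //.
    apply: measurableT_comp => //; apply/measurable_EFinP; apply: measurableT_comp => //.
    exact: measurable_tcons.
  - by move=> z; exact: abse_ge0.
  (* The trailing factor 1 gives [u] the shape required by [prodM]. *)
  move=> x _; pose u (i : 'I_n) y := (if i == q then `|H x y| else 1) * 1.
  have iu i : m.-integrable setT (EFin \o u i).
    rewrite /u; have [iq|iq] := eqVneq i q.
      by apply: eq_integrable (integrable_norm (iHx x)) => // y _ /=; rewrite mulr1.
    by apply: eq_integrable (finite_measure_integrable_cst m 1 measurableT) => // y _ /=; rewrite mulr1.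
  have [i1 e1] := tuple_integral_prod iu.
  have int1 : \int[m]_x (1 : R) = 1.
    by rewrite Rintegral_cst// mul1r [X in fine X](_ : _ = 1%E)//; exact: probability_setT.
  have {}e1 : \int[M n]_t (\prod_i u i (tnth t i)) = \int[m]_y `|H x y|.
    rewrite e1 /u (prodM (fun _ _ => 1) (fun y => `|H x y|)) int1 big1// mulr1.
    by apply: eq_Rintegral => y _; rewrite mulr1.
  apply: (@le_trans _ _ (\int[M n]_t (P * \prod_i u i (tnth t i))%:E)%E).
    apply: ge0_le_integral => //.
    - apply: measurableT_comp => //; apply/measurable_EFinP; apply: measurableT_comp => //.
      by apply: measurableT_comp => //; exact: measurable_tcons.
    - by apply/measurable_EFinP/measurable_funM => //; apply/measurable_EFinP; exact: measurable_int i1.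
    move=> t _; rewrite lee_fin /= /F tnthS normrM mulrC normr_prod.
    apply: ler_pM => //.
    - exact: prodr_ge0.
    - by apply: ler_prod => i _; rewrite normr_ge0 (le_trans (fB _ _))// ler_norm.
    - by rewrite big_split/= -big_mkcond big_pred1_eq big1// mulr1.
  rewrite (EFin_Rintegral measurableT); last exact: (real_integrableZl measurableT).
  rewrite RintegralZl// e1 lee_fin ler_wpM2l// -lee_fin -EFin_Rintegral ?HC//.
  exact: integrable_norm.
have [-> ->] := integral_tupleS mF iF; split => //.
have iFF := integrable_fubini_F iF.
set P := \prod_(i | _) _.
pose J x := \int[m]_y (H x y * (f ord0 x * f (lift ord0 q) y)).
have FJ x : (\int[M n]_t (F (tcons (x, t)))%:E = (J x * P)%:E)%E.
  under eq_integral do rewrite FE.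
  have [i1 e1] := tuple_integral_prod (ig x).
  rewrite (EFin_Rintegral measurableT); last exact: (real_integrableZl measurableT).
  rewrite RintegralZl// e1 (prodM (fun i => f (lift ord0 i)) (H x)) mulrA; congr (_ * _)%:E.
    rewrite -RintegralZl//; last first.
      by apply: eq_integrable (ig x q) => // y _ /=; rewrite /g eqxx.
    by apply: eq_Rintegral => y _; rewrite mulrCA.
  rewrite /P [RHS]big_mkcond big_ord_recl eqxx/= mul1r big_mkcond; apply: eq_bigr => i _.
  by rewrite (inj_eq lift_inj).
rewrite [LHS]/Rintegral -(integral12_prod_meas1 iF) /fubini_F/=.
move: iFF; rewrite /fubini_F/=; under eq_fun do rewrite FJ; move=> iJ.
(* Integrability of [J] is deduced from that of [J * P] by division; if P = 0 both sides vanish. *)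
have [P0|P0] := eqVneq P 0; first by rewrite P0 mulr0; under eq_integral do rewrite mulr0; rewrite integral0.
rewrite -RintegralZr//.
apply: eq_integrable (integrableZr measurableT P^-1 iJ) => // x _ /=.
by rewrite -EFinM mulfK.
Qed.

Section dominated.
Variables (G H : T -> T -> R) (C D : R).
Hypothesis D0 : 0 <= D.
Hypothesis mG : measurable_fun setT (fun z : T * T => G z.1 z.2).
Hypothesis mH : measurable_fun setT (fun z : T * T => H z.1 z.2).
Hypothesis GH : forall x y, `|G x y| <= D * `|H x y|.
Hypothesis HC : forall x, (\int[m]_y `|H x y|%:E <= C%:E)%E.

Let mGx x : measurable_fun setT (G x).
Proof. exact: (measurableT_comp (f := fun z => G z.1 z.2) (g := pair x)). Qed.
Let mGy y : measurable_fun setT (G ^~ y).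
Proof. exact: (measurableT_comp (f := fun z => G z.1 z.2) (g := pair ^~ y)). Qed.
Let mHx x : measurable_fun setT (H x).
Proof. exact: (measurableT_comp (f := fun z => H z.1 z.2) (g := pair x)). Qed.
Let mHy y : measurable_fun setT (H ^~ y).
Proof. exact: (measurableT_comp (f := fun z => H z.1 z.2) (g := pair ^~ y)). Qed.

Let bound (u v : T -> R) : measurable_fun setT u -> measurable_fun setT v ->
    (forall x, `|u x| <= D * `|v x|) -> (\int[m]_x `|v x|%:E <= C%:E)%E ->
    (\int[m]_x `|u x|%:E <= (D * C)%:E)%E.
Proof.
move=> mu mv uv vC.
apply: (@le_trans _ _ (\int[m]_x (D%:E * `|v x|%:E))%E).
  apply: ge0_le_integral => //.
  - by apply/measurable_EFinP; exact: measurableT_comp.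
  - by apply/measurable_EFinP/measurable_funM => //; exact: measurableT_comp.
  - by move=> x _; rewrite -EFinM lee_fin.
rewrite ge0_integralZl//; first by rewrite EFinM lee_wpmul2l// lee_fin.
by apply/measurable_EFinP; exact: measurableT_comp.
Qed.

Let EFin_bounded (u v : T -> R) : measurable_fun setT u -> measurable_fun setT v ->
    (forall x, `|u x| <= D * `|v x|) -> (\int[m]_x `|v x|%:E <= C%:E)%E ->
    (\int[m]_x u x)%:E = (\int[m]_x (u x)%:E)%E.
Proof.
move=> mu mv uv vC; rewrite EFin_Rintegral//; apply/integrableP; split; first exact/measurable_EFinP.
by apply: le_lt_trans (bound mu mv uv vC) _; rewrite ltry.
Qed.

Lemma integrable_dominated : (m \x m)%E.-integrable setT (fun z => (G z.1 z.2)%:E).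
Proof.
apply/integrable12ltyP; first exact/measurable_EFinP.
apply: (@le_lt_trans _ _ (D * C)%:E); last exact: ltry.
rewrite -[leRHS]mule1 -(probability_setT m) -integral_cst//.
apply: ge0_le_integral => //.
- by move=> x _; exact: integral_ge0.
- apply: (measurable_fun_fubini_tonelli_F (abse \o (fun z => (G z.1 z.2)%:E))) => //.
    by apply: measurableT_comp => //; exact/measurable_EFinP.
  by move=> z; exact: abse_ge0.
- by move=> x _; exact: (bound (mGx x) (mHx x) (GH x) (HC x)).
Qed.

Lemma Rintegral_prod_dominated :
  \int[(m \x m)%E]_z G z.1 z.2 = \int[m]_x \int[m]_y G x y.
Proof.
rewrite [LHS]/Rintegral -(integral12_prod_meas1 integrable_dominated); congr fine.
apply: eq_integral => x _; rewrite /fubini_F/=.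
by rewrite -(EFin_bounded (mGx x) (mHx x) (GH x) (HC x)).
Qed.

Lemma Rintegral_swap : (forall y, (\int[m]_x `|H x y|%:E <= C%:E)%E) ->
  \int[m]_x \int[m]_y G x y = \int[m]_y \int[m]_x G x y.
Proof.
move=> HC'; rewrite -Rintegral_prod_dominated [LHS]/Rintegral.
rewrite -(integral21_prod_meas1 integrable_dominated); congr fine.
apply: eq_integral => y _; rewrite /fubini_G/=.
by rewrite -(EFin_bounded (mGy y) (mHy y) (GH^~ y) (HC' y)).
Qed.

End dominated.

(** Peel off the head: outside the pair it splits off as a factor; if it is [p] the previous case
    applies; if it is [q] the arguments of [H] are exchanged, at the cost of a Fubini swap that uses
    the bound in the other variable. *)
Lemma tuple_integral_pair n (p q : 'I_n) (f : 'I_n -> T -> R) (H : T -> T -> R) C : p != q ->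
  (forall i, measurable_fun setT (f i)) -> (forall i, exists B, forall x, `|f i x| <= B) ->
  measurable_fun setT (fun z => H z.1 z.2) ->
  (forall x, (\int[m]_y `|H x y|%:E <= C%:E)%E) ->
  (forall y, (\int[m]_x `|H x y|%:E <= C%:E)%E) ->
  (M n).-integrable setT (EFin \o (fun t => H (tnth t p) (tnth t q) * \prod_i f i (tnth t i))) /\
  \int[M n]_t (H (tnth t p) (tnth t q) * \prod_i f i (tnth t i)) =
  (\int[m]_x \int[m]_y (H x y * (f p x * f q y))) *
   \prod_(i | (i != p) && (i != q)) \int[m]_x f i x.
Proof.
move=> pq mf fB mH HC HC'.
elim: n p q f pq mf fB => [[]//|n IH] p q f pq mf fB.
case: (unliftP ord0 p) pq => [p'|] ->; case: (unliftP ord0 q) => [q'|] -> pq; last by rewrite eqxx in pq.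
- have pq' : p' != q' by rewrite -(inj_eq (@lift_inj _ ord0)).
  have [i1 e1] := IH _ _ (fun i => f (lift ord0 i)) pq' (fun i => mf _) (fun i => fB _).
  have if0 : m.-integrable setT (EFin \o f ord0).
    have [B f0B] := fB ord0.
    apply: (le_integrable measurableT) (finite_measure_integrable_cst m B measurableT).
      exact/measurable_EFinP.
    by move=> x _; rewrite lee_fin (le_trans (f0B x))// ler_norm.
  have [i2 e2] := integrable_prodM if0 i1.
  pose F (t : n.+1.-tuple T) := H (tnth t (lift ord0 p')) (tnth t (lift ord0 q')) * \prod_i f i (tnth t i).
  have mF : measurable_fun setT F.
    apply: measurable_funM; last exact: measurable_tuple_prod.
    apply: (measurableT_comp (f := fun z => H z.1 z.2)
       (g := fun t : n.+1.-tuple T => (tnth t (lift ord0 p'), tnth t (lift ord0 q')))) => //.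
    by apply: measurable_fun_pair; exact: measurable_tnth.
  have FE z : F (tcons z) = f ord0 z.1 * (H (tnth z.2 p') (tnth z.2 q') * \prod_i f (lift ord0 i) (tnth z.2 i)).
    case: z => x t; rewrite /F !tnthS big_ord_recl mulrCA; congr (_ * (_ * _)).
    by apply: eq_bigr => i _; rewrite tnthS.
  have iF : (m \x M n)%E.-integrable setT (EFin \o (F \o @tcons _ T n)).
    by apply: eq_integrable i2 => // z _ /=; rewrite FE.
  have [-> ->] := integral_tupleS mF iF; split => //.
  under eq_Rintegral do rewrite FE.
  rewrite e2 e1 mulrCA; congr (_ * _).
  rewrite [RHS]big_mkcond big_ord_recl/= [X in _ * X = _]big_mkcond.
  by congr (_ * _); apply: eq_bigr.
- have mH' : measurable_fun setT (fun z => (fun x y => H y x) z.1 z.2).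
    apply: (measurableT_comp (f := fun z => H z.1 z.2) (g := fun z : T * T => (z.2, z.1))) => //.
    by apply: measurable_fun_pair; [exact: measurable_snd|exact: measurable_fst].
  have [i1 e1] := @tuple_integral_pair0 n p' f (fun x y => H y x) C mf fB mH' HC'.
  split; first exact: i1.
  rewrite [LHS]e1.
  have [B0 f0B] := fB ord0; have [Bp fpB] := fB (lift ord0 p').
  pose G x y := H x y * (f (lift ord0 p') x * f ord0 y).
  have mG : measurable_fun setT (fun z : T * T => G z.1 z.2).
    by apply: measurable_funM => //; apply: measurable_funM; apply: measurableT_comp.
  have GB x y : `|G x y| <= `|Bp| * `|B0| * `|H x y|.
    rewrite /G normrM mulrC ler_wpM2r// normrM.
    by rewrite ler_pM// (le_trans _ (ler_norm _)).
  have D0 : 0 <= `|Bp| * `|B0| by rewrite mulr_ge0.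
  have E : \int[m]_x \int[m]_y (H y x * (f ord0 x * f (lift ord0 p') y)) = \int[m]_x \int[m]_y G x y.
    rewrite (Rintegral_swap D0 mG mH GB HC HC').
    by apply: eq_Rintegral => x _; apply: eq_Rintegral => y _; rewrite /G [f ord0 _ * _]mulrC.
  by rewrite E; under eq_bigl do rewrite andbC.
- exact: tuple_integral_pair0.
Qed.

End tuple_fubini.

(** * Biorthogonal expansion of the kernel *)

Section kernel_expansion.
Context (R : realType) (d L : nat).
Local Notation S := (unit_sphere R d).
Local Notation mu := (sphere_measure R d).
Local Notation SP := (sphere_polynomials R d).
Variable K : Rvec R d.+1 -> Rvec R d.+1 -> R.
Hypothesis HK : is_reproducing_kernel (SP L) K.

Lemma reproducing_kernel_Rintegral f x : SP L f -> S x -> \int[mu]_(y in S) (f y * K y x) = f x.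
Proof. by move=> fL Sx; have [_ /(_ _ fL) /(congr1 fine)] := HK Sx. Qed.

Lemma sphere_polynomials_integrableM f g : SP L f -> SP L g ->
  mu.-integrable S (EFin \o (fun x => f x * g x)).
Proof. by move=> fL gL; exact: sphere_polynomials_integrable (sphere_polynomialsM fL gL). Qed.

(** As \int f^2 = 0, the integral of (g + t f)^2 is the affine function G + 2 t c of t, nonnegative
    for all t, so c = \int f g = 0. Taking g = K(., x) gives f x = 0 at every point, not just almost
    everywhere. *)
Lemma sphere_polynomials_definite f : SP L f -> \int[mu]_(x in S) (f x * f x) = 0 ->
  forall x, S x -> f x = 0.
Proof.
move=> fL f0; have mS := @measurable_sphere R d.
have key g : SP L g -> \int[mu]_(x in S) (f x * g x) = 0.
  move=> gL; set c := \int[mu]_(x in S) _; set G := \int[mu]_(x in S) (g x * g x).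
  have quad t : 0 <= G + 2 * t * c.
    have -> : G + 2 * t * c = \int[mu]_(x in S) ((g x + t * f x) * (g x + t * f x)).
      have ifg := sphere_polynomials_integrableM fL gL.
      have iff := sphere_polynomials_integrableM fL fL.
      have igg := sphere_polynomials_integrableM gL gL.
      have i1 := real_integrableZl mS (2 * t) ifg; have i2 := real_integrableZl mS (t ^+ 2) iff.
      rewrite -RintegralZl// -[LHS]addr0 -[X in _ + X](mulr0 (t ^+ 2)) -f0 -[X in _ + X]RintegralZl//.
      rewrite -RintegralD// -RintegralD//; last exact: real_integrableD.
      by apply: eq_Rintegral => x _; ring.
    by apply: Rintegral_ge0 => x _; exact: sqr_ge0.
  apply/eqP; apply: contraT => c0; have := quad (- (G + 1) / (2 * c)).
  have -> : G + 2 * (- (G + 1) / (2 * c)) * c = -1 by field.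
  by rewrite oppr_ge0 ler10.
move=> x Sx; have [V _] := HK Sx.
by rewrite -(reproducing_kernel_Rintegral fL Sx) key.
Qed.

Section basis.
Variables (n : nat) (b : 'I_n -> Rvec R d.+1 -> R).
Hypothesis bL : forall i, SP L (b i).
Hypothesis b_free : forall c : 'I_n -> R,
  (forall x, S x -> \sum_(i < n) c i * b i x = 0) -> forall i, c i = 0.
Hypothesis b_gen : forall f, SP L f -> exists c : 'I_n -> R,
  forall x, S x -> f x = \sum_(i < n) c i * b i x.

Definition gram : 'M[R]_n := \matrix_(i, j) \int[mu]_(x in S) (b i x * b j x).

Let bx x : 'cV[R]_n := \col_i b i x.

Lemma kernel_coef x : S x -> exists g : 'cV[R]_n,
  gram *m g = bx x /\ forall z, S z -> K z x = \sum_i g i 0 * b i z.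
Proof.
move=> Sx; have [V _] := HK Sx; have [c cK] := b_gen V.
exists (\col_i c i); split; last by move=> z Sz; rewrite cK//; apply: eq_bigr => i _; rewrite mxE.
apply/matrixP => j o; rewrite ord1 !mxE -(reproducing_kernel_Rintegral (bL j) Sx).
rewrite (@eq_Rintegral _ _ _ _ _ (fun z => \sum_i c i * (b j z * b i z))); last first.
  move=> z /set_mem Sz; rewrite cK// mulr_sumr; apply: eq_bigr => i _.
  by rewrite mulrCA.
rewrite Rintegral_sum; [|exact: measurable_sphere|].
  apply: eq_bigr => i _; rewrite !mxE RintegralZl 1?mulrC//; [exact: measurable_sphere|].
  exact: sphere_polynomials_integrableM.
move=> i _; apply: real_integrableZl; [exact: measurable_sphere|exact: sphere_polynomials_integrableM].
Qed.

(** If w gram = 0, then w b(x) = w gram g = 0 for every x by [kernel_coef], and w = 0 because the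
    basis is free. *)
Lemma gram_unit : gram \in unitmx.
Proof.
rewrite -row_free_unit -kermx_eq0; apply/eqP/row_matrixP => i; rewrite row0.
have : row i (kermx gram) *m gram = 0 by rewrite -row_mul mulmx_ker row0.
move: (row i _) => w wA.
apply/rowP => j; rewrite [RHS]mxE; apply: (b_free (c := fun j => w 0 j)) => x Sx.
have [g [gb _]] := kernel_coef Sx.
have : (w *m bx x) 0 0 = 0 by rewrite -gb mulmxA wA mul0mx mxE.
by rewrite mxE => E; rewrite -[RHS]E; apply: eq_bigr => k _; rewrite mxE.
Qed.

(** The family biorthogonal to [b], which replaces an orthonormalization. *)
Definition dual_basis (i : 'I_n) (x : Rvec R d.+1) : R := \sum_j invmx gram i j * b j x.

Lemma sphere_polynomials_dual i : SP L (dual_basis i).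
Proof. by apply: sphere_polynomials_sum => j _; exact: sphere_polynomialsZ. Qed.

Lemma kernel_dual_basis x y : S x -> S y -> K x y = \sum_i b i x * dual_basis i y.
Proof.
move=> Sx Sy; have [g [gb ->//]] := kernel_coef Sy.
apply: eq_bigr => i _; rewrite mulrC; congr (_ * _).
have -> : g = invmx gram *m bx y by rewrite -gb mulKmx// gram_unit.
by rewrite mxE; apply: eq_bigr => j _; rewrite mxE.
Qed.

Lemma dual_basisP i j : \int[mu]_(x in S) (b i x * dual_basis j x) = (i == j)%:R.
Proof.
have mS := @measurable_sphere R d.
rewrite (@eq_Rintegral _ _ _ _ _ (fun x => \sum_k invmx gram j k * (b k x * b i x))); last first.
  by move=> x _; rewrite mulr_sumr; apply: eq_bigr => k _; ring.
rewrite Rintegral_sum//; last first.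
  by move=> k _; apply: real_integrableZl => //; exact: sphere_polynomials_integrableM.
transitivity ((invmx gram *m gram) j i); last by rewrite mulVmx ?gram_unit// mxE eq_sym.
rewrite mxE; apply: eq_bigr => k _; rewrite RintegralZl//; last exact: sphere_polynomials_integrableM.
by rewrite mxE.
Qed.

Lemma Rintegral_kernel_diag : \int[mu]_(x in S) K x x = n%:R.
Proof.
rewrite (@eq_Rintegral _ _ _ _ _ (fun x => \sum_i b i x * dual_basis i x)); last first.
  by move=> x /set_mem Sx; rewrite kernel_dual_basis.
rewrite Rintegral_sum; [|exact: measurable_sphere|].
  by under eq_bigr do rewrite dual_basisP eqxx; rewrite sumr_const card_ord.
by move=> i _; apply: sphere_polynomials_integrableM => //; exact: sphere_polynomials_dual.
Qed.

End basis.

Hypothesis d0 : (0 < d)%N.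
Variable k : {poly R}.
Hypothesis kK : forall y, S y -> K y (pole R d0) = k.[vcoord y].

Lemma vcoord_pole : vcoord (pole R d0) = 0.
Proof. by rewrite /vcoord tnth_mktuple/= subrr mul0r. Qed.

Lemma zonal_repr (q : {poly R}) : (size q <= L.+1)%N -> vint d (k * q) = q.[0].
Proof.
move=> qL; rewrite -vcoord_pole.
rewrite -(reproducing_kernel_Rintegral (sphere_polynomials_horner d qL) (sphere_pole R d0)).
by apply: eq_Rintegral => y /set_mem Sy; rewrite kK// hornerM mulrC.
Qed.

(** v r has degree at most L and (v r)^2 <= v r^2 on [0, 1], so v r vanishes at every point of the
    sphere. *)
Lemma zonal_definite (r : {poly R}) : (size r <= L)%N -> vint d ('X * r * r) = 0 -> r = 0.
Proof.
move=> rL r0; have XL : (size ('X * r)%R <= L.+1)%N.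
  by rewrite (leq_trans (size_polyMleq _ _))// size_polyX.
have fL := sphere_polynomials_horner d XL.
have f2 : \int[mu]_(x in S) (('X * r).[vcoord x] * ('X * r).[vcoord x]) = 0.
  apply/eqP; rewrite eq_le; apply/andP; split; last by apply: Rintegral_ge0 => x _; exact: sqr_ge0.
  rewrite -r0; apply: le_Rintegral.
  - exact: measurable_sphere.
  - exact: sphere_polynomials_integrableM.
  - exact: integrable_horner.
  move=> x Sx; have /andP[v0 v1] := vcoord_itv Sx.
  rewrite !hornerM hornerX; move: (vcoord x) v0 v1 (r.[_]) => v v0 v1 w.
  by have -> : v * w * (v * w) = v * (v * w * w); [ring|rewrite ler_piMl// -mulrA mulr_ge0// sqr_ge0].
have Xr0 := sphere_polynomials_definite fL f2.
(* The values 1 / (i + 1) of v, attained on the sphere, supply more roots than the degree of [r]. *)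
have roots (i : nat) : root r (i.+1%:R^-1).
  have v01 : 0 <= (i.+1%:R^-1 : R) <= 1 by rewrite invr_ge0 ler0n invf_le1 ?ltr0n// ler1n.
  pose t : R := 1 - 2 * i.+1%:R^-1.
  have Sx : S (plane_point d0 t (Num.sqrt (1 - t ^+ 2))).
    apply: plane_point_sphere; rewrite sqr_sqrtr ?subrKC//.
    by rewrite /t; move: (i.+1%:R^-1) v01 => v /andP[v0 v1]; nra.
  have := Xr0 _ Sx; have -> : vcoord (plane_point d0 t (Num.sqrt (1 - t ^+ 2))) = i.+1%:R^-1.
    by rewrite /vcoord tnth_mktuple/= /t; field.
  rewrite hornerM hornerX => /eqP; rewrite mulf_eq0 invr_eq0 pnatr_eq0/=.
  by move=> /eqP r1; exact/rootP.
apply: (@roots_geq_poly_eq0 _ r [seq (i.+1%:R^-1 : R) | i <- iota 0 (size r)]).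
- by apply/allP => _ /mapP[i _ ->].
- rewrite map_inj_uniq ?iota_uniq// => i j /invr_inj /eqP.
  by rewrite eqr_nat => /eqP[].
- by rewrite size_map size_iota.
Qed.

(** K(x, x) is constant on the sphere and its integral is the trace n. *)
Lemma zonal_horner0 n : has_dim_on_sphere (SP L) n -> k.[0] = n%:R.
Proof.
move=> [b [bL b_free b_gen]]; rewrite -(Rintegral_kernel_diag bL b_free b_gen).
rewrite -vcoord_pole -kK; last exact: sphere_pole.
rewrite (@eq_Rintegral _ _ _ _ _ (fun x => K (pole R d0) (pole R d0))); last first.
  by move=> x /set_mem Sx; rewrite (kernel_diag d0 HK).
rewrite Rintegral_cst; last exact: measurable_sphere.
by rewrite [X in fine X](_ : _ = 1%E) ?mulr1//; exact: sphere_measure_sphere.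
Qed.

Hypothesis size_k : (size k <= L.+1)%N.

Lemma lint_zonal_sqr n : has_dim_on_sphere (SP L) n ->
  lint d (k * k) = n%:R * (lint d 1 - \sum_(i < L) (2 * (d%:R / 2) + i%:R)^-1
    - \sum_(i < L) (i.+1%:R + d%:R / 2)^-1).
Proof.
by move=> dimn; rewrite (lint_kernel_sqr d0 size_k zonal_repr zonal_definite) (zonal_horner0 dimn).
Qed.

Lemma vint_zonal_sqr n : has_dim_on_sphere (SP L) n -> vint d (k * k) = n%:R.
Proof. by move=> dimn; rewrite zonal_repr// (zonal_horner0 dimn). Qed.

End kernel_expansion.

(** * The expected energy of the determinantal process *)

Section transposition.
Context (R : comPzRingType) (n : nat).
Implicit Types (s t : 'S_n).

Lemma perm_eq_off2 (p q : 'I_n) s t : p != q ->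
  (forall i, i != p -> i != q -> s i = t i) -> t = s \/ t = (tperm p q * s)%g.
Proof.
move=> pq st.
have img i : (i == p) || (i == q) -> t i = s p \/ t i = s q.
  move=> ipq; have tij : t i = s ((s^-1)%g (t i)) by rewrite permKV.
  move: (s^-1 _)%g tij => j tij; have [jp|jp] := eqVneq j p; first by left; rewrite tij jp.
  have [jq|jq] := eqVneq j q; first by right; rewrite tij jq.
  by move: tij; rewrite st// => /perm_inj ij; move: ipq; rewrite ij (negbTE jp) (negbTE jq).
have imgq : t q = s p \/ t q = s q by apply: img; rewrite eqxx orbT.
have tpq : t p <> t q by move=> /perm_inj /eqP; rewrite (negbTE pq).
have [|tp|tp] := img p; first by rewrite eqxx.
  have tq : t q = s q by case: imgq => // tq; rewrite tq tp in tpq.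
  left; apply/permP => i; have [->//|ip] := eqVneq i p; have [->//|iq] := eqVneq i q.
  by rewrite st.
have tq : t q = s p by case: imgq => // tq; rewrite tq tp in tpq.
right; apply/permP => i; rewrite permM.
have [->|ip] := eqVneq i p; first by rewrite tpermL.
have [->|iq] := eqVneq i q; first by rewrite tpermR.
by rewrite tpermD 1?eq_sym// st.
Qed.

(** The Kronecker factors leave only t = s and t = s with its values at p and q exchanged, of
    opposite signs. *)
Lemma sum_sign_off2 (p q : 'I_n) s (G : 'I_n -> 'I_n -> R) : p != q ->
  \sum_(t : 'S_n) (-1) ^+ s * (-1) ^+ t * (G (t p) (t q) * \prod_(i | (i != p) && (i != q)) (s i == t i)%:R) =
  G (s p) (s q) - G (s q) (s p).
Proof.
move=> pq; set t1 := (tperm p q * s)%g.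
have t1p : t1 p = s q by rewrite permM tpermL.
have t1q : t1 q = s p by rewrite permM tpermR.
have t1s : t1 != s.
  by apply: contraNneq pq => ts; rewrite -(inj_eq (@perm_inj _ s)) -t1q ts.
have prod1 t : (forall i, i != p -> i != q -> s i = t i) ->
    \prod_(i | (i != p) && (i != q)) (s i == t i)%:R = 1 :> R.
  by move=> st; rewrite big1// => i /andP[ip iq]; rewrite st// eqxx.
rewrite (bigD1 s)//= (bigD1 t1)//= [X in _ + (_ + X)]big1 ?addr0; last first.
  move=> t /andP[ts tt1].
  have [/forallP st|/forallPn[i]] := boolP [forall i, (i != p) && (i != q) ==> (s i == t i)].
    have [|E|E] := @perm_eq_off2 p q s t pq; [|by rewrite E eqxx in ts|by rewrite E eqxx in tt1].
    by move=> i ip iq; have := st i; rewrite ip iq => /eqP.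
  rewrite negb_imply => /andP[ipq /negbTE sti].
  by rewrite (bigD1 i)//= sti mul0r !mulr0.
rewrite !prod1//; last by move=> i ip iq; rewrite permM tpermD 1?eq_sym.
rewrite !mulr1 -!signr_addb addbb expr0 mul1r t1p t1q odd_permM odd_tperm pq.
by rewrite addbCA addbb addbF expr1 mulN1r.
Qed.

(** Reindexing by s, every permutation yields the same double sum, to which the zero diagonal can be
    added. *)
Lemma sum_perm_pairs (F : 'I_n -> 'I_n -> R) : (forall a, F a a = 0) ->
  \sum_p \sum_(q | q != p) \sum_(s : 'S_n) F (s p) (s q) = (\sum_a \sum_c F a c) *+ n`!.
Proof.
move=> F0; rewrite (eq_bigr (fun p => \sum_(s : 'S_n) \sum_(q | q != p) F (s p) (s q))); last first.
  by move=> p _; rewrite exchange_big.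
rewrite exchange_big/= (eq_bigr (fun=> \sum_a \sum_c F a c)).
  by rewrite sumr_const card_Sn.
move=> s _; rewrite [RHS](reindex_perm s); apply: eq_bigr => p _.
rewrite [RHS](reindex_perm s) [RHS](bigD1 p)//= F0 add0r.
by [].
Qed.

End transposition.

(** * The logarithmic kernel seen from the pole *)

Section log_kernel.
Context (R : realType) (d : nat).
Hypothesis d0 : (0 < d)%N.
Local Notation S := (unit_sphere R d).
Local Notation mu := (sphere_measure R d).
Local Notation pole := (pole R d0).
Local Notation edist := Defs.edist.
Implicit Types (x y : Rvec R d.+1).

Definition log_kernel x y : R := ln (edist x y)^-1.

(** At distance 0 both sides vanish, by the conventions for inverse and logarithm at 0. *)
Lemma log_kernelE x y : log_kernel x y = - ln (edist x y).
Proof.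
rewrite /log_kernel; have [->|e0] := eqVneq (edist x y) 0; first by rewrite invr0 ln0// oppr0.
by rewrite lnV// posrE lt_neqAle eq_sym e0 sqrtr_ge0.
Qed.

Lemma measurable_log_kernel :
  measurable_fun setT (fun z : Rvec R d.+1 * Rvec R d.+1 => log_kernel z.1 z.2).
Proof.
under eq_fun do rewrite log_kernelE.
apply: measurableT_comp => //; apply: (measurableT_comp (@measurable_ln R)).
apply: (@measurableT_comp _ _ _ _ _ _ (@Num.sqrt R)).
  by apply: continuous_measurable_fun; exact: sqrt_continuous.
apply: (@measurable_sum _ _ _ _ _ _ (fun i (z : Rvec R d.+1 * Rvec R d.+1) =>
  ((tnth z.1 i : R) - tnth z.2 i) ^+ 2)) => i.
apply: measurable_funX; apply: measurable_funB.
  by apply: (measurableT_comp (f := fun x : Rvec R d.+1 => tnth x i)) => //; exact: measurable_tnth.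
by apply: (measurableT_comp (f := fun x : Rvec R d.+1 => tnth x i)) => //; exact: measurable_tnth.
Qed.

Lemma edist_sphere x y : S x -> S y ->
  edist x y = Num.sqrt (2 - 2 * \sum_(i < d.+1) (tnth x i : R) * (tnth y i : R)).
Proof.
move=> /sphere_sum Sx /sphere_sum Sy; congr Num.sqrt.
rewrite (eq_bigr (fun i => (tnth x i : R) * tnth x i + (tnth y i : R) * tnth y i - 2 * ((tnth x i : R) * tnth y i))).
  by rewrite sumrB big_split/= Sx Sy mulr_sumr.
by move=> i _; ring.
Qed.

Lemma log_kernel_givens i j c s x y : sphere_rotation i j c s -> S x -> S y ->
  log_kernel (givens i j c s x) (givens i j c s y) = log_kernel x y.
Proof.
move=> G Sx Sy; rewrite /log_kernel [in LHS]edist_sphere; [|exact/givens_sphere|exact/givens_sphere].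
by case: G => ij _ cs; rewrite sum_givens// -edist_sphere.
Qed.

Lemma edistC x y : edist x y = edist y x.
Proof. by congr Num.sqrt; apply: eq_bigr => i _; rewrite -sqrrN opprB. Qed.

(** |pole - y| = 2 sqrt v. At v = 0 the left side is 0 by convention and the formula fails. *)
Lemma log_kernel_pole y : S y -> vcoord y != 0 ->
  log_kernel pole y = - ln 2 - ln (vcoord y) / 2.
Proof.
move=> Sy v0; have /andP[vge0 _] := vcoord_itv Sy.
have vgt0 : 0 < vcoord y by rewrite lt_neqAle eq_sym v0.
rewrite log_kernelE (edist_sphere (sphere_pole R d0) Sy).
have -> : 2 - 2 * (\sum_(i < d.+1) (tnth pole i : R) * (tnth y i : R)) = 4 * vcoord y.
  rewrite (bigD1 ord0)//= big1; last by move=> i i0; rewrite tnth_mktuple (negbTE i0) if_same mul0r.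
  by rewrite tnth_mktuple/= /vcoord; field.
have -> : 4 * vcoord y = (2 * Num.sqrt (vcoord y)) ^+ 2.
  by rewrite exprMn sqr_sqrtr// -natrX.
rewrite sqrtr_sqr ger0_norm ?mulr_ge0 ?sqrtr_ge0// lnM ?posrE ?sqrtr_gt0//.
rewrite opprD; congr (_ - _).
have {2}<- := sqr_sqrtr vge0; rewrite lnXn ?sqrtr_gt0//.
by rewrite mulr2n; field.
Qed.

Lemma integrable_log_kernel_pole : mu.-integrable S (EFin \o log_kernel pole).
Proof.
have mS := @measurable_sphere R d.
have i0 := finite_measure_integrable_cst mu (ln 2 : R) mS.
have i1 := real_integrableZl mS 2^-1 (integrable_norm (integrable_ln R d0)).
apply: (le_integrable mS) (real_integrableD mS i0 i1).
  apply/measurable_EFinP/measurable_funTS.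
  by apply: (measurableT_comp (f := fun z => log_kernel z.1 z.2) (g := pair pole)) => //; exact: measurable_log_kernel.
move=> y Sy; rewrite lee_fin /=.
have l2 : 0 <= ln 2 :> R by rewrite ln_ge0// ler1n.
have [v0|v0] := eqVneq (vcoord y) 0.
  rewrite log_kernelE (edist_sphere (sphere_pole R d0) Sy).
  rewrite (_ : 2 - _ = 4 * vcoord y).
    by rewrite v0 mulr0 sqrtr0 ln0// oppr0 normr0.
  rewrite (bigD1 ord0)//= big1; last by move=> i i0'; rewrite tnth_mktuple (negbTE i0') if_same mul0r.
  by rewrite tnth_mktuple/= /vcoord; field.
rewrite log_kernel_pole// [leRHS]ger0_norm ?addr_ge0 ?mulr_ge0//.
rewrite (le_trans (ler_normB _ _))// normrN ger0_norm// lerD// normrM mulrC.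
by rewrite ger0_norm ?invr_ge0.
Qed.

Lemma Rintegral_log_kernel_horner (p : {poly R}) :
  mu.-integrable S (EFin \o (fun y => log_kernel pole y * p.[vcoord y])) /\
  \int[mu]_(y in S) (log_kernel pole y * p.[vcoord y]) = - ln 2 * vint d p - lint d p / 2.
Proof.
have mS := @measurable_sphere R d.
have [M M0 pM] := horner_bounded p.
have i0 : mu.-integrable S (EFin \o (fun y => log_kernel pole y * p.[vcoord y])).
  apply: (le_integrable mS) (integrable_norm (real_integrableZl mS M integrable_log_kernel_pole)).
    apply/measurable_EFinP/measurable_funM.
      by apply/measurable_EFinP; exact: measurable_int integrable_log_kernel_pole.
    by apply/measurable_EFinP; exact: measurable_int (integrable_horner d p).
  move=> y Sy; rewrite lee_fin normr_id !normrM (ger0_norm M0) mulrC ler_wpM2r//.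
  exact/pM/vcoord_itv.
split => //.
have i1 := real_integrableZl mS (- ln 2 : R) (integrable_horner d p).
have i2 := real_integrableZl mS 2^-1 (integrable_lint d0 p).
rewrite [lint d p / 2]mulrC -RintegralZl//; last exact: integrable_horner.
rewrite -[X in _ - X]RintegralZl//; last exact: integrable_lint.
(* The pole is removed as a null set, since [log_kernel_pole] excludes it. *)
rewrite -RintegralB// Rintegral_S0// [RHS]Rintegral_S0//; last exact: real_integrableB.
apply: eq_Rintegral => y /set_mem [Sy v0].
rewrite log_kernel_pole//; last by apply/eqP.
by move: (ln 2) (ln (vcoord y)) (p.[_]) => c1 c2 c3; field.
Qed.

(** A rotation of x is undone by rotating y, which leaves the measure unchanged. *)
Lemma invariant_integral (phi : Rvec R d.+1 -> Rvec R d.+1 -> \bar R) x :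
  (forall x, S x -> measurable_fun S (phi x)) ->
  (forall i j c s x y, sphere_rotation i j c s -> S x -> S y ->
     phi (givens i j c s x) (givens i j c s y) = phi x y) ->
  S x -> (\int[mu]_(y in S) phi x y = \int[mu]_(y in S) phi pole y)%E.
Proof.
move=> mphi phiG; apply: (rotation_invariant_const d0 (F := fun x => (\int[mu]_(y in S) phi x y)%E)).
move=> i j c s z G Sz; rewrite -(integral_givens G); last by apply: mphi; exact/givens_sphere.
by apply: eq_integral => y /set_mem Sy; exact: phiG.
Qed.

End log_kernel.

(** * Extension by zero to the ambient space *)

Section zero_extension.
Context (R : realType) (d : nat).
Local Notation S := (unit_sphere R d).
Local Notation mu := (sphere_measure R d).
Local Notation SP := (sphere_polynomials R d).
Implicit Types (f : Rvec R d.+1 -> R).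

(** Functions matter on the sphere only; extended by zero, they can be integrated over the whole
    ambient space, which is where the formulas for tuples are stated. *)
Definition zext f (x : Rvec R d.+1) : R := f x * \1_S x.

Lemma zextE f x : S x -> zext f x = f x.
Proof. by move=> Sx; rewrite /zext indicE mem_set// mulr1. Qed.

Lemma zext0 f x : ~ S x -> zext f x = 0.
Proof. by move=> Sx; rewrite /zext indicE memNset// mulr0. Qed.

Lemma Rintegral_zext f : \int[mu]_x zext f x = \int[mu]_(x in S) f x.
Proof. by rewrite [RHS]Rintegral_mkcond patch_indic. Qed.

Lemma measurable_zext L f : SP L f -> measurable_fun setT (zext f).
Proof.
move=> /sphere_polynomials_measurable_bounded [[g [mg fg]] _].
have -> : zext f = (fun x => g x * \1_S x).
  apply/funext => x; have [Sx|Sx] := pselect (S x); first by rewrite zextE// fg// indicE mem_set// mulr1.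
  by rewrite zext0// indicE memNset// mulr0.
by apply: measurable_funM => //; apply: measurable_indic; exact: measurable_sphere.
Qed.

Lemma bounded_zext L f : SP L f -> exists M, forall x, `|zext f x| <= M.
Proof.
move=> /sphere_polynomials_measurable_bounded [_ [M fM]]; exists `|M| => x.
have [Sx|Sx] := pselect (S x); last by rewrite zext0// normr0.
by rewrite zextE// (le_trans (fM _ Sx))// ler_norm.
Qed.

Definition log_kernel_ext x y := \1_S x * \1_S y * log_kernel x y : R.

Lemma log_kernel_extE x y : S x -> S y -> log_kernel_ext x y = log_kernel x y.
Proof. by move=> Sx Sy; rewrite /log_kernel_ext !indicE !mem_set// !mul1r. Qed.

Lemma log_kernel_extC x y : log_kernel_ext x y = log_kernel_ext y x.
Proof. by rewrite /log_kernel_ext mulrAC [_ * \1_S x]mulrC mulrAC /log_kernel edistC. Qed.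

Lemma measurable_log_kernel_ext :
  measurable_fun setT (fun z : Rvec R d.+1 * Rvec R d.+1 => log_kernel_ext z.1 z.2).
Proof.
have mS : measurable_fun setT (\1_S : _ -> R).
  by apply: measurable_indic; exact: measurable_sphere.
apply: measurable_funM; last exact: measurable_log_kernel.
by apply: measurable_funM; apply: measurableT_comp.
Qed.

Hypothesis d0 : (0 < d)%N.
Local Notation pole := (pole R d0).

Definition log_kernel_norm : R := \int[mu]_(y in S) `|log_kernel pole y|.

(** By rotation invariance the value at the pole bounds all others; off the sphere the integrand is
    0. *)
Lemma integral_log_kernel_ext x : (\int[mu]_y `|log_kernel_ext x y|%:E <= log_kernel_norm%:E)%E.
Proof.
have mS := @measurable_sphere R d; have mh := @measurable_log_kernel R d.
have [Sx|Sx] := pselect (S x); last first.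
  under eq_integral do rewrite /log_kernel_ext indicE memNset// !mul0r normr0.
  by rewrite integral0 lee_fin; apply: Rintegral_ge0.
rewrite /log_kernel_norm -EFin_Rintegral//; last exact/integrable_norm/integrable_log_kernel_pole.
rewrite -(@invariant_integral _ _ d0 (fun x y => `|log_kernel x y|%:E) x)//.
- rewrite [leRHS]integral_mkcond le_eqVlt; apply/orP; left; apply/eqP.
  apply: eq_integral => y _; rewrite epatch_indic /log_kernel_ext !indicE mem_set// mul1r.
  rewrite /= indicE -EFinM; case: (y \in S); first by rewrite mul1r mulr1.
  by rewrite mul0r normr0 mulr0.
- move=> z _; apply/measurable_EFinP/measurable_funTS; apply: measurableT_comp => //.
  exact: (measurableT_comp (f := fun z => log_kernel z.1 z.2) (g := pair z)).
- by move=> i j c s u v G Su Sv; rewrite log_kernel_givens.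
Qed.

End zero_extension.

(** * Leibniz expansion of the expected energy *)

Section determinantal_expectation.
Context (R : realType) (d L n : nat).
Hypothesis d0 : (0 < d)%N.
Local Notation S := (unit_sphere R d).
Local Notation mu := (sphere_measure R d).
Local Notation SP := (sphere_polynomials R d).
Local Notation M := (tuple_measure mu n).
Variables (b c : 'I_n -> Rvec R d.+1 -> R).
Hypothesis bL : forall i, SP L (b i).
Hypothesis cL : forall i, SP L (c i).
Hypothesis bc : forall i j, \int[mu]_(x in S) (b i x * c j x) = (i == j)%:R.
Variable K : Rvec R d.+1 -> Rvec R d.+1 -> R.
Hypothesis Kbc : forall x y, S x -> S y -> K x y = \sum_i b i x * c i y.
Local Notation h := (@log_kernel_ext R d).

Let f i j (x : Rvec R d.+1) := zext (b i) x * zext (c j) x.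

Let mf i j : measurable_fun setT (f i j).
Proof. by apply: measurable_funM; [exact: measurable_zext (bL i)|exact: measurable_zext (cL j)]. Qed.

Let fB i j : exists B, forall x, `|f i j x| <= B.
Proof.
have [A bA] := bounded_zext (bL i); have [B cB] := bounded_zext (cL j).
by exists (A * B) => x; rewrite normrM ler_pM.
Qed.

Let f_int i j : \int[mu]_x f i j x = (i == j)%:R.
Proof.
rewrite -bc -Rintegral_zext; apply: eq_Rintegral => x _; rewrite /f.
by have [Sx|Sx] := pselect (S x); [rewrite !zextE|rewrite !zext0// mul0r].
Qed.

(** The density as a product of two determinants; one point off the sphere makes a row vanish, so it
    is 0 there. *)
Definition determinantal_ext (t : n.-tuple (Rvec R d.+1)) : R :=
  n`!%:R^-1 * (\det (\matrix_(i, l) zext (b l) (tnth t i)) * \det (\matrix_(i, l) zext (c l) (tnth t i))).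

Lemma determinantal_extE t : determinantal_ext t =
  n`!%:R^-1 * \sum_(s : 'S_n) \sum_(u : 'S_n) (-1) ^+ s * (-1) ^+ u * \prod_i f (s i) (u i) (tnth t i).
Proof.
congr (_ * _); rewrite /determinant mulr_suml; apply: eq_bigr => s _.
rewrite mulr_sumr; apply: eq_bigr => u _.
rewrite mulrACA; congr (_ * _); rewrite -big_split/=; apply: eq_bigr => i _.
by rewrite !mxE.
Qed.

Local Notation Sn := [set t : n.-tuple (Rvec R d.+1) | forall i, S (tnth t i)].

Lemma determinantal_ext_sphere t : Sn t -> determinantal_ext t = determinantal_density K t.
Proof.
move=> St; rewrite /determinantal_ext /determinantal_density -[X in _ * X]mulr1 mulr1; congr (_ * _).
rewrite -[X in _ * X]det_tr -det_mulmx; congr (\det _); apply/matrixP => i j; rewrite !mxE Kbc//.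
by apply: eq_bigr => l _; rewrite !mxE !zextE.
Qed.

Lemma determinantal_ext0 t : ~ Sn t -> determinantal_ext t = 0.
Proof.
move=> /existsNP[i Si]; rewrite /determinantal_ext (expand_det_row _ i) big1 ?mul0r ?mulr0//.
by move=> j _; rewrite mxE zext0// mul0r.
Qed.

Lemma determinantal_lawE A : measurable A ->
  determinantal_law K A = (\int[M]_(t in A) (determinantal_ext t)%:E)%E.
Proof.
move=> mA; rewrite /determinantal_law integral_mkcondr; apply: eq_integral => t _.
rewrite epatch_indic/= indicE -EFinM.
have [St|St] := pselect (Sn t); first by rewrite mem_set// mulr1 determinantal_ext_sphere.
by rewrite memNset// mulr0 determinantal_ext0.
Qed.

Let f_integrable i j : mu.-integrable setT (EFin \o f i j).
Proof.
have [B B0] := fB i j.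
apply: (le_integrable measurableT) (finite_measure_integrable_cst mu B measurableT).
  exact/measurable_EFinP.
by move=> x _; rewrite lee_fin (le_trans (B0 x))// ler_norm.
Qed.

Lemma integrable_determinantal_ext : M.-integrable setT (EFin \o determinantal_ext).
Proof.
rewrite (_ : determinantal_ext = fun t => n`!%:R^-1 * \sum_(s : 'S_n) \sum_(u : 'S_n)
    (-1) ^+ s * (-1) ^+ u * \prod_i f (s i) (u i) (tnth t i)); last first.
  by apply/funext => t; exact: determinantal_extE.
apply: real_integrableZl => //; apply: real_integrable_sum => // s _.
apply: real_integrable_sum => // u _; apply: real_integrableZl => //.
by have [] := @tuple_integral_prod _ _ R mu n (fun i => f (s i) (u i)) (fun i => f_integrable _ _).
Qed.

Lemma log_energy_ext t : log_energy t * determinantal_ext t =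
  n`!%:R^-1 * \sum_p \sum_(q | q != p) \sum_(s : 'S_n) \sum_(u : 'S_n) (-1) ^+ s * (-1) ^+ u *
    (h (tnth t p) (tnth t q) * \prod_i f (s i) (u i) (tnth t i)).
Proof.
transitivity ((\sum_p \sum_(q | q != p) h (tnth t p) (tnth t q)) * determinantal_ext t).
  have [St|St] := pselect (Sn t); last by rewrite determinantal_ext0// !mulr0.
  by congr (_ * _); apply: eq_bigr => p _; apply: eq_bigr => q _; rewrite log_kernel_extE.
rewrite determinantal_extE mulrCA; congr (_ * _).
rewrite mulr_suml; apply: eq_bigr => p _; rewrite mulr_suml; apply: eq_bigr => q _.
rewrite mulr_sumr; apply: eq_bigr => s _; rewrite mulr_sumr; apply: eq_bigr => u _.
by rewrite mulrCA.
Qed.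

Let pair_integral (p q : 'I_n) (s u : 'S_n) : q != p ->
  M.-integrable setT (EFin \o (fun t => h (tnth t p) (tnth t q) * \prod_i f (s i) (u i) (tnth t i))) /\
  \int[M]_t (h (tnth t p) (tnth t q) * \prod_i f (s i) (u i) (tnth t i)) =
  (\int[mu]_x \int[mu]_y (h x y * (f (s p) (u p) x * f (s q) (u q) y))) *
   \prod_(i | (i != p) && (i != q)) (s i == u i)%:R.
Proof.
rewrite eq_sym => pq.
have hC y : (\int[mu]_x `|h x y|%:E <= (log_kernel_norm R d0)%:E)%E.
  by under eq_integral do rewrite log_kernel_extC; exact: integral_log_kernel_ext.
have [i1 e1] := @tuple_integral_pair _ _ R mu n p q (fun i => f (s i) (u i)) h (log_kernel_norm R d0) pq
  (fun i => mf _ _) (fun i => fB _ _) (@measurable_log_kernel_ext R d)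
  (integral_log_kernel_ext d0) hC.
split; first exact: i1.
by rewrite [LHS]e1; under [X in _ * X = _]eq_bigr do rewrite f_int.
Qed.

Local Notation W a a' e e' := (\int[mu]_x \int[mu]_y (h x y * (f a a' x * f e e' y))).

(** After integration the sum over [u] collapses by [sum_sign_off2]; the sums over p, q and s then
    give n! copies of one double sum, which cancels the normalization. *)
Lemma integral_log_energy_ext :
  M.-integrable setT (EFin \o (fun t => log_energy t * determinantal_ext t)) /\
  \int[M]_t (log_energy t * determinantal_ext t) = \sum_a \sum_e (W a a e e - W a e e a).
Proof.
have mT : measurable [set: n.-tuple (Rvec R d.+1)] by [].
rewrite (_ : (fun t => _) = fun t => n`!%:R^-1 * \sum_p \sum_(q | q != p) \sum_(s : 'S_n) \sum_(u : 'S_n) (-1) ^+ s * (-1) ^+ u *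
    (h (tnth t p) (tnth t q) * \prod_i f (s i) (u i) (tnth t i))); last first.
  by apply/funext => t; exact: log_energy_ext.
have i4 p q (s u : 'S_n) : q != p -> M.-integrable setT (EFin \o (fun t => (-1) ^+ s * (-1) ^+ u *
    (h (tnth t p) (tnth t q) * \prod_i f (s i) (u i) (tnth t i)))).
  by move=> qp; apply: real_integrableZl => //; have [] := pair_integral s u qp.
have i3 p q (s : 'S_n) : q != p -> M.-integrable setT (EFin \o (fun t => \sum_(u : 'S_n) (-1) ^+ s * (-1) ^+ u *
    (h (tnth t p) (tnth t q) * \prod_i f (s i) (u i) (tnth t i)))).
  by move=> qp; apply: real_integrable_sum => // u _; exact: i4.
have i2 p q : q != p -> M.-integrable setT (EFin \o (fun t => \sum_(s : 'S_n) \sum_(u : 'S_n) (-1) ^+ s * (-1) ^+ u *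
    (h (tnth t p) (tnth t q) * \prod_i f (s i) (u i) (tnth t i)))).
  by move=> qp; apply: real_integrable_sum => // s _; exact: i3.
have i1 p : M.-integrable setT (EFin \o (fun t => \sum_(q | q != p) \sum_(s : 'S_n) \sum_(u : 'S_n) (-1) ^+ s * (-1) ^+ u *
    (h (tnth t p) (tnth t q) * \prod_i f (s i) (u i) (tnth t i)))).
  by apply: real_integrable_sum => // q qp; exact: i2.
have i0 := @real_integrable_sum _ _ _ _ _ mT _ (index_enum _) xpredT _ (fun p _ => i1 p).
split; first exact: real_integrableZl.
rewrite RintegralZl// Rintegral_sum//; last by move=> p _; exact: i1.
have n0 : (n`!%:R : R) != 0 by rewrite pnatr_eq0 -lt0n fact_gt0.
apply: (mulfI n0); rewrite mulVKf// mulr_natl -sum_perm_pairs; last by move=> a; rewrite subrr.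
apply: eq_bigr => p _; rewrite Rintegral_sum//; last exact: i2.
apply: eq_bigr => q qp; rewrite Rintegral_sum//; last by move=> s _; exact: i3.
apply: eq_bigr => s _; rewrite Rintegral_sum//; last by move=> u _; exact: i4.
rewrite -(@sum_sign_off2 _ _ p q s (fun x y => W (s p) x (s q) y)) 1?eq_sym//.
apply: eq_bigr => u _; rewrite RintegralZl//; last by have [] := pair_integral s u qp.
by have [_ ->] := pair_integral s u qp.
Qed.

(** In the exchange terms, b_a(x) c_e(x) b_e(y) c_a(y) regroups into a summand of K(x, y) times a
    summand of K(y, x). *)
Lemma sum_pair_integrals : \sum_a \sum_e (W a a e e - W a e e a) =
  \int[mu]_(x in S) \int[mu]_(y in S) (log_kernel x y * (K x x * K y y - K x y * K y x)).
Proof.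
have /boolp.choice[B fBB] : forall i, exists B : 'I_n -> R, forall j x, `|f i j x| <= B j.
  by move=> i; have /boolp.choice[B] := fB i; exists B.
have mh := @measurable_log_kernel_ext R d; have hC := @integral_log_kernel_ext R d d0.
have mT : measurable [set: Rvec R d.+1 * Rvec R d.+1] by [].
have mff i j k l : measurable_fun setT (fun z : Rvec R d.+1 * Rvec R d.+1 => f i j z.1 * f k l z.2).
  by apply: measurable_funM; apply: measurableT_comp.
have Bff i j k l x y : `|f i j x * f k l y| <= B i j * B k l by rewrite normrM ler_pM.
have BB i j k l : 0 <= B i j * B k l.
  by rewrite mulr_ge0// (le_trans (normr_ge0 _) (fBB _ _ (pole R d0))).
have dom i j k l x y : `|h x y * (f i j x * f k l y)| <= B i j * B k l * `|h x y|.
  by rewrite normrM mulrC ler_wpM2r.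
have iW i j k l : (mu \x mu)%E.-integrable setT
    (EFin \o (fun z => h z.1 z.2 * (f i j z.1 * f k l z.2))).
  apply: (@integrable_dominated _ _ _ mu (fun x y => h x y * (f i j x * f k l y)) h _ _ (BB i j k l) (measurable_funM mh (mff i j k l)) mh (dom i j k l) hC).
have WE i j k l : W i j k l = \int[(mu \x mu)%E]_z (h z.1 z.2 * (f i j z.1 * f k l z.2)).
  by rewrite (@Rintegral_prod_dominated _ _ _ mu (fun x y => h x y * (f i j x * f k l y)) h _ _ (BB i j k l) (measurable_funM mh (mff i j k l)) mh (dom i j k l) hC).
pose U x y := \sum_a \sum_e (f a a x * f e e y - f a e x * f e a y).
transitivity (\int[(mu \x mu)%E]_z (h z.1 z.2 * U z.1 z.2)).
  rewrite (@eq_Rintegral _ _ _ _ _ (fun z => \sum_a \sum_e (h z.1 z.2 * (f a a z.1 * f e e z.2) -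
      h z.1 z.2 * (f a e z.1 * f e a z.2)))); last first.
    move=> z _; rewrite mulr_sumr; apply: eq_bigr => a _; rewrite mulr_sumr; apply: eq_bigr => e _.
    by rewrite mulrBr.
  rewrite Rintegral_sum//; last first.
    by move=> a _; apply: real_integrable_sum => // e _; exact: real_integrableB.
  apply: eq_bigr => a _; rewrite Rintegral_sum//; last by move=> e _; exact: real_integrableB.
  by apply: eq_bigr => e _; rewrite RintegralB// !WE.
pose D := \sum_a \sum_e (B a a * B e e + B a e * B e a).
have D0 : 0 <= D by apply: sumr_ge0 => a _; apply: sumr_ge0 => e _; rewrite addr_ge0.
have UD x y : `|h x y * U x y| <= D * `|h x y|.
  rewrite normrM mulrC ler_wpM2r// (le_trans (ler_norm_sum _ _ _))//; apply: ler_sum => a _.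
  rewrite (le_trans (ler_norm_sum _ _ _))//; apply: ler_sum => e _.
  by rewrite (le_trans (ler_normB _ _))// lerD.
have mU : measurable_fun setT (fun z => h z.1 z.2 * U z.1 z.2).
  apply: measurable_funM => //; apply: measurable_sum => a; apply: measurable_sum => e.
  by apply: measurable_funB; exact: mff.
rewrite (@Rintegral_prod_dominated _ _ _ mu (fun x y => h x y * U x y) h _ _ D0 mU mh UD hC).
rewrite [RHS]Rintegral_mkcond patch_indic; apply: eq_Rintegral => x _ /=.
have [Sx|Sx] := pselect (S x); last first.
  rewrite indicE memNset// mulr0 (@eq_Rintegral _ _ _ _ _ (cst 0)); first by rewrite /Rintegral integral0.
  by move=> y _; rewrite /log_kernel_ext indicE memNset// !mul0r.
rewrite indicE mem_set// mulr1 [RHS]Rintegral_mkcond patch_indic; apply: eq_Rintegral => y _ /=.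
have [Sy|Sy] := pselect (S y); last first.
  by rewrite /log_kernel_ext !indicE [y \in S]memNset// !(mulr0, mul0r).
rewrite log_kernel_extE// indicE mem_set// mulr1; congr (_ * _).
rewrite !Kbc// !big_distrlr -sumrB; apply: eq_bigr => a _; rewrite -sumrB; apply: eq_bigr => e _.
by rewrite /f !zextE//=; ring.
Qed.

End determinantal_expectation.

(** * Closed form of the expected energy *)

Section harmonic_expectation.
Context (R : realType) (d L n : nat).
Hypothesis d0 : (0 < d)%N.
Local Notation S := (unit_sphere R d).
Local Notation mu := (sphere_measure R d).
Local Notation SP := (sphere_polynomials R d).
Local Notation pole := (pole R d0).

Lemma measurable_log_energy : measurable_fun setT (@log_energy R d n).
Proof.
apply: measurable_sum => i.
rewrite (_ : (fun x => _) = fun x => \sum_(j < n) if j != i then log_kernel (tnth x i) (tnth x j) else 0); last first.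
  by apply/funext => x; rewrite big_mkcond.
apply: measurable_sum => j; case: (j != i) => //.
apply: (measurableT_comp (f := fun z => log_kernel z.1 z.2)
  (g := fun x : n.-tuple (Rvec R d.+1) => (tnth x i, tnth x j))).
  exact: measurable_log_kernel.
by apply: measurable_fun_pair; exact: measurable_tnth.
Qed.

Lemma measurable_log_kernel_section x : measurable_fun setT (@log_kernel R d x).
Proof.
by apply: (measurableT_comp (f := fun z => log_kernel z.1 z.2) (g := pair x)) => //; exact: measurable_log_kernel.
Qed.

Lemma V_logE : V_log R d = (- ln 2 - lint d 1 / 2)%:E.
Proof.
have mS := @measurable_sphere R d.
have [i1 e1] := @Rintegral_log_kernel_horner R d d0 1.
rewrite /V_log (eq_integral (fun=> (- ln 2 - lint d 1 / 2)%:E)).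
  rewrite integral_cst//= [X in (_ * X)%E](_ : _ = 1%E) ?mule1//; exact: sphere_measure_sphere.
move=> x /set_mem Sx; rewrite (@invariant_integral _ _ d0 (fun x y => (log_kernel x y)%:E))//.
- rewrite EFin_Rintegral//; last exact: integrable_log_kernel_pole.
  congr EFin; rewrite -[LHS](_ : \int[mu]_(y in S) (log_kernel pole y * (1 : {poly R}).[vcoord y]) = _).
    by rewrite e1 vint1 mulr1.
  by apply: eq_Rintegral => y _; rewrite hornerE mulr1.
- by move=> z _; apply/measurable_EFinP/measurable_funTS; exact: measurable_log_kernel_section.
- by move=> i j c s u v G Su Sv; rewrite log_kernel_givens.
Qed.

Variable K : Rvec R d.+1 -> Rvec R d.+1 -> R.
Hypothesis HK : is_reproducing_kernel (SP L) K.
Hypothesis dimn : has_dim_on_sphere (SP L) n.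

(** The exchange term \int log (1 / |pole - y|) k(v)^2, evaluated by [lint_zonal_sqr]. *)
Local Notation W := (- ln 2 * n%:R - n%:R * (lint d 1 - \sum_(i < L) (2 * (d%:R / 2) + i%:R)^-1
    - \sum_(i < L) (i.+1%:R + d%:R / 2)^-1) / 2 : R).

(** By invariance the inner integral is the one at the pole, where the bracket is n^2 - k(v)^2. *)
Lemma kernel_energy : \int[mu]_(x in S) \int[mu]_(y in S)
    (log_kernel x y * (K x x * K y y - K x y * K y x)) =
  n%:R ^+ 2 * (- ln 2 - lint d 1 / 2) - W.
Proof.
have mS := @measurable_sphere R d.
have [k size_k kK] := zonal_kernel d0 HK.
have k0 := zonal_horner0 HK kK dimn.
have Kxx x : S x -> K x x = n%:R.
  by move=> Sx; rewrite (kernel_diag d0 HK)// kK ?vcoord_pole//; exact: sphere_pole.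
pose q : {poly R} := (n%:R ^+ 2)%:P - k * k.
have [iq eq] := @Rintegral_log_kernel_horner R d d0 q.
have E x : S x -> \int[mu]_(y in S) (log_kernel x y * (K x x * K y y - K x y * K y x)) =
    \int[mu]_(y in S) (log_kernel pole y * q.[vcoord y]).
  move=> Sx; pose phi x y : \bar R := (log_kernel x y * (n%:R ^+ 2 - K y x ^+ 2))%:E.
  transitivity (fine (\int[mu]_(y in S) phi x y)%E).
    apply: eq_Rintegral => y /set_mem Sy.
    by rewrite !Kxx// [K x y](kernel_sym HK)// !expr2.
  rewrite (@invariant_integral _ _ d0 phi)//.
  - apply: eq_Rintegral => y /set_mem Sy.
    by rewrite kK// /q hornerD hornerN hornerC hornerM expr2.
  - move=> z Sz; apply/measurable_EFinP/measurable_funM.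
      by apply: measurable_funTS; exact: measurable_log_kernel_section.
    apply: measurable_funB => //; apply: measurable_funX.
    by have [V _] := HK Sz; exact: sphere_polynomials_measurable V.
  - by move=> i j c s u v G Su Sv; rewrite /phi log_kernel_givens// (kernel_givens HK).
rewrite (@eq_Rintegral _ _ _ _ _ (fun=> \int[mu]_(y in S) (log_kernel pole y * q.[vcoord y]))); last first.
  by move=> x /set_mem Sx; exact: E.
rewrite Rintegral_cst// [X in fine X](_ : _ = 1%E); last exact: sphere_measure_sphere.
have lB (p r : {poly R}) : lint d (p - r) = lint d p - lint d r by exact: linearB.
rewrite mulr1 eq vintB lB (vint_zonal_sqr HK kK size_k dimn) (lint_zonal_sqr HK kK size_k dimn).
rewrite -(alg_polyC (n%:R ^+ 2)) (vintZ d _ 1) (lintZ d0 _ 1) vint1.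
by move: (ln 2) (lint d 1) (n%:R) (\sum_(i < L) _) (\sum_(i < L) _) => x1 x2 x3 x4 x5; field.
Qed.

Lemma lint1E : lint d 1 =
  digamma (d%:R / 2) - digamma (1 / 2) - 2 * ln 2 - harmonic_number R (d - 1).
Proof.
have : - lint d 1 = 2 * ln 2 + harmonic_number R (d - 1) - (digamma (d%:R / 2) - digamma (1 / 2)).
  rewrite -(cvg_lim (@Rhausdorff R) (@cvg_lint1 R d d0)).
  by apply: cvg_lim; [exact: Rhausdorff|exact: cvg_digamma_sum].
move: (lint d 1) (ln 2) (harmonic_number R _) (digamma (d%:R / 2)) (digamma (1 / 2)) => x1 x2 x3 x4 x5.
by lra.
Qed.

(** For m = d - 1 the added sum is that of the 1 / (d + i), which turns H_(d-1) into H_(L+d-1). *)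
Lemma harmonic_numberD m l : harmonic_number R (l + m) =
  harmonic_number R m + \sum_(i < l) (m.+1%:R + i%:R)^-1.
Proof.
elim: l => [|l IH]; first by rewrite big_ord0 addr0.
rewrite big_ord_recr/= addrA -IH addSn /harmonic_number big_nat_recr//=.
by rewrite addnC -addSn natrD.
Qed.

End harmonic_expectation.

Theorem theorem3 (R : realType) (d L n : nat) (hd : (1 <= d)%N)
  (hn : has_dim_on_sphere (sphere_polynomials R d L) n)
  (K : Rvec R d.+1 -> Rvec R d.+1 -> R)
  (hK : is_reproducing_kernel (sphere_polynomials R d L) K)
  (disp : measure_display) (Omega : measurableType disp)
  (P : probability Omega R) (X : {RV P >-> n.-tuple (Rvec R d.+1)})
  (hX : forall A : set (n.-tuple (Rvec R d.+1)), measurable A ->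
    distribution P X A = determinantal_law K A) :
  ('E_P[fun w => log_energy (X w)] =
    (n%:R ^+ 2)%:E * V_log R d -
    (n%:R / 2 * (\sum_(1 <= k < L.+1) (d%:R / 2 + k%:R)^-1
                 + harmonic_number R (L + d - 1)
                 + digamma (1 / 2) - digamma (d%:R / 2)))%:E)%E.
Proof.
have [b [bL b_free b_gen]] := hn.
set mu := sphere_measure R d.
pose c := dual_basis b.
have cL i : sphere_polynomials R d L (c i) by exact: sphere_polynomials_dual.
have bc := dual_basisP hK bL b_free b_gen.
have Kbc x y := @kernel_dual_basis _ _ _ _ hK _ _ bL b_free b_gen x y.
have [iE eE] := integral_log_energy_ext hd bL cL bc.
have lawE A : measurable A ->
    distribution P X A = (\int[tuple_measure mu n]_(t in A) (determinantal_ext b c t)%:E)%E.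
  by move=> mA; rewrite hX// (determinantal_lawE Kbc).
(* The law of [X] has the density [determinantal_ext b c], so the expectation becomes an integral
   over tuples. *)
have [iX eX] := integral_density (integrable_determinantal_ext bL cL) lawE
  (@measurable_log_energy R d n) iE.
have mE : measurable_fun setT (EFin \o @log_energy R d n).
  by apply/measurable_EFinP; exact: measurable_log_energy.
have iP : P.-integrable setT ((EFin \o @log_energy R d n) \o X).
  apply/integrableP; split; first exact: measurableT_comp.
  rewrite -(ge0_integral_distribution X (f := abse \o (EFin \o @log_energy R d n))).
  - by have /integrableP[] := iX.
  - exact: measurableT_comp.
  - by move=> t; exact: abse_ge0.
rewrite unlock -[LHS](integral_distribution (X := X) mE iP).
rewrite [LHS]eX EFin_Rintegral// eE (sum_pair_integrals hd bL cL Kbc).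
rewrite (kernel_energy hd hK hn) V_logE// -EFinM -EFinB; congr EFin.
have -> : harmonic_number R (L + d - 1) =
    harmonic_number R (d - 1) + \sum_(i < L) (2 * (d%:R / 2) + i%:R)^-1.
  rewrite -addnBA// harmonic_numberD; congr (_ + _); apply: eq_bigr => i _.
  by rewrite mulrC divfK ?pnatr_eq0// subn1 prednK.
have -> : \sum_(1 <= k < L.+1) (d%:R / 2 + k%:R)^-1 = \sum_(i < L) (i.+1%:R + d%:R / 2)^-1 :> R.
  by rewrite big_add1/= big_mkord; apply: eq_bigr => i _; rewrite addrC.
(* The 2 ln 2 contained in [lint d 1] cancels the ln 2 of the exchange term. *)
rewrite lint1E//.
move: (digamma (d%:R / 2)) (digamma (1 / 2)) (ln 2) (harmonic_number R (d - 1)) (n%:R)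
  (\sum_(i < L) _) (\sum_(i < L) _) => x1 x2 x3 x4 x5 x6 x7.
by field.
Qed.
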